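(* Let $\mathbb{D}_{12}=\{\tau\in\mathbb{H}\mid -1<\mathrm{Re}(\tau)\le 1,\ |\tau|>1\}\cup\{\tau\in\mathbb{H}\mid |\tau|=1,\ 0\le \mathrm{Re}(\tau)\le 1\}$ and, for $\tau\in\mathbb{D}_{12}$, set $$\zeta(\tau)=\frac{4\vartheta_{01}(\tau)^4\vartheta_{10}(\tau)^4}{\vartheta_{00}(\tau)^8}.$$ Then for every $\tau\in\mathbb{D}_{12}$ $$F\Big(\tfrac14,\tfrac14,1;\zeta(\tau)\Big)=\vartheta_{00}(\tau)^2,$$ and for every $\tau\in\mathbb{D}_{12}$ with $\zeta(\tau)\ne 1$ $$F\Big(\tfrac34,\tfrac34,1;\zeta(\tau)\Big)=\frac{\vartheta_{00}(\tau)^6}{\vartheta_{01}(\tau)^4-\vartheta_{10}(\tau)^4}.$$ Here $F$ is the extension of the hypergeometric series to a single-valued function on $\mathbb{C}-\{1\}$ described in the context; in the first formula, if $\zeta(\tau)=1$ (which happens only at $\tau=\sqrt{-1}$), $F(\frac14,\frac14,1;1)$ denotes $\lim_{z\to1,|z|<1}F(\frac14,\frac14,1;z)$.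
   Context: $\mathbb{H}=\{\tau\in\mathbb{C}\mid \mathrm{Im}(\tau)>0\}$ and $\mathbf{i}=\sqrt{-1}$. For $p,q\in\{0,1\}$ and $\tau\in\mathbb{H}$ the theta constant is $\vartheta_{pq}(\tau)=\sum_{n=-\infty}^\infty \exp\big(\pi\mathbf{i}(n+\frac p2)^2\tau+2\pi\mathbf{i}(n+\frac p2)\frac q2\big)$. The hypergeometric series is $F(a,b,c;z)=\sum_{n=0}^\infty\frac{(a,n)(b,n)}{(c,n)(1,n)}z^n$ for $|z|<1$, where $(a,n)=a(a+1)\cdots(a+n-1)$. It is extended to $\mathbb{C}-[1,\infty)$ by analytic continuation on this simply connected domain (same symbol $F$), and for $t\in(1,\infty)$ the value $F(a,b,c;t)$ is defined as the limit of $F(a,b,c;z)$ as $z\to t$ with $\mathrm{Im}(z)>0$. This gives a single-valued (in general discontinuous along $(1,\infty)$) function on $\mathbb{C}-\{1\}$. *)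

(* Defs.v *)
From Stdlib Require Import Reals ZArith ClassicalEpsilon.
From Coquelicot Require Import Coquelicot.

Open Scope C_scope.

Definition Cexp (z : C) : C := RtoC (exp (Re z)) * (cos (Im z), sin (Im z)).

(* [iota] picks the unique limit; the value is junk when there is no limit. *)
Definition Clim {T : Type} (F : (T -> Prop) -> Prop) (f : T -> C) : C :=
  iota (fun l : C_CompleteNormedModule => filterlim f F (locally l)).

Definition Csum (a : nat -> C) : C :=
  iota (fun l : C_CompleteNormedModule => is_series a l).

Definition CsumZ (a : Z -> C) : C :=
  Csum (fun n => a (Z.of_nat n)) + Csum (fun n => a (- Z.of_nat (S n))%Z).

(* Only p, q in {0, 1} are used. *)
Definition theta (p q : nat) (tau : C) : C :=
  CsumZ (fun n : Z =>
    let m := RtoC (IZR n + INR p / 2) in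
    Cexp (PI * Ci * m ^ 2 * tau + 2 * PI * Ci * m * RtoC (INR q / 2))).

Definition zeta (tau : C) : C :=
  4 * theta 0 1 tau ^ 4 * theta 1 0 tau ^ 4 / theta 0 0 tau ^ 8.

Definition D12 (tau : C) : Prop :=
  (0 < Im tau /\ -1 < Re tau <= 1 /\ 1 < Cmod tau)%R \/
  (0 < Im tau /\ Cmod tau = 1 /\ 0 <= Re tau <= 1)%R.

Fixpoint poch (a : C) (n : nat) : C :=
  match n with
  | O => 1
  | S m => poch a m * (a + RtoC (INR m))
  end.

Definition hyper_coeff (a b c : C) (n : nat) : C :=
  (poch a n * poch b n) / (poch c n * poch 1 n).

(* The values of f on the cut [1, +oo) are unconstrained. *)
Definition is_hyper_continuation (a b c : C) (f : C -> C) : Prop :=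
  (forall z : C, ~ (1 <= Re z /\ Im z = 0)%R ->
     ex_derive (K := C_AbsRing) (V := C_NormedModule) f z) /\
  (forall z : C, (Cmod z < 1)%R ->
     is_pseries (K := C_AbsRing) (V := C_NormedModule)
       (hyper_coeff a b c) z (f z)).

(* By the identity theorem, the choice is unambiguous off the cut. *)
Definition hyper_continuation (a b c : C) : C -> C :=
  epsilon (inhabits (fun _ : C => RtoC 0)) (is_hyper_continuation a b c).

(* Values on (1, +oo) are limits from the upper half-plane; the value at 1 is
   the limit from inside the unit disc. *)
Definition hyperF (a b c z : C) : C :=
  if Ceq_dec z 1 then
    Clim (within (fun w : C => (Cmod w < 1)%R)
            (locally (T := C_UniformSpace) (RtoC 1)))
         (hyper_continuation a b c)
  else if excluded_middle_informative (1 < Re z /\ Im z = 0)%R then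
    Clim (within (fun w : C => (0 < Im w)%R) (locally (T := C_UniformSpace) z))
         (hyper_continuation a b c)
  else hyper_continuation a b c z.

(* Main.v *)
(** On [H] put [q = exp(pi i tau)] and [l = theta10^4/theta00^4], so that [zeta = 4 l (1 - l)].
    The substitution [z = 4 l (1 - l)] turns [F(1/4,1/4,1;z)] and [(1-z)^(1/2) F(3/4,3/4,1;z)]
    into [F(1/2,1/2,1;l)] on [Re l < 1/2], and Landen's transformation
    [F(1/2,1/2,1;4k/(1+k)^2) = (1+k) F(1/2,1/2,1;k^2)] continues the latter to [C - [1,oo)].
    These identities are proved on the real line, where both sides solve the same singular
    second order equation.  On the imaginary axis the duplication formulas of the theta
    constants are Landen's transformation, which gives [F(1/2,1/2,1;l) = theta00^2] there, and
    together with the logarithmic singularity of [F] at 1 (Wallis) also the behaviour of [l] and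
    [theta00^2] under [tau -> -1/tau].  Everything is extended by the identity theorem for
    complex differentiable functions.  The values of [l] on the fundamental domain are located
    by the maximum principle for [l/(1 - l)], which has modulus 1 on [|tau| = 1], modulus less
    than 1 on [Re tau = +-1], and tends to 0 at [i oo] and to -1 at the cusps [+-1]. *)

Require Import Defs.
From Stdlib Require Import Reals Ranalysis5 Lra Lia Psatz ZArith List FinFun.
From Stdlib Require Import ClassicalEpsilon Classical.
From Coquelicot Require Import Coquelicot.

Open Scope C_scope.

(** * Complex differentiability *)

(** What has to be controlled is a branch. Since [1 - zeta = (1 - 2 l)^2], the continuation at
    [zeta] involves the square root of [1 - zeta] with positive real part, and this is [1 - 2 l]
    exactly when [Re l < 1/2]; hence the effort spent on that inequality away from the arc
    [|tau| = 1]. On the arc [Re l = 1/2], so [zeta = 1 + (2 Im l)^2] lies on the cut, and the limit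
    from the upper half-plane selects the root with negative imaginary part, which is [1 - 2 l]
    exactly when [Im l > 0]. This sign holds on the right half of the arc, the half that belongs to
    the domain; at [tau = i] both roots are 0. The continuation in the statement comes from a choice
    operator, so an explicit function on the slit plane is constructed and identified with it by
    uniqueness. Neither product formulas nor Poisson summation enter: the theta series have no zeros
    because duplication carries a zero at [q] to zeros tending to 0, and the inversion formula
    follows from the value of K'/K and the monotonicity of F. *)

Definition ccont (f : C -> C) (z : C) : Prop :=
  forall eps : R, (0 < eps)%R -> exists d : R, (0 < d)%R /\
    forall w : C, (Cmod (w - z) < d)%R -> (Cmod (f w - f z) < eps)%R.

Definition cderiv (f : C -> C) (z l : C) : Prop :=
  forall eps : R, (0 < eps)%R -> exists d : R, (0 < d)%R /\
    forall w : C, (Cmod (w - z) < d)%R ->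
      (Cmod (f w - f z - l * (w - z)) <= eps * Cmod (w - z))%R.

Definition holo (f : C -> C) (z : C) : Prop := exists l : C, cderiv f z l.

Definition cnear (z : C) (P : C -> Prop) : Prop :=
  exists d : R, (0 < d)%R /\ forall w : C, (Cmod (w - z) < d)%R -> P w.

Lemma Cmod_minus_sym (a b : C) : Cmod (a - b) = Cmod (b - a).
Proof. rewrite <- Cmod_opp; f_equal; ring. Qed.

Lemma Cmod_self (z : C) : Cmod (z - z) = 0%R.
Proof. replace (z - z) with (RtoC 0) by ring; apply Cmod_0. Qed.

Lemma Cmod_rev_triangle (a b : C) : (Cmod a - Cmod b <= Cmod (a - b))%R.
Proof.
  assert (H := Cmod_triangle (a - b) b).
  replace (a - b + b) with a in H by ring; lra.
Qed.

Lemma cnear_self (z : C) (P : C -> Prop) : cnear z P -> P z.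
Proof. intros [d [Hd H]]; apply H; rewrite Cmod_self; exact Hd. Qed.

Lemma cnear_and (z : C) (P Q : C -> Prop) :
  cnear z P -> cnear z Q -> cnear z (fun w => P w /\ Q w).
Proof.
  intros [d [Hd H]] [e [He K]]; exists (Rmin d e); split.
  - apply Rmin_pos; assumption.
  - intros w Hw; split; [apply H | apply K]; eapply Rlt_le_trans; try exact Hw;
      [apply Rmin_l | apply Rmin_r].
Qed.

Lemma cnear_impl (z : C) (P Q : C -> Prop) :
  (forall w, P w -> Q w) -> cnear z P -> cnear z Q.
Proof. intros I [d [Hd H]]; exists d; split; auto. Qed.

Lemma cnear_ball (c z : C) (r : R) :
  (Cmod (z - c) < r)%R -> cnear z (fun w => (Cmod (w - c) < r)%R).
Proof.
  intros H; exists (r - Cmod (z - c))%R; split; [lra |]; intros w Hw.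
  replace (w - c) with ((w - z) + (z - c)) by ring.
  eapply Rle_lt_trans; [apply Cmod_triangle | lra].
Qed.

Lemma ccont_near (f : C -> C) (z : C) (P : C -> Prop) :
  ccont f z -> cnear (f z) P -> cnear z (fun w => P (f w)).
Proof.
  intros Hf [e [He K]]; destruct (Hf e He) as [d [Hd H]]; exists d; split; auto.
Qed.

Lemma ccont_ext_near (f g : C -> C) (z : C) :
  cnear z (fun w => f w = g w) -> ccont f z -> ccont g z.
Proof.
  intros Hn Hf eps He.
  assert (Hz := cnear_self _ _ Hn); cbv beta in Hz.
  destruct Hn as [d [Hd H]], (Hf eps He) as [d' [Hd' H']].
  exists (Rmin d d'); split; [apply Rmin_pos; assumption |]; intros w Hw.
  rewrite <- H, <- Hz.
  - apply H'; eapply Rlt_le_trans; [exact Hw | apply Rmin_r].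
  - eapply Rlt_le_trans; [exact Hw | apply Rmin_l].
Qed.

Lemma ccont_const (c z : C) : ccont (fun _ => c) z.
Proof. intros e He; exists 1%R; split; [lra |]; intros; rewrite Cmod_self; exact He. Qed.

Lemma ccont_id (z : C) : ccont (fun w => w) z.
Proof. intros e He; exists e; auto. Qed.

Lemma ccont_plus (f g : C -> C) (z : C) :
  ccont f z -> ccont g z -> ccont (fun w => f w + g w) z.
Proof.
  intros Hf Hg e He.
  destruct (Hf (e / 2)%R) as [d [Hd H]]; [lra |].
  destruct (Hg (e / 2)%R) as [d' [Hd' H']]; [lra |].
  exists (Rmin d d'); split; [apply Rmin_pos; assumption |]; intros w Hw.
  replace (f w + g w - (f z + g z)) with ((f w - f z) + (g w - g z)) by ring.
  eapply Rle_lt_trans; [apply Cmod_triangle |].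
  assert (Cmod (f w - f z) < e / 2)%R
    by (apply H; eapply Rlt_le_trans; [exact Hw | apply Rmin_l]).
  assert (Cmod (g w - g z) < e / 2)%R
    by (apply H'; eapply Rlt_le_trans; [exact Hw | apply Rmin_r]).
  lra.
Qed.

Lemma ccont_mult (f g : C -> C) (z : C) :
  ccont f z -> ccont g z -> ccont (fun w => f w * g w) z.
Proof.
  intros Hf Hg e He.
  assert (P1 := Cmod_ge_0 (f z)); assert (P2 := Cmod_ge_0 (g z)).
  set (k := (1 + Cmod (f z) + Cmod (g z))%R).
  set (e' := Rmin 1 (e / k)).
  assert (Hk : (0 < k)%R) by (unfold k; lra).
  assert (He' : (0 < e')%R) by (apply Rmin_pos; [lra | apply Rdiv_lt_0_compat; lra]).
  assert (L1 : (e' <= 1)%R) by apply Rmin_l.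
  assert (L2 : (e' * k <= e)%R).
  { assert (e' <= e / k)%R by apply Rmin_r.
    replace e with ((e / k) * k)%R at 1 by (field; lra).
    apply Rmult_le_compat_r; lra. }
  destruct (Hf e') as [d [Hd H]]; [lra |].
  destruct (Hg e') as [d' [Hd' H']]; [lra |].
  exists (Rmin d d'); split; [apply Rmin_pos; assumption |]; intros w Hw.
  assert (A : (Cmod (f w - f z) < e')%R)
    by (apply H; eapply Rlt_le_trans; [exact Hw | apply Rmin_l]).
  assert (B : (Cmod (g w - g z) < e')%R)
    by (apply H'; eapply Rlt_le_trans; [exact Hw | apply Rmin_r]).
  replace (f w * g w - f z * g z)
    with ((f w - f z) * (g w - g z) + (f z * (g w - g z) + g z * (f w - f z))) by ring.
  eapply Rle_lt_trans; [apply Cmod_triangle |].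
  eapply Rle_lt_trans; [apply Rplus_le_compat_l, Cmod_triangle |].
  rewrite !Cmod_mult.
  assert (Q1 := Cmod_ge_0 (f w - f z)); assert (Q2 := Cmod_ge_0 (g w - g z)).
  unfold k in *; nra.
Qed.

Lemma ccont_opp (f : C -> C) (z : C) : ccont f z -> ccont (fun w => - f w) z.
Proof.
  intros Hf; apply (ccont_ext_near (fun w => (-(1)) * f w)).
  - exists 1%R; split; [lra |]; intros; ring.
  - apply ccont_mult; [apply ccont_const | exact Hf].
Qed.

Lemma ccont_minus (f g : C -> C) (z : C) :
  ccont f z -> ccont g z -> ccont (fun w => f w - g w) z.
Proof. intros; apply ccont_plus; [| apply ccont_opp]; assumption. Qed.

Lemma ccont_neq0 (f : C -> C) (z : C) : ccont f z -> f z <> 0 -> cnear z (fun w => f w <> 0).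
Proof.
  intros Hf Hz; apply Cmod_gt_0 in Hz.
  destruct (Hf _ Hz) as [d [Hd H]]; exists d; split; [exact Hd |]; intros w Hw E.
  specialize (H w Hw); rewrite E, Cmod_minus_sym in H.
  replace (f z - 0) with (f z) in H by ring; lra.
Qed.

Lemma ccont_inv (f : C -> C) (z : C) :
  ccont f z -> f z <> 0 -> ccont (fun w => / f w) z.
Proof.
  intros Hf Hz e He.
  destruct (ccont_neq0 f z Hf Hz) as [d0 [Hd0 H0]].
  assert (P := proj1 (Cmod_gt_0 _) Hz).
  set (m := Cmod (f z)) in *.
  destruct (Hf (Rmin (m / 2) (e * m * m / 4))) as [d [Hd H]].
  { apply Rmin_pos; [lra |]. apply Rdiv_lt_0_compat; [| lra].
    apply Rmult_lt_0_compat; [apply Rmult_lt_0_compat |]; assumption. }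
  exists (Rmin d0 d); split; [apply Rmin_pos; assumption |]; intros w Hw.
  assert (N : f w <> 0) by (apply H0; eapply Rlt_le_trans; [exact Hw | apply Rmin_l]).
  assert (A := H w (Rlt_le_trans _ _ _ Hw (Rmin_r _ _))).
  assert (A1 := Rlt_le_trans _ _ _ A (Rmin_l _ _)).
  assert (A2 := Rlt_le_trans _ _ _ A (Rmin_r _ _)).
  replace (/ f w - / f z) with ((f z - f w) / (f w * f z)) by (field; auto).
  rewrite Cmod_div by (apply Cmult_neq_0; assumption).
  rewrite Cmod_mult, Cmod_minus_sym; fold m.
  assert (B : (m / 2 < Cmod (f w))%R).
  { assert (T := Cmod_rev_triangle (f z) (f w)).
    rewrite Cmod_minus_sym in T; fold m in T; lra. }
  apply (Rmult_lt_reg_r (Cmod (f w) * m)); [nra |].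
  replace (Cmod (f w - f z) / (Cmod (f w) * m) * (Cmod (f w) * m))%R
    with (Cmod (f w - f z)) by (field; split; lra).
  assert (0 < e * m)%R by nra. nra.
Qed.

Lemma ccont_comp (f g : C -> C) (z : C) :
  ccont f z -> ccont g (f z) -> ccont (fun w => g (f w)) z.
Proof.
  intros Hf Hg e He; destruct (Hg e He) as [d [Hd H]], (Hf d Hd) as [d' [Hd' H']].
  exists d'; split; auto.
Qed.

Lemma ccont_zero (f : C -> C) (z : C) :
  ccont f z ->
  (forall d, (0 < d)%R -> exists w, (Cmod (w - z) < d)%R /\ f w = 0) -> f z = 0.
Proof.
  intros Hf Ha; apply NNPP; intros N.
  destruct (ccont_neq0 f z Hf N) as [d [Hd H]], (Ha d Hd) as [w [Hw E]].
  exact (H w Hw E).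
Qed.

(* Caratheodory's form of differentiability reduces the calculus of derivatives
   to the one of continuous functions. *)
Lemma cderiv_slope (f : C -> C) (z l : C) :
  cderiv f z l <->
  exists g : C -> C, ccont g z /\ g z = l /\ cnear z (fun w => f w = f z + g w * (w - z)).
Proof.
  split.
  - intros Hf.
    exists (fun w => if Ceq_dec w z then l else (f w - f z) / (w - z)).
    split; [| split].
    + intros e He; destruct (Hf (e / 2)%R) as [d [Hd H]]; [lra |].
      exists d; split; [exact Hd |]; intros w Hw.
      destruct (Ceq_dec z z) as [_ | K]; [| congruence].
      destruct (Ceq_dec w z) as [-> | N]; [rewrite Cmod_self; exact He |].
      assert (N' : w - z <> 0)
        by (intros K; apply N; rewrite <- (Cplus_0_l z), <- K; ring).
      replace ((f w - f z) / (w - z) - l) with ((f w - f z - l * (w - z)) / (w - z))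
        by (field; exact N').
      rewrite Cmod_div by exact N'.
      assert (P := proj1 (Cmod_gt_0 _) N').
      apply (Rmult_lt_reg_r (Cmod (w - z))); [exact P |].
      unfold Rdiv; rewrite Rmult_assoc, Rinv_l, Rmult_1_r by lra.
      eapply Rle_lt_trans; [apply H; exact Hw |]; nra.
    + destruct (Ceq_dec z z); congruence.
    + exists 1%R; split; [lra |]; intros w _.
      destruct (Ceq_dec w z) as [-> | N]; [ring |].
      field; intros K; apply N; rewrite <- (Cplus_0_l z), <- K; ring.
  - intros [g [Hg [<- [d0 [Hd0 H0]]]]] e He; destruct (Hg e He) as [d [Hd H]].
    exists (Rmin d0 d); split; [apply Rmin_pos; assumption |]; intros w Hw.
    rewrite (H0 w) by (eapply Rlt_le_trans; [exact Hw | apply Rmin_l]).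
    replace (f z + g w * (w - z) - f z - g z * (w - z)) with ((g w - g z) * (w - z)) by ring.
    rewrite Cmod_mult; apply Rmult_le_compat_r; [apply Cmod_ge_0 |].
    apply Rlt_le, H; eapply Rlt_le_trans; [exact Hw | apply Rmin_r].
Qed.

Lemma cderiv_cont (f : C -> C) (z l : C) : cderiv f z l -> ccont f z.
Proof.
  intros H; apply cderiv_slope in H; destruct H as [g [Hg [_ Hn]]].
  apply (ccont_ext_near (fun w => f z + g w * (w - z))).
  - revert Hn; apply cnear_impl; auto.
  - apply ccont_plus; [apply ccont_const | apply ccont_mult; [exact Hg |]].
    apply ccont_minus; [apply ccont_id | apply ccont_const].
Qed.

Lemma cderiv_ext_near (f g : C -> C) (z l : C) :
  cnear z (fun w => f w = g w) -> cderiv f z l -> cderiv g z l.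
Proof.
  intros Hn Hf eps He.
  assert (Hz := cnear_self _ _ Hn); cbv beta in Hz.
  destruct Hn as [d [Hd H]], (Hf eps He) as [d' [Hd' H']].
  exists (Rmin d d'); split; [apply Rmin_pos; assumption |]; intros w Hw.
  rewrite <- H, <- Hz.
  - apply H'; eapply Rlt_le_trans; [exact Hw | apply Rmin_r].
  - eapply Rlt_le_trans; [exact Hw | apply Rmin_l].
Qed.

Lemma cderiv_const (c z : C) : cderiv (fun _ => c) z 0.
Proof.
  intros e He; exists 1%R; split; [lra |]; intros w _.
  replace (c - c - 0 * (w - z)) with (RtoC 0) by ring.
  rewrite Cmod_0; assert (H := Cmod_ge_0 (w - z)); nra.
Qed.

Lemma cderiv_id (z : C) : cderiv (fun w => w) z 1.
Proof.
  intros e He; exists 1%R; split; [lra |]; intros w _.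
  replace (w - z - 1 * (w - z)) with (RtoC 0) by ring.
  rewrite Cmod_0; assert (H := Cmod_ge_0 (w - z)); nra.
Qed.

Lemma cderiv_plus (f g : C -> C) (z l m : C) :
  cderiv f z l -> cderiv g z m -> cderiv (fun w => f w + g w) z (l + m).
Proof.
  rewrite !cderiv_slope; intros [u [Cu [<- Nu]]] [v [Cv [<- Nv]]].
  exists (fun w => u w + v w); split; [apply ccont_plus; assumption | split; [reflexivity |]].
  generalize (cnear_and _ _ _ Nu Nv); apply cnear_impl.
  intros w [-> ->]; ring.
Qed.

Lemma cderiv_mult (f g : C -> C) (z l m : C) :
  cderiv f z l -> cderiv g z m -> cderiv (fun w => f w * g w) z (l * g z + f z * m).
Proof.
  intros Hf Hg; assert (Cg := cderiv_cont _ _ _ Hg).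
  revert Hf Hg; rewrite !cderiv_slope; intros [u [Cu [<- Nu]]] [v [Cv [<- Nv]]].
  exists (fun w => u w * g w + f z * v w); split; [| split; [reflexivity |]].
  - apply ccont_plus; apply ccont_mult; try assumption; apply ccont_const.
  - generalize (cnear_and _ _ _ Nu Nv); apply cnear_impl.
    intros w [-> E]; rewrite E; ring.
Qed.

Lemma cderiv_opp (f : C -> C) (z l : C) : cderiv f z l -> cderiv (fun w => - f w) z (- l).
Proof.
  intros H; assert (K := cderiv_mult _ _ _ _ _ (cderiv_const (-(1)) z) H).
  cbv beta in K; replace (0 * f z + - (1) * l) with (- l) in K by ring.
  revert K; apply cderiv_ext_near; exists 1%R; split; [lra |]; intros; ring.
Qed.

Lemma cderiv_inv (f : C -> C) (z l : C) :
  cderiv f z l -> f z <> 0 -> cderiv (fun w => / f w) z (- l / (f z * f z)).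
Proof.
  intros Hf Hz; assert (Cf := cderiv_cont _ _ _ Hf).
  revert Hf; rewrite !cderiv_slope; intros [u [Cu [<- Nu]]].
  exists (fun w => - u w * / (f w * f z)); split; [| split; [reflexivity |]].
  - apply ccont_mult; [apply ccont_opp; assumption |].
    apply ccont_inv; [| apply Cmult_neq_0; assumption].
    apply ccont_mult; [assumption | apply ccont_const].
  - generalize (cnear_and _ _ _ Nu (ccont_neq0 f z Cf Hz)); apply cnear_impl.
    intros w [E N].
    replace (- u w * / (f w * f z) * (w - z)) with (- (u w * (w - z)) * / (f w * f z)) by ring.
    replace (u w * (w - z)) with (f w - f z) by (rewrite E; ring).
    field; split; assumption.
Qed.

Lemma cderiv_comp (f g : C -> C) (z l m : C) :
  cderiv f z l -> cderiv g (f z) m -> cderiv (fun w => g (f w)) z (m * l).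
Proof.
  intros Hf Hg; assert (Cf := cderiv_cont _ _ _ Hf).
  revert Hf Hg; rewrite !cderiv_slope; intros [u [Cu [<- Nu]]] [v [Cv [<- Nv]]].
  exists (fun w => v (f w) * u w); split; [| split; [reflexivity |]].
  - apply ccont_mult; [| assumption]; apply (ccont_comp f v); assumption.
  - generalize (cnear_and _ _ _ Nu (ccont_near _ _ _ Cf Nv)); apply cnear_impl.
    intros w [E ->]; replace (f w - f z) with (u w * (w - z)) by (rewrite E; ring); ring.
Qed.

Lemma holo_cont (f : C -> C) (z : C) : holo f z -> ccont f z.
Proof. intros [l H]; exact (cderiv_cont _ _ _ H). Qed.

Lemma holo_ext_near (f g : C -> C) (z : C) :
  cnear z (fun w => f w = g w) -> holo f z -> holo g z.
Proof. intros Hn [l H]; exists l; exact (cderiv_ext_near _ _ _ _ Hn H). Qed.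

Lemma holo_const (c z : C) : holo (fun _ => c) z.
Proof. exists 0; apply cderiv_const. Qed.

Lemma holo_id (z : C) : holo (fun w => w) z.
Proof. exists 1; apply cderiv_id. Qed.

Lemma holo_plus (f g : C -> C) (z : C) : holo f z -> holo g z -> holo (fun w => f w + g w) z.
Proof. intros [l H] [m K]; eexists; apply cderiv_plus; eassumption. Qed.

Lemma holo_mult (f g : C -> C) (z : C) : holo f z -> holo g z -> holo (fun w => f w * g w) z.
Proof. intros [l H] [m K]; eexists; apply cderiv_mult; eassumption. Qed.

Lemma holo_opp (f : C -> C) (z : C) : holo f z -> holo (fun w => - f w) z.
Proof. intros [l H]; eexists; apply cderiv_opp; eassumption. Qed.

Lemma holo_minus (f g : C -> C) (z : C) : holo f z -> holo g z -> holo (fun w => f w - g w) z.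
Proof. intros; apply holo_plus; [| apply holo_opp]; assumption. Qed.

Lemma holo_inv (f : C -> C) (z : C) : holo f z -> f z <> 0 -> holo (fun w => / f w) z.
Proof. intros [l H] N; eexists; apply cderiv_inv; eassumption. Qed.

Lemma holo_div (f g : C -> C) (z : C) :
  holo f z -> holo g z -> g z <> 0 -> holo (fun w => f w / g w) z.
Proof. intros; apply holo_mult; [| apply holo_inv]; assumption. Qed.

Lemma holo_pow (f : C -> C) (n : nat) (z : C) : holo f z -> holo (fun w => f w ^ n) z.
Proof.
  intros H; induction n as [| n IH]; simpl; [apply holo_const | apply holo_mult; assumption].
Qed.

Lemma holo_comp (f g : C -> C) (z : C) :
  holo f z -> holo g (f z) -> holo (fun w => g (f w)) z.
Proof. intros [l H] [m K]; eexists; exact (cderiv_comp _ _ _ _ _ H K). Qed.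

Lemma is_filter_lim_locally_unique_C (z x : C) :
  is_filter_lim (locally (T := AbsRing_UniformSpace C_AbsRing) z) x -> z = x.
Proof.
  intros H; apply (is_filter_lim_locally_unique (V := AbsRing_NormedModule C_AbsRing)).
  exact H.
Qed.

(** Bridge between the notion in [is_hyper_continuation] and the epsilon form used in the rest of
    the proof. *)
Lemma ex_derive_holo (f : C -> C) (z : C) :
  ex_derive (K := C_AbsRing) (V := C_NormedModule) f z <-> holo f z.
Proof.
  split.
  - intros [l [_ Hl]]; exists l; intros e He.
    specialize (Hl z (fun P H => H) (mkposreal e He)).
    destruct Hl as [d Hd]; exists (pos d); split; [apply cond_pos |]; intros w Hw.
    replace (l * (w - z)) with ((w - z) * l) by ring.
    exact (Hd w Hw).
  - intros [l Hl]; exists l; split.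
    + apply (is_linear_scal_l (K := C_AbsRing) (V := C_NormedModule) l).
    + intros x Hx e.
      rewrite <- (is_filter_lim_locally_unique_C z x Hx).
      destruct (Hl e (cond_pos e)) as [d [Hd H]].
      exists (mkposreal d Hd); intros w Hw; simpl.
      assert (K := H w Hw).
      replace (l * (w - z)) with ((w - z) * l) in K by ring.
      exact K.
Qed.

(** The balls of [C_UniformSpace] are squares; they compare with the discs of [Cmod] up to the
    factor [sqrt 2]. *)
Lemma locally_cnear (z : C) (P : C -> Prop) :
  locally (T := C_UniformSpace) z P <-> cnear z P.
Proof.
  split.
  - intros [e H]; exists (pos e); split; [apply cond_pos |]; intros w Hw; apply H.
    apply C_NormedModule_mixin_compat1; exact Hw.
  - intros [d [Hd H]].
    assert (S : (0 < sqrt 2)%R) by (apply sqrt_lt_R0; lra).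
    assert (Q : (0 < d / sqrt 2)%R) by (apply Rdiv_lt_0_compat; assumption).
    exists (mkposreal _ Q); intros w Hw; apply H.
    eapply Rlt_le_trans; [apply (C_NormedModule_mixin_compat2 z w (mkposreal _ Q)); exact Hw |].
    simpl; right; field; lra.
Qed.

(** * Integrals of complex functions of a real variable *)

Lemma Cmod_le_Re_Im (z : C) : (Cmod z <= Rabs (Re z) + Rabs (Im z))%R.
Proof.
  assert (P1 := Rabs_pos (Re z)); assert (P2 := Rabs_pos (Im z)).
  apply Rsqr_incr_0_var; [| lra].
  replace (Rsqr (Cmod z)) with (Cmod z ^ 2)%R by (unfold Rsqr; ring).
  rewrite Cmod2_alt, <- (pow2_abs (Re z)), <- (pow2_abs (Im z)); unfold Rsqr; nra.
Qed.

Lemma im_le_Cmod (z : C) : (Rabs (Im z) <= Cmod z)%R.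
Proof. eapply Rle_trans; [apply Rmax_r | apply Rmax_Cmod]. Qed.

(** Stated by components because integrals are taken by components. *)
Definition rcont (f : R -> C) (t : R) : Prop :=
  continuous (fun x => Re (f x)) t /\ continuous (fun x => Im (f x)) t.

Lemma continuous_eps (f : R -> R) (t : R) :
  continuous f t <-> forall eps, (0 < eps)%R -> exists d, (0 < d)%R /\
    forall x, (Rabs (x - t) < d)%R -> (Rabs (f x - f t) < eps)%R.
Proof.
  split.
  - intros H e He.
    destruct (proj1 (filterlim_locally f (f t)) H (mkposreal e He)) as [d Hd].
    exists (pos d); split; [apply cond_pos |]; intros x Hx; apply Hd; exact Hx.
  - intros H; apply filterlim_locally; intros e.
    destruct (H e (cond_pos e)) as [d [Hd K]].
    exists (mkposreal d Hd); intros x Hx; apply K; exact Hx.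
Qed.

Lemma rcont_eps (f : R -> C) (t : R) :
  rcont f t <-> forall eps, (0 < eps)%R -> exists d, (0 < d)%R /\
    forall x, (Rabs (x - t) < d)%R -> (Cmod (f x - f t) < eps)%R.
Proof.
  unfold rcont; rewrite !continuous_eps; split.
  - intros [H1 H2] e He.
    destruct (H1 (e / 2)%R) as [d [Hd K]]; [lra |].
    destruct (H2 (e / 2)%R) as [d' [Hd' K']]; [lra |].
    exists (Rmin d d'); split; [apply Rmin_pos; assumption |]; intros x Hx.
    specialize (K x (Rlt_le_trans _ _ _ Hx (Rmin_l _ _))).
    specialize (K' x (Rlt_le_trans _ _ _ Hx (Rmin_r _ _))).
    eapply Rle_lt_trans; [apply Cmod_le_Re_Im |].
    unfold Rminus in K, K'; simpl; unfold Re, Im in *; lra.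
  - intros H; split; intros e He; destruct (H e He) as [d [Hd K]]; exists d;
      (split; [exact Hd |]); intros x Hx; specialize (K x Hx).
    + eapply Rle_lt_trans; [apply (re_le_Cmod (f x - f t)) | exact K].
    + eapply Rle_lt_trans; [apply (im_le_Cmod (f x - f t)) | exact K].
Qed.

Lemma rcont_comp (g : R -> C) (f : C -> C) (t : R) :
  rcont g t -> ccont f (g t) -> rcont (fun x => f (g x)) t.
Proof.
  rewrite !rcont_eps; intros Hg Hf e He.
  destruct (Hf e He) as [d [Hd H]], (Hg d Hd) as [d' [Hd' H']]; exists d'; split; auto.
Qed.

Lemma rcont_const (c : C) (t : R) : rcont (fun _ => c) t.
Proof. split; apply continuous_const. Qed.

Lemma rcont_RtoC (t : R) : rcont (fun x => RtoC x) t.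
Proof. split; [apply continuous_id | apply continuous_const]. Qed.

Lemma rcont_plus (f g : R -> C) (t : R) :
  rcont f t -> rcont g t -> rcont (fun x => f x + g x) t.
Proof.
  intros [H1 H2] [K1 K2]; split; simpl.
  - apply (continuous_plus (fun x => Re (f x)) (fun x => Re (g x))); assumption.
  - apply (continuous_plus (fun x => Im (f x)) (fun x => Im (g x))); assumption.
Qed.

Lemma rcont_mult (f g : R -> C) (t : R) :
  rcont f t -> rcont g t -> rcont (fun x => f x * g x) t.
Proof.
  intros [H1 H2] [K1 K2]; split; simpl.
  - apply (continuous_minus (fun x => Re (f x) * Re (g x))%R (fun x => Im (f x) * Im (g x))%R);
      apply (continuous_mult (K := R_AbsRing)); assumption.
  - apply (continuous_plus (fun x => Re (f x) * Im (g x))%R (fun x => Im (f x) * Re (g x))%R);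
      apply (continuous_mult (K := R_AbsRing)); assumption.
Qed.

Lemma rcont_opp (f : R -> C) (t : R) : rcont f t -> rcont (fun x => - f x) t.
Proof.
  intros [H1 H2]; split; simpl.
  - apply (continuous_opp (fun x => Re (f x))); assumption.
  - apply (continuous_opp (fun x => Im (f x))); assumption.
Qed.

Lemma rcont_minus (f g : R -> C) (t : R) :
  rcont f t -> rcont g t -> rcont (fun x => f x - g x) t.
Proof. intros; apply rcont_plus; [| apply rcont_opp]; assumption. Qed.

Lemma rcont_inv (f : R -> C) (t : R) : rcont f t -> f t <> 0 -> rcont (fun x => / f x) t.
Proof.
  intros H N; apply (rcont_comp f (fun w => / w)); [exact H |].
  apply (ccont_inv (fun w => w)); [apply ccont_id | exact N].
Qed.

Lemma rcont_div (f g : R -> C) (t : R) :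
  rcont f t -> rcont g t -> g t <> 0 -> rcont (fun x => f x / g x) t.
Proof. intros; apply rcont_mult; [| apply rcont_inv]; assumption. Qed.

Lemma rcont_pow (f : R -> C) (n : nat) (t : R) : rcont f t -> rcont (fun x => f x ^ n) t.
Proof. intros H; induction n; simpl; [apply rcont_const | apply rcont_mult; assumption]. Qed.

Definition CInt (f : R -> C) (a b : R) : C :=
  (RInt (fun t => Re (f t)) a b, RInt (fun t => Im (f t)) a b).

Definition rcont_on (f : R -> C) (a b : R) : Prop := forall t, (a <= t <= b)%R -> rcont f t.

Lemma rcont_on_ex_RInt (f : R -> C) (a b : R) : (a <= b)%R -> rcont_on f a b ->
  ex_RInt (fun t => Re (f t)) a b /\ ex_RInt (fun t => Im (f t)) a b.
Proof.
  intros Hab H; split; apply (ex_RInt_continuous (V := R_CompleteNormedModule)); intros t;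
    rewrite Rmin_left, Rmax_right by exact Hab; intros Ht; apply (H t Ht).
Qed.

Lemma CInt_ext (f g : R -> C) (a b : R) : (a <= b)%R ->
  (forall t, (a < t < b)%R -> f t = g t) -> CInt f a b = CInt g a b.
Proof.
  intros Hab H; unfold CInt; f_equal; apply RInt_ext; intros t;
    rewrite Rmin_left, Rmax_right by exact Hab; intros Ht; rewrite (H t Ht); reflexivity.
Qed.

Lemma CInt_plus (f g : R -> C) (a b : R) : (a <= b)%R -> rcont_on f a b -> rcont_on g a b ->
  CInt (fun t => f t + g t) a b = CInt f a b + CInt g a b.
Proof.
  intros Hab Hf Hg.
  destruct (rcont_on_ex_RInt f a b Hab Hf), (rcont_on_ex_RInt g a b Hab Hg).
  apply injective_projections.
  - apply (RInt_plus (V := R_CompleteNormedModule) (fun t => Re (f t)) (fun t => Re (g t)));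
      assumption.
  - apply (RInt_plus (V := R_CompleteNormedModule) (fun t => Im (f t)) (fun t => Im (g t)));
      assumption.
Qed.

Lemma CInt_scal (c : C) (f : R -> C) (a b : R) : (a <= b)%R -> rcont_on f a b ->
  CInt (fun t => c * f t) a b = c * CInt f a b.
Proof.
  intros Hab Hf.
  destruct (rcont_on_ex_RInt f a b Hab Hf) as [H1 H2].
  apply injective_projections.
  - transitivity (RInt (fun t => minus (scal (Re c) (Re (f t))) (scal (Im c) (Im (f t)))) a b);
      [reflexivity |].
    rewrite (RInt_minus (V := R_CompleteNormedModule)), !(RInt_scal (V := R_CompleteNormedModule));
      try assumption; try (apply (ex_RInt_scal (V := R_CompleteNormedModule)); assumption).
    reflexivity.
  - transitivity (RInt (fun t => plus (scal (Re c) (Im (f t))) (scal (Im c) (Re (f t)))) a b);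
      [reflexivity |].
    rewrite (RInt_plus (V := R_CompleteNormedModule)), !(RInt_scal (V := R_CompleteNormedModule));
      try assumption; try (apply (ex_RInt_scal (V := R_CompleteNormedModule)); assumption).
    reflexivity.
Qed.

Lemma CInt_minus (f g : R -> C) (a b : R) : (a <= b)%R -> rcont_on f a b -> rcont_on g a b ->
  CInt (fun t => f t - g t) a b = CInt f a b - CInt g a b.
Proof.
  intros Hab Hf Hg.
  rewrite (CInt_ext _ (fun t => f t + (-(1)) * g t)) by (auto; intros; ring).
  rewrite CInt_plus, CInt_scal; try assumption; [ring |].
  intros t Ht; apply rcont_mult; [apply rcont_const | apply Hg; exact Ht].
Qed.

Lemma CInt_Chasles (f : R -> C) (a b c : R) : (a <= b <= c)%R -> rcont_on f a c ->
  CInt f a c = CInt f a b + CInt f b c.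
Proof.
  intros Hb Hf.
  destruct (rcont_on_ex_RInt f a b) as [H1 H2]; [lra | intros t Ht; apply Hf; lra |].
  destruct (rcont_on_ex_RInt f b c) as [K1 K2]; [lra | intros t Ht; apply Hf; lra |].
  apply injective_projections; symmetry;
    [apply (RInt_Chasles (V := R_CompleteNormedModule) (fun t => Re (f t)))
    |apply (RInt_Chasles (V := R_CompleteNormedModule) (fun t => Im (f t)))]; assumption.
Qed.

(** The factor 2 comes from bounding the two components separately; it is harmless, as the bound is
    applied to quantities that tend to 0. *)
Lemma CInt_bound (f : R -> C) (a b M : R) : (a <= b)%R -> rcont_on f a b ->
  (forall t, (a <= t <= b)%R -> (Cmod (f t) <= M)%R) ->
  (Cmod (CInt f a b) <= 2 * M * (b - a))%R.
Proof.
  intros Hab Hf HM.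
  destruct (rcont_on_ex_RInt f a b Hab Hf) as [H1 H2].
  eapply Rle_trans; [apply Cmod_le_Re_Im |]; simpl.
  assert (forall g : R -> R, ex_RInt g a b ->
    (forall t, (a <= t <= b)%R -> (Rabs (g t) <= M)%R) ->
    (Rabs (RInt g a b) <= M * (b - a))%R) as B.
  { intros g Hg HgM; rewrite Rmult_comm.
    apply abs_RInt_le_const; assumption. }
  assert (B1 := B _ H1 (fun t Ht => Rle_trans _ _ _ (re_le_Cmod _) (HM t Ht))).
  assert (B2 := B _ H2 (fun t Ht => Rle_trans _ _ _ (im_le_Cmod _) (HM t Ht))).
  lra.
Qed.

Lemma CInt_derive (F f : R -> C) (a b : R) : (a <= b)%R -> rcont_on f a b ->
  (forall t, (a <= t <= b)%R -> is_derive (fun x => Re (F x)) t (Re (f t)) /\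
     is_derive (fun x => Im (F x)) t (Im (f t))) ->
  CInt f a b = F b - F a.
Proof.
  intros Hab Hf HF; apply injective_projections; apply is_RInt_unique.
  - apply (is_RInt_derive (V := R_CompleteNormedModule) (fun x => Re (F x)));
      rewrite Rmin_left, Rmax_right by exact Hab; intros t Ht; [apply (HF t Ht) | apply (Hf t Ht)].
  - apply (is_RInt_derive (V := R_CompleteNormedModule) (fun x => Im (F x)));
      rewrite Rmin_left, Rmax_right by exact Hab; intros t Ht; [apply (HF t Ht) | apply (Hf t Ht)].
Qed.

Lemma CInt_const (c : C) (a b : R) : (a <= b)%R -> CInt (fun _ => c) a b = c * RtoC (b - a).
Proof.
  intros Hab; unfold CInt; rewrite !RInt_const; unfold scal; simpl; unfold mult; simpl.
  apply injective_projections; simpl; unfold Re, Im; ring.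
Qed.

(* Each stage index [n] records the number of bisections already made. *)
Lemma rectangle_bisection (P : R -> R -> R -> R -> nat -> Prop) (a b c d : R) :
  (a <= b)%R -> (c <= d)%R -> P a b c d 0%nat ->
  (forall n x1 x2 y1 y2, (a <= x1 <= x2)%R -> (x2 <= b)%R -> (c <= y1 <= y2)%R -> (y2 <= d)%R ->
     P x1 x2 y1 y2 n ->
     let mx := ((x1 + x2) / 2)%R in let my := ((y1 + y2) / 2)%R in
     P x1 mx y1 my (S n) \/ P mx x2 y1 my (S n) \/ P x1 mx my y2 (S n) \/ P mx x2 my y2 (S n)) ->
  exists x y, (a <= x <= b)%R /\ (c <= y <= d)%R /\
    forall n, exists x1 x2 y1 y2, P x1 x2 y1 y2 n /\
      (a <= x1 <= x)%R /\ (x <= x2 <= b)%R /\ (c <= y1 <= y)%R /\ (y <= y2 <= d)%R /\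
      (x2 - x1 = (b - a) / 2 ^ n)%R /\ (y2 - y1 = (d - c) / 2 ^ n)%R.
Proof.
  intros Hab Hcd H0 Hstep.
  set (T := (R * R * (R * R))%type).
  set (ok := fun n (q : T) => let '((x1, x2), (y1, y2)) := q in
    (a <= x1 <= x2)%R /\ (x2 <= b)%R /\ (c <= y1 <= y2)%R /\ (y2 <= d)%R /\ P x1 x2 y1 y2 n /\
    (x2 - x1 = (b - a) / 2 ^ n)%R /\ (y2 - y1 = (d - c) / 2 ^ n)%R).
  set (sub := fun (q q' : T) => let '((x1, x2), (y1, y2)) := q in
    let '((u1, u2), (v1, v2)) := q' in
    (x1 <= u1 /\ u2 <= x2 /\ y1 <= v1 /\ v2 <= y2)%R).
  (* The step is made total, with a dummy result on rectangles that are not [ok], so that it can be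
     turned into a choice function. *)
  assert (Hs : forall n q, exists q', ok n q -> ok (S n) q' /\ sub q q').
  { intros n [[x1 x2] [y1 y2]].
    destruct (classic (ok n ((x1, x2), (y1, y2)))) as [K | K]; [| exists ((x1, x2), (y1, y2)); tauto].
    destruct K as [A1 [A2 [A3 [A4 [A5 [A6 A7]]]]]].
    assert (T2 : (0 < 2 ^ n)%R) by (apply pow_lt; lra).
    assert (E1 : ((b - a) / 2 ^ S n = (x2 - x1) / 2)%R) by (rewrite A6; simpl; field; lra).
    assert (E2 : ((d - c) / 2 ^ S n = (y2 - y1) / 2)%R) by (rewrite A7; simpl; field; lra).
    destruct (Hstep n x1 x2 y1 y2 A1 A2 A3 A4 A5) as [K | [K | [K | K]]]; eexists; intros _;
      [instantiate (1 := ((x1, (x1 + x2) / 2), (y1, (y1 + y2) / 2))%R)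
      |instantiate (1 := (((x1 + x2) / 2, x2), (y1, (y1 + y2) / 2))%R)
      |instantiate (1 := ((x1, (x1 + x2) / 2), ((y1 + y2) / 2, y2))%R)
      |instantiate (1 := (((x1 + x2) / 2, x2), ((y1 + y2) / 2, y2))%R)];
      unfold ok, sub; rewrite E1, E2; repeat split; try exact K; lra. }
  set (next := fun n q => proj1_sig (constructive_indefinite_description _ (Hs n q))).
  assert (Hnext : forall n q, ok n q -> ok (S n) (next n q) /\ sub q (next n q)).
  { intros n q; exact (proj2_sig (constructive_indefinite_description _ (Hs n q))). }
  set (Q := fix Q n : T := match n with O => ((a, b), (c, d)) | S m => next m (Q m) end).
  assert (HQ : forall n, ok n (Q n)).
  { induction n as [| n IH]; [| apply Hnext, IH].
    simpl; repeat split; try exact H0; try lra; field. }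
  assert (HQs : forall n, sub (Q n) (Q (S n))) by (intros n; apply Hnext, HQ).
  set (x1 := fun n => fst (fst (Q n))); set (x2 := fun n => snd (fst (Q n))).
  set (y1 := fun n => fst (snd (Q n))); set (y2 := fun n => snd (snd (Q n))).
  assert (M : forall n, (x1 n <= x1 (S n) /\ x2 (S n) <= x2 n /\
                         y1 n <= y1 (S n) /\ y2 (S n) <= y2 n)%R).
  { intros n; specialize (HQs n); unfold x1, x2, y1, y2, sub in *.
    destruct (Q n) as [[? ?] [? ?]], (Q (S n)) as [[? ?] [? ?]]; simpl; tauto. }
  assert (O : forall n, (x1 n <= x2 n /\ y1 n <= y2 n)%R).
  { intros n; specialize (HQ n); unfold x1, x2, y1, y2, ok in *.
    destruct (Q n) as [[? ?] [? ?]]; simpl; tauto. }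
  assert (Mk : forall n k, (x1 n <= x1 (n + k)%nat /\ x2 (n + k)%nat <= x2 n /\
                         y1 n <= y1 (n + k)%nat /\ y2 (n + k)%nat <= y2 n)%R).
  { intros n; induction k as [| k IH]; [rewrite Nat.add_0_r; lra |].
    rewrite Nat.add_succ_r; specialize (M (n + k)%nat); lra. }
  assert (X : forall n m, (x1 n <= x2 m /\ y1 n <= y2 m)%R).
  { intros n m; assert (A := Mk n m); assert (B := Mk m n).
    rewrite (Nat.add_comm m n) in B; specialize (O (n + m)%nat); lra. }
  assert (L : forall u w : nat -> R, (forall n m, (u n <= w m)%R) ->
    exists x, forall n, (u n <= x <= w n)%R).
  { intros u w Huw.
    destruct (completeness (fun x => exists n, x = u n)) as [x [Hx1 Hx2]].
    - exists (w 0%nat); intros x [n ->]; apply Huw.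
    - exists (u 0%nat); exists 0%nat; reflexivity.
    - exists x; intros n; split; [apply Hx1; exists n; reflexivity |].
      apply Hx2; intros y [m ->]; apply Huw. }
  destruct (L x1 x2 (fun n m => proj1 (X n m))) as [x Hx].
  destruct (L y1 y2 (fun n m => proj2 (X n m))) as [y Hy].
  exists x, y; split; [apply (Hx 0%nat) | split; [apply (Hy 0%nat) |]]; intros n.
  exists (x1 n), (x2 n), (y1 n), (y2 n).
  specialize (Hx n); specialize (Hy n); specialize (HQ n).
  unfold x1, x2, y1, y2, ok in *.
  destruct (Q n) as [[? ?] [? ?]]; simpl in *.
  destruct HQ as [A1 [A2 [A3 [A4 [A5 [A6 A7]]]]]]; repeat split; try assumption; lra.
Qed.

(** * Goursat's lemma and Taylor series *)

(* Integral over the boundary of a rectangle of the pull-back of [h(w) dw/(w - z)] under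
   [(t, p) |-> w = z + t v(p)], where [psi = v'/v]: the 1-form [dw/(w - z)] becomes
   [dt/t + psi dp]. *)
Definition loop_int (psi : R -> C) (G : R -> R -> C) (x1 x2 y1 y2 : R) : C :=
  CInt (fun p => G x2 p * psi p) y1 y2 - CInt (fun p => G x1 p * psi p) y1 y2
  - (CInt (fun t => G t y2 / RtoC t) x1 x2 - CInt (fun t => G t y1 / RtoC t) x1 x2).

(** Only integrals along sides of rectangles occur, hence continuity in each variable separately. *)
Definition sep_cont (G : R -> R -> C) (a : R) : Prop :=
  forall t p, (a <= t <= 1)%R -> rcont (fun q => G t q) p /\ rcont (fun s => G s p) t.

Lemma rcont_div_t (G : R -> C) (t : R) : (0 < t)%R -> rcont G t ->
  rcont (fun s => G s / RtoC s) t.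
Proof.
  intros Ht H; apply rcont_div; [exact H | apply rcont_RtoC |].
  intros K; apply RtoC_inj in K; lra.
Qed.

(** Each inner side is traversed twice, in opposite directions, and cancels. *)
Lemma loop_int_split (psi : R -> C) (G : R -> R -> C) (a x1 x x2 y1 y y2 : R) :
  (0 < a <= x1)%R -> (x1 <= x <= x2)%R -> (x2 <= 1)%R -> (y1 <= y <= y2)%R ->
  (forall p, rcont psi p) -> sep_cont G a ->
  loop_int psi G x1 x2 y1 y2 =
  loop_int psi G x1 x y1 y + loop_int psi G x x2 y1 y
  + loop_int psi G x1 x y y2 + loop_int psi G x x2 y y2.
Proof.
  intros Ha Hx H1 Hy Hpsi HG; unfold loop_int.
  assert (CA : forall t, (a <= t <= 1)%R -> CInt (fun p => G t p * psi p) y1 y2 =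
    CInt (fun p => G t p * psi p) y1 y + CInt (fun p => G t p * psi p) y y2).
  { intros t Ht; apply CInt_Chasles; [lra |]; intros p _.
    apply rcont_mult; [apply (HG t p Ht) | apply Hpsi]. }
  assert (CB : forall p, CInt (fun t => G t p / RtoC t) x1 x2 =
    CInt (fun t => G t p / RtoC t) x1 x + CInt (fun t => G t p / RtoC t) x x2).
  { intros p; apply CInt_Chasles; [lra |]; intros t Ht.
    apply rcont_div_t; [lra |]; apply HG; lra. }
  rewrite (CA x1), (CA x2), (CB y1), (CB y2) by lra; ring.
Qed.

(** The constant 4 is two parallel sides times the factor 2 of [CInt_bound]; on the sides in [t] the
    weight is at most [1 / a]. *)
Lemma loop_int_bound (psi : R -> C) (G : R -> R -> C) (a K m x1 x2 y1 y2 : R) :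
  (0 < a <= x1)%R -> (x1 <= x2)%R -> (x2 <= 1)%R -> (y1 <= y2)%R ->
  (forall p, rcont psi p) -> (forall p, (Cmod (psi p) <= K)%R) -> sep_cont G a ->
  (forall t p, (x1 <= t <= x2)%R -> (y1 <= p <= y2)%R -> (Cmod (G t p) <= m)%R) ->
  (Cmod (loop_int psi G x1 x2 y1 y2) <= 4 * m * (K * (y2 - y1) + (x2 - x1) / a))%R.
Proof.
  intros Ha Hx H1 Hy Hpsi HK HG Hm; unfold loop_int.
  assert (BA : forall t, (x1 <= t <= x2)%R ->
    (Cmod (CInt (fun p => (G t p * psi p)%C) y1 y2) <= 2 * (m * K) * (y2 - y1))%R).
  { intros t Ht; apply CInt_bound; [exact Hy | |].
    - intros p _; apply rcont_mult; [apply (HG t p); lra | apply Hpsi].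
    - intros p Hp; rewrite Cmod_mult.
      apply Rmult_le_compat; try apply Cmod_ge_0; [apply Hm; lra | apply HK]. }
  assert (BB : forall p, (y1 <= p <= y2)%R ->
    (Cmod (CInt (fun t => (G t p / RtoC t)%C) x1 x2) <= 2 * (m / a) * (x2 - x1))%R).
  { intros p Hp; apply CInt_bound; [exact Hx | |].
    - intros t Ht; apply rcont_div_t; [lra | apply (HG t p); lra].
    - intros t Ht.
      rewrite Cmod_div, Cmod_R, Rabs_pos_eq by (try (intros E; apply RtoC_inj in E); lra).
      apply Rmult_le_compat; [apply Cmod_ge_0 | left; apply Rinv_0_lt_compat; lra
        | apply Hm; lra | apply Rinv_le_contravar; lra]. }
  assert (T : forall u v : C, (Cmod (u - v) <= Cmod u + Cmod v)%R).
  { intros u v; unfold Cminus; rewrite <- (Cmod_opp v); apply Cmod_triangle. }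
  assert (B1 := BA x1 ltac:(lra)); assert (B2 := BA x2 ltac:(lra)).
  assert (B3 := BB y1 ltac:(lra)); assert (B4 := BB y2 ltac:(lra)).
  eapply Rle_trans; [apply T |].
  eapply Rle_trans; [apply Rplus_le_compat; apply T |].
  replace (4 * m * (K * (y2 - y1) + (x2 - x1) / a))%R with
    (2 * (m * K) * (y2 - y1) + 2 * (m * K) * (y2 - y1)
     + (2 * (m / a) * (x2 - x1) + 2 * (m / a) * (x2 - x1)))%R by (field; lra).
  lra.
Qed.

Lemma loop_int_minus (psi : R -> C) (G L : R -> R -> C) (a x1 x2 y1 y2 : R) :
  (0 < a <= x1)%R -> (x1 <= x2)%R -> (x2 <= 1)%R -> (y1 <= y2)%R ->
  (forall p, rcont psi p) -> sep_cont G a -> sep_cont L a ->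
  loop_int psi (fun t p => G t p - L t p) x1 x2 y1 y2
  = loop_int psi G x1 x2 y1 y2 - loop_int psi L x1 x2 y1 y2.
Proof.
  intros Ha Hx H1 Hy Hpsi HG HL; unfold loop_int.
  assert (CA : forall t, (a <= t <= 1)%R -> CInt (fun p => (G t p - L t p) * psi p) y1 y2 =
    CInt (fun p => G t p * psi p) y1 y2 - CInt (fun p => L t p * psi p) y1 y2).
  { intros t Ht; rewrite <- CInt_minus; [| exact Hy | |].
    - apply CInt_ext; [exact Hy |]; intros; ring.
    - intros p _; apply rcont_mult; [apply (HG t p Ht) | apply Hpsi].
    - intros p _; apply rcont_mult; [apply (HL t p Ht) | apply Hpsi]. }
  assert (CB : forall p, CInt (fun t => (G t p - L t p) / RtoC t) x1 x2 =
    CInt (fun t => G t p / RtoC t) x1 x2 - CInt (fun t => L t p / RtoC t) x1 x2).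
  { intros p; rewrite <- CInt_minus; [| exact Hx | |].
    - apply CInt_ext; [exact Hx |]; intros; unfold Cdiv; ring.
    - intros t Ht; apply rcont_div_t; [lra | apply (HG t p); lra].
    - intros t Ht; apply rcont_div_t; [lra | apply (HL t p); lra]. }
  rewrite (CA x1), (CA x2), (CB y1), (CB y2) by lra; ring.
Qed.

Definition is_rderive (v : R -> C) (p : R) (l : C) : Prop :=
  is_derive (fun x => Re (v x)) p (Re l) /\ is_derive (fun x => Im (v x)) p (Im l).

Lemma is_rderive_rcont (v : R -> C) (p : R) (l : C) : is_rderive v p l -> rcont v p.
Proof.
  intros [H1 H2]; split; apply (ex_derive_continuous (K := R_AbsRing) (V := R_NormedModule));
    eexists; eassumption.
Qed.

(** The pulled-back form is [A (dt/t + psi dp) + B d(t v)]. In the first summand the variables are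
    separated and the second is exact, so opposite sides cancel. *)
Lemma loop_int_linear (v dv : R -> C) (A B : C) (x1 x2 y1 y2 : R) :
  (0 < x1 <= x2)%R -> (y1 <= y2)%R ->
  (forall p, is_rderive v p (dv p)) -> (forall p, rcont dv p) -> (forall p, v p <> 0) ->
  loop_int (fun p => dv p / v p) (fun t p => A + B * (RtoC t * v p)) x1 x2 y1 y2 = 0.
Proof.
  intros Hx Hy Hv Hdv Hn; unfold loop_int.
  assert (Cv : forall p, rcont v p) by (intros p; apply (is_rderive_rcont v p _ (Hv p))).
  assert (Cq : forall p, rcont (fun p => dv p / v p) p)
    by (intros p; apply rcont_div; auto).
  assert (CA : forall t, CInt (fun p => (A + B * (RtoC t * v p)) * (dv p / v p)) y1 y2 =
    A * CInt (fun p => dv p / v p) y1 y2 + B * RtoC t * (v y2 - v y1)).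
  { intros t; rewrite <- (CInt_derive v dv); [| exact Hy | intros p _; apply Hdv
      | intros p _; apply Hv].
    rewrite <- !CInt_scal; try exact Hy; [| intros p _; apply Hdv | intros p _; apply Cq].
    rewrite <- CInt_plus; [| exact Hy | |].
    - apply CInt_ext; [exact Hy |]; intros p _; field; apply Hn.
    - intros p _; apply rcont_mult; [apply rcont_const | apply Cq].
    - intros p _; apply rcont_mult; [apply rcont_const | apply Hdv]. }
  assert (CB : forall p, CInt (fun t => (A + B * (RtoC t * v p)) / RtoC t) x1 x2 =
    CInt (fun t => A / RtoC t) x1 x2 + B * v p * RtoC (x2 - x1)).
  { intros p; rewrite <- CInt_const by lra.
    rewrite <- CInt_plus; [| lra | |].
    - apply CInt_ext; [lra |]; intros t Ht; field; intros E; apply RtoC_inj in E; lra.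
    - intros t Ht; apply rcont_div_t; [lra | apply rcont_const].
    - intros t _; apply rcont_const. }
  rewrite !CA, !CB, RtoC_minus; ring.
Qed.

(* Goursat's lemma: after [n] bisections the loop integral has lost at most a factor [4^n],
   while differentiability at the limit point makes it [o(4^-n)]. *)
Lemma Goursat (h : C -> C) (z : C) (v dv : R -> C) (K a c d : R) :
  (0 < a <= 1)%R -> (c <= d)%R ->
  (forall p, is_rderive v p (dv p)) -> (forall p, rcont dv p) -> (forall p, v p <> 0) ->
  (forall p, (Cmod (v p) <= K)%R) -> (forall p, (Cmod (dv p / v p) <= K)%R) ->
  (forall p q, (Cmod (v p - v q) <= K * Rabs (p - q))%R) ->
  (forall t p, (a <= t <= 1)%R -> holo h (z + RtoC t * v p)) ->
  loop_int (fun p => dv p / v p) (fun t p => h (z + RtoC t * v p)) a 1 c d = 0.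
Proof.
  intros Ha Hcd Hv Hdv Hn HK1 HK2 HK3 Hh.
  set (psi := fun p => dv p / v p).
  set (H := fun t p => h (z + RtoC t * v p)).
  assert (Cv : forall p, rcont v p) by (intros p; apply (is_rderive_rcont v p _ (Hv p))).
  assert (Cpsi : forall p, rcont psi p) by (intros p; apply rcont_div; auto).
  assert (SH : sep_cont H a).
  { intros t p Ht; split.
    - apply (rcont_comp (fun q => z + RtoC t * v q) h).
      + apply rcont_plus; [apply rcont_const | apply rcont_mult; [apply rcont_const | apply Cv]].
      + apply holo_cont, Hh, Ht.
    - apply (rcont_comp (fun s => z + RtoC s * v p) h).
      + apply rcont_plus; [apply rcont_const | apply rcont_mult; [apply rcont_RtoC | apply rcont_const]].
      + apply holo_cont, Hh, Ht. }
  apply NNPP; intros N; apply Cmod_gt_0 in N.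
  set (D := Cmod (loop_int psi H a 1 c d)) in *.
  assert (HK0 : (0 <= K)%R) by (eapply Rle_trans; [apply Cmod_ge_0 | apply (HK1 0%R)]).
  destruct (rectangle_bisection (fun x1 x2 y1 y2 n =>
    (D <= 4 ^ n * Cmod (loop_int psi H x1 x2 y1 y2))%R) a 1 c d) as [x [y [Hx [Hy Hlim]]]].
  - lra.
  - exact Hcd.
  - simpl; unfold D; lra.
  - intros n x1 x2 y1 y2 Hx1 Hx2 Hy1 Hy2 HD mx my.
    rewrite (loop_int_split psi H a x1 mx x2 y1 my y2) in HD by
      (try assumption; unfold mx, my; lra).
    set (u1 := loop_int psi H x1 mx y1 my) in *; set (u2 := loop_int psi H mx x2 y1 my) in *.
    set (u3 := loop_int psi H x1 mx my y2) in *; set (u4 := loop_int psi H mx x2 my y2) in *.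
    assert (T := Cmod_triangle (u1 + u2 + u3) u4).
    assert (T' := Cmod_triangle (u1 + u2) u3); assert (T'' := Cmod_triangle u1 u2).
    assert (P4 : (0 < 4 ^ n)%R) by (apply pow_lt; lra).
    simpl.
    destruct (Rle_dec D (4 * 4 ^ n * Cmod u1)) as [? | N1]; [tauto |].
    destruct (Rle_dec D (4 * 4 ^ n * Cmod u2)) as [? | N2]; [tauto |].
    destruct (Rle_dec D (4 * 4 ^ n * Cmod u3)) as [? | N3]; [tauto |].
    destruct (Rle_dec D (4 * 4 ^ n * Cmod u4)) as [? | N4]; [tauto |].
    exfalso; nra.
  - destruct (Hh x y Hx) as [l Hl].
    set (w0 := z + RtoC x * v y) in *.
    set (S := (1 - a + (d - c))%R).
    (* [M - 1] is the coefficient of [e] in the final estimate [Z], which then contradicts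
       [e * M = D / 2]. *)
    set (M := (4 * (K * S) * (K * S + S / a) + 1)%R).
    assert (HS : (0 <= S)%R) by (unfold S; lra).
    assert (HSa : (0 <= S / a)%R) by (apply Rmult_le_pos; [lra | left; apply Rinv_0_lt_compat; lra]).
    assert (HKS : (0 <= K * S)%R) by (apply Rmult_le_pos; assumption).
    assert (HM : (0 < M)%R) by (unfold M; nra).
    destruct (Hl (D / (2 * M))%R) as [del [Hdel Hl']]; [apply Rdiv_lt_0_compat; lra |].
    set (e := (D / (2 * M))%R) in *.
    assert (He : (0 < e)%R) by (apply Rdiv_lt_0_compat; lra).
    (* With this [n] the image of the rectangle lies within [K * (S / 2 ^ n) < del] of [w0]. *)
    destruct (Pow_x_infinity 2 ltac:(rewrite Rabs_pos_eq; lra) ((K * S + 1) / del)%R) as [n Hn0].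
    specialize (Hn0 n (le_n n)).
    assert (P2 : (0 < 2 ^ n)%R) by (apply pow_lt; lra).
    rewrite Rabs_pos_eq in Hn0 by lra.
    assert (Hsmall : (K * (S / 2 ^ n) < del)%R).
    { apply Rge_le in Hn0; apply (Rmult_le_compat_r del) in Hn0; [| lra].
      unfold Rdiv in Hn0 at 1; rewrite Rmult_assoc, Rinv_l, Rmult_1_r in Hn0 by lra.
      apply (Rmult_lt_reg_r (2 ^ n)); [lra |].
      replace (K * (S / 2 ^ n) * 2 ^ n)%R with (K * S)%R by (field; lra). lra. }
    destruct (Hlim n) as [x1 [x2 [y1 [y2 [HD [Q1 [Q2 [Q3 [Q4 [Q5 Q6]]]]]]]]]].
    (* [L] is the pull-back of the first-order expansion of [h] at [w0]. Its loop integral vanishes,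
       so only the remainder of the expansion has to be bounded. *)
    set (A := h w0 + l * (z - w0)).
    set (L := fun (t p : R) => A + l * (RtoC t * v p)).
    assert (SL : sep_cont L a).
    { intros t p _; split.
      - apply rcont_plus; [apply rcont_const | apply rcont_mult; [apply rcont_const |]].
        apply rcont_mult; [apply rcont_const | apply Cv].
      - apply rcont_plus; [apply rcont_const | apply rcont_mult; [apply rcont_const |]].
        apply rcont_mult; [apply rcont_RtoC | apply rcont_const]. }
    assert (SHL : sep_cont (fun t p => H t p - L t p) a).
    { intros t p Ht; destruct (SH t p Ht), (SL t p Ht); split; apply rcont_minus; assumption. }
    assert (E : loop_int psi H x1 x2 y1 y2 = loop_int psi (fun t p => H t p - L t p) x1 x2 y1 y2).
    { rewrite (loop_int_minus psi H L a) by (try assumption; lra).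
      assert (EL : loop_int psi L x1 x2 y1 y2 = 0)
        by (apply (loop_int_linear v dv A l); try assumption; lra).
      rewrite EL; ring. }
    assert (HS1 : (x2 - x1 <= S / 2 ^ n)%R).
    { rewrite Q5; unfold S, Rdiv; apply Rmult_le_compat_r; [left; apply Rinv_0_lt_compat |]; lra. }
    assert (HS2 : (y2 - y1 <= S / 2 ^ n)%R).
    { rewrite Q6; unfold S, Rdiv; apply Rmult_le_compat_r; [left; apply Rinv_0_lt_compat |]; lra. }
    assert (HS3 : (x2 - x1 + (y2 - y1) = S / 2 ^ n)%R) by (rewrite Q5, Q6; unfold S; field; lra).
    rewrite E in HD.
    assert (B := loop_int_bound psi (fun t p => H t p - L t p) a K (e * (K * (S / 2 ^ n)))%R
      x1 x2 y1 y2 ltac:(lra) ltac:(lra) ltac:(lra) ltac:(lra) Cpsi HK2 SHL).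
    assert (B' : (Cmod (loop_int psi (fun t p => (H t p - L t p)%C) x1 x2 y1 y2) <=
      4 * (e * (K * (S / 2 ^ n))) * (K * (y2 - y1) + (x2 - x1) / a))%R).
    { apply B; intros t p Ht Hp; unfold H, L, A.
      set (w := z + RtoC t * v p).
      replace (h w - (h w0 + l * (z - w0) + l * (RtoC t * v p)))
        with (h w - h w0 - l * (w - w0)) by (unfold w; ring).
      assert (W : (Cmod (w - w0) <= K * (S / 2 ^ n))%R).
      { replace (w - w0) with (RtoC (t - x) * v p + RtoC x * (v p - v y))
          by (unfold w, w0; rewrite RtoC_minus; ring).
        eapply Rle_trans; [apply Cmod_triangle |].
        rewrite !Cmod_mult, !Cmod_R, (Rabs_pos_eq x) by lra.
        assert (A1 : (Rabs (t - x) <= x2 - x1)%R) by (apply Rabs_le; lra).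
        assert (A2 : (Rabs (p - y) <= y2 - y1)%R) by (apply Rabs_le; lra).
        assert (A3 := HK3 p y); assert (A4 := HK1 p).
        assert (A5 := Rabs_pos (t - x)); assert (A6 := Cmod_ge_0 (v p)).
        assert (A7 := Cmod_ge_0 (v p - v y)).
        assert (T1 : (Rabs (t - x) * Cmod (v p) <= (x2 - x1) * K)%R)
          by (apply Rmult_le_compat; lra).
        assert (T2 : (x * Cmod (v p - v y) <= 1 * (K * (y2 - y1)))%R).
        { apply Rmult_le_compat; try lra. eapply Rle_trans; [exact A3 |].
          apply Rmult_le_compat_l; lra. }
        rewrite <- HS3; lra. }
      eapply Rle_trans; [apply Hl'; lra |]; apply Rmult_le_compat_l; lra. }
    assert (B2 : (K * (y2 - y1) + (x2 - x1) / a <= (K * S + S / a) / 2 ^ n)%R).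
    { replace ((K * S + S / a) / 2 ^ n)%R with (K * (S / 2 ^ n) + (S / 2 ^ n) / a)%R
        by (field; lra).
      apply Rplus_le_compat; [apply Rmult_le_compat_l; lra |].
      apply Rmult_le_compat_r; [left; apply Rinv_0_lt_compat |]; lra. }
    assert (P4 : (0 < 4 ^ n)%R) by (apply pow_lt; lra).
    assert (F : (4 ^ n = 2 ^ n * 2 ^ n)%R) by (rewrite <- Rpow_mult_distr; f_equal; ring).
    assert (Z : (D <= e * (M - 1))%R).
    { eapply Rle_trans; [exact HD |].
      apply (Rle_trans _ (4 ^ n * (4 * (e * (K * (S / 2 ^ n))) * ((K * S + S / a) / 2 ^ n)))%R).
      - apply Rmult_le_compat_l; [lra |].
        eapply Rle_trans; [exact B' |]; apply Rmult_le_compat_l; [| exact B2].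
        assert (0 <= S / 2 ^ n)%R by (apply Rmult_le_pos; [lra | left; apply Rinv_0_lt_compat; lra]).
        assert (0 <= K * (S / 2 ^ n))%R by (apply Rmult_le_pos; assumption). nra.
      - right; rewrite F; unfold M; field; split; lra. }
    assert (e * M = D / 2)%R by (unfold e; field; lra). nra.
Qed.

(** * Convergence of complex series *)

Fixpoint csumn (a : nat -> C) (n : nat) : C :=
  match n with O => 0 | S m => csumn a m + a m end.

Definition csum_to (a : nat -> C) (l : C) : Prop :=
  forall eps, (0 < eps)%R -> exists N, forall n, (N <= n)%nat -> (Cmod (csumn a n - l) < eps)%R.

Lemma csumn_ext (a b : nat -> C) (n : nat) :
  (forall k, (k < n)%nat -> a k = b k) -> csumn a n = csumn b n.
Proof.
  induction n as [| n IH]; intros H; simpl; [reflexivity |].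
  rewrite IH, H by (intros; try apply H; lia); reflexivity.
Qed.

Lemma csumn_scal (c : C) (a : nat -> C) (n : nat) : csumn (fun k => c * a k) n = c * csumn a n.
Proof. induction n as [| n IH]; simpl; [ring | rewrite IH; ring]. Qed.

Lemma csumn_plus (a b : nat -> C) (n : nat) :
  csumn (fun k => a k + b k) n = csumn a n + csumn b n.
Proof. induction n as [| n IH]; simpl; [ring | rewrite IH; ring]. Qed.

Lemma csum_to_ext (a b : nat -> C) (l : C) :
  (forall k, a k = b k) -> csum_to a l -> csum_to b l.
Proof.
  intros E H eps He; destruct (H eps He) as [N HN]; exists N; intros n Hn.
  rewrite <- (csumn_ext a b) by auto; auto.
Qed.

Lemma csum_to_scal (c : C) (a : nat -> C) (l : C) :
  csum_to a l -> csum_to (fun k => c * a k) (c * l).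
Proof.
  intros H eps He.
  assert (P := Cmod_ge_0 c).
  destruct (H (eps / (Cmod c + 1))%R) as [N HN]; [apply Rdiv_lt_0_compat; lra |].
  exists N; intros n Hn; rewrite csumn_scal.
  replace (c * csumn a n - c * l) with (c * (csumn a n - l)) by ring; rewrite Cmod_mult.
  specialize (HN n Hn); apply (Rmult_lt_compat_r (Cmod c + 1)) in HN; [| lra].
  unfold Rdiv in HN; rewrite Rmult_assoc, Rinv_l, Rmult_1_r in HN by lra.
  assert (Q := Cmod_ge_0 (csumn a n - l)); nra.
Qed.

Lemma csum_to_plus (a b : nat -> C) (l m : C) :
  csum_to a l -> csum_to b m -> csum_to (fun k => a k + b k) (l + m).
Proof.
  intros Ha Hb eps He.
  destruct (Ha (eps / 2)%R) as [N HN]; [lra |]; destruct (Hb (eps / 2)%R) as [N' HN']; [lra |].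
  exists (N + N')%nat; intros n Hn; rewrite csumn_plus.
  replace (csumn a n + csumn b n - (l + m)) with ((csumn a n - l) + (csumn b n - m)) by ring.
  specialize (HN n ltac:(lia)); specialize (HN' n ltac:(lia)).
  eapply Rle_lt_trans; [apply Cmod_triangle | lra].
Qed.

Lemma Cmod_small_eq (a b : C) : (forall eps, (0 < eps)%R -> (Cmod (a - b) < eps)%R) -> a = b.
Proof.
  intros H; apply NNPP; intros N.
  assert (K : a - b <> 0) by (intros E; apply N; rewrite <- (Cplus_0_l b), <- E; ring).
  apply Cmod_gt_0 in K; specialize (H _ K); lra.
Qed.

Lemma csum_to_unique (a : nat -> C) (l m : C) : csum_to a l -> csum_to a m -> l = m.
Proof.
  intros Hl Hm; apply Cmod_small_eq; intros e He.
  destruct (Hl (e / 2)%R) as [N HN]; [lra |]; destruct (Hm (e / 2)%R) as [N' HN']; [lra |].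
  specialize (HN (N + N')%nat ltac:(lia)); specialize (HN' (N + N')%nat ltac:(lia)).
  set (s := csumn a (N + N')) in *.
  replace (l - m) with (- (s - l) + (s - m)) by ring.
  eapply Rle_lt_trans; [apply Cmod_triangle |]; rewrite Cmod_opp; lra.
Qed.

(** * Circles and Cauchy's integral formula *)

Definition cis (r p : R) : C := ((r * cos p)%R, (r * sin p)%R).

Lemma Cmod_cis (r p : R) : (0 <= r)%R -> Cmod (cis r p) = r.
Proof.
  intros Hr; unfold Cmod, cis; simpl.
  replace (r * cos p * (r * cos p * 1) + r * sin p * (r * sin p * 1))%R with (r * r)%R.
  - apply sqrt_square; exact Hr.
  - assert (E := sin2_cos2 p); unfold Rsqr in E; nra.
Qed.

Lemma is_rderive_cis (r p : R) : is_rderive (cis r) p (Ci * cis r p).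
Proof. split; simpl; auto_derive; auto; ring. Qed.

Lemma rcont_cis (r p : R) : rcont (cis r) p.
Proof. exact (is_rderive_rcont _ _ _ (is_rderive_cis r p)). Qed.

Lemma Rabs_diff_le (f df : R -> R) (a b : R) :
  (forall t, is_derive f t (df t)) -> (forall t, (Rabs (df t) <= 1)%R) ->
  (Rabs (f a - f b) <= Rabs (a - b))%R.
Proof.
  intros Hf Hb.
  destruct (MVT_gen f b a df) as [t [_ E]].
  - intros x _; apply Hf.
  - intros x _; apply continuity_pt_filterlim.
    apply (ex_derive_continuous (K := R_AbsRing) (V := R_NormedModule)); eexists; apply Hf.
  - rewrite E, Rabs_mult; specialize (Hb t); assert (P := Rabs_pos (a - b)); nra.
Qed.

Lemma cis_Lipschitz (r p q : R) : (0 <= r)%R ->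
  (Cmod (cis r p - cis r q) <= 2 * r * Rabs (p - q))%R.
Proof.
  intros Hr; eapply Rle_trans; [apply Cmod_le_Re_Im |]; simpl.
  assert (A : (Rabs (cos p - cos q) <= Rabs (p - q))%R).
  { apply (Rabs_diff_le cos (fun t => - sin t)%R); [intros; auto_derive; auto; ring |].
    intros t; rewrite Rabs_Ropp; apply Rabs_le, SIN_bound. }
  assert (B : (Rabs (sin p - sin q) <= Rabs (p - q))%R).
  { apply (Rabs_diff_le sin cos); [intros; auto_derive; auto; ring |].
    intros t; apply Rabs_le, COS_bound. }
  replace (r * cos p + - (r * cos q))%R with (r * (cos p - cos q))%R by ring.
  replace (r * sin p + - (r * sin q))%R with (r * (sin p - sin q))%R by ring.
  rewrite !Rabs_mult, (Rabs_pos_eq r) by exact Hr; nra.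
Qed.

Lemma cis_neq0 (r p : R) : (0 < r)%R -> cis r p <> 0.
Proof. intros Hr; apply Cmod_gt_0; rewrite Cmod_cis; lra. Qed.

Lemma cis_minus_neq0 (r p : R) (u : C) : (Cmod u < r)%R -> cis r p - u <> 0.
Proof.
  intros Hu E; assert (H := Cmod_ge_0 u).
  assert (K : cis r p = u) by (rewrite <- (Cplus_0_l u), <- E; ring).
  assert (L := Cmod_cis r p ltac:(lra)); rewrite K in L; lra.
Qed.

Lemma Cmod_cis_minus (r p : R) (u : C) : (0 <= r)%R -> (r - Cmod u <= Cmod (cis r p - u))%R.
Proof. intros Hr; rewrite <- (Cmod_cis r p Hr) at 1; apply Cmod_rev_triangle. Qed.

Lemma rcont_kernel (r p : R) (u : C) : (Cmod u < r)%R ->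
  rcont (fun p => Ci * cis r p / (cis r p - u)) p.
Proof.
  intros Hu; apply rcont_div; [apply rcont_mult; [apply rcont_const | apply rcont_cis] | |].
  - apply rcont_minus; [apply rcont_cis | apply rcont_const].
  - apply cis_minus_neq0, Hu.
Qed.

(** The circle is contracted to [z] along the segments [z + t v(p)]. By [Goursat] the integral of
    [h(w) dw / (w - z)] does not change, the sides [p = 0] and [p = 2 PI] cancelling by periodicity
    of [v]; for small [t] the factor [h] is close to [h z]. The integral of the bare kernel is
    evaluated separately in [CInt_kernel]. *)
Lemma Cauchy_kernel (h : C -> C) (c z : C) (r R0 : R) :
  (0 < r < R0)%R -> (Cmod (z - c) < r)%R ->
  (forall w, (Cmod (w - c) < R0)%R -> holo h w) ->
  CInt (fun p => h (c + cis r p) * (Ci * cis r p / (cis r p - (z - c)))) 0 (2 * PI) =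
  h z * CInt (fun p => Ci * cis r p / (cis r p - (z - c))) 0 (2 * PI).
Proof.
  intros Hr Hz Hh.
  assert (Pi := PI_RGT_0).
  set (u := z - c) in *.
  set (v := fun p => cis r p - u); set (dv := fun p => Ci * cis r p).
  set (psi := fun p => dv p / v p).
  (* One constant for the three bounds required by [Goursat]: [2 * r] for [v] and for its Lipschitz
     constant, [r / (r - Cmod u)] for [psi]. *)
  set (K := (2 * r + r / (r - Cmod u))%R).
  assert (Hu := Cmod_ge_0 u).
  assert (Hq : (0 < r / (r - Cmod u))%R) by (apply Rdiv_lt_0_compat; lra).
  assert (Hdvn : forall p, Cmod (dv p) = r).
  { intros p; unfold dv; rewrite Cmod_mult, Cmod_Ci, Cmod_cis; lra. }
  assert (Hvn : forall p, v p <> 0) by (intros p; apply cis_minus_neq0, Hz).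
  assert (Hpsi : forall p, (Cmod (psi p) <= K)%R).
  { intros p; unfold psi; rewrite Cmod_div by apply Hvn; rewrite Hdvn.
    assert (A := Cmod_cis_minus r p u ltac:(lra)).
    apply (Rle_trans _ (r / (r - Cmod u))%R); [| unfold K; lra].
    apply Rmult_le_compat_l; [lra |]; apply Rinv_le_contravar; [lra | exact A]. }
  assert (Hdom : forall t p, (0 <= t <= 1)%R -> (Cmod (z + RtoC t * v p - c) < R0)%R).
  { intros t p Ht.
    replace (z + RtoC t * v p - c) with (RtoC (1 - t) * u + RtoC t * cis r p)
      by (unfold v, u; rewrite RtoC_minus; ring).
    eapply Rle_lt_trans; [apply Cmod_triangle |].
    rewrite !Cmod_mult, !Cmod_R, !Rabs_pos_eq, Cmod_cis by lra; nra. }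
  assert (Hv2 : forall p, (Cmod (v p) <= K)%R).
  { intros p; unfold v, Cminus; eapply Rle_trans; [apply Cmod_triangle |].
    rewrite Cmod_opp, Cmod_cis by lra; unfold K; lra. }
  assert (HdvC : forall p, rcont dv p)
    by (intros p; apply rcont_mult; [apply rcont_const | apply rcont_cis]).
  assert (HvC : forall p, rcont v p)
    by (intros p; apply rcont_minus; [apply rcont_cis | apply rcont_const]).
  assert (HpsiC : forall p, rcont psi p) by (intros p; apply rcont_div; auto).
  assert (HgC : forall t p, (0 <= t <= 1)%R -> rcont (fun p => h (z + RtoC t * v p)) p).
  { intros t p Ht; apply (rcont_comp (fun p => z + RtoC t * v p) h).
    - apply rcont_plus; [apply rcont_const | apply rcont_mult; [apply rcont_const | apply HvC]].
    - apply holo_cont, Hh, Hdom, Ht. }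
  assert (Hinv : forall a, (0 < a <= 1)%R ->
    CInt (fun p => h (z + RtoC 1 * v p) * psi p) 0 (2 * PI) =
    CInt (fun p => h (z + RtoC a * v p) * psi p) 0 (2 * PI)).
  { intros a Ha.
    assert (G : loop_int psi (fun t p => h (z + RtoC t * v p)) a 1 0 (2 * PI) = 0).
    { apply (Goursat h z v dv K); try assumption; try lra.
      - intros p; destruct (is_rderive_cis r p) as [D1 D2]; split.
        + apply (is_derive_ext (fun x => Re (cis r x) + - Re u)%R); [reflexivity |].
          replace (Re (dv p)) with (Re (dv p) + 0)%R by ring.
          apply (is_derive_plus (K := R_AbsRing) (V := R_NormedModule));
            [exact D1 | apply (is_derive_const (K := R_AbsRing) (V := R_NormedModule))].
        + apply (is_derive_ext (fun x => Im (cis r x) + - Im u)%R); [reflexivity |].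
          replace (Im (dv p)) with (Im (dv p) + 0)%R by ring.
          apply (is_derive_plus (K := R_AbsRing) (V := R_NormedModule));
            [exact D2 | apply (is_derive_const (K := R_AbsRing) (V := R_NormedModule))].
      - intros p q; unfold v.
        replace (cis r p - u - (cis r q - u)) with (cis r p - cis r q) by ring.
        eapply Rle_trans; [apply cis_Lipschitz; lra |].
        apply Rmult_le_compat_r; [apply Rabs_pos | unfold K; lra].
      - intros t p Ht; apply Hh, Hdom; lra. }
    unfold loop_int in G.
    assert (V : v (2 * PI)%R = v 0%R).
    { unfold v, cis; rewrite cos_2PI, sin_2PI, cos_0, sin_0; reflexivity. }
    rewrite V in G.
    match type of G with ?x - ?y - _ = _ => replace x with (y + (x - y)) by ring end.
    replace (CInt (fun p : R => h (z + RtoC 1 * v p) * psi p) 0 (2 * PI) -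
      CInt (fun p : R => h (z + RtoC a * v p) * psi p) 0 (2 * PI)) with (RtoC 0)
      by (rewrite <- G; ring).
    ring. }
  assert (E1 : CInt (fun p => h (c + cis r p) * (Ci * cis r p / (cis r p - u))) 0 (2 * PI) =
    CInt (fun p => h (z + RtoC 1 * v p) * psi p) 0 (2 * PI)).
  { apply CInt_ext; [lra |]; intros p _; unfold psi, v, dv; f_equal; f_equal; unfold u; ring. }
  rewrite E1; apply Cmod_small_eq; intros e He.
  assert (HK : (0 < K)%R) by (unfold K; lra).
  (* Chosen so that [CInt_bound] over a length [2 * PI] returns [4 * PI * K * e' = e / 2]. *)
  set (e' := (e / (8 * K * PI))%R).
  assert (He' : (0 < e')%R) by (apply Rdiv_lt_0_compat; [lra | nra]).
  destruct (holo_cont _ _ (Hh z ltac:(fold u; lra)) e' He') as [d [Hd Hd']].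
  set (a := Rmin 1 (d / (2 * K))%R).
  assert (Ha : (0 < a)%R) by (apply Rmin_pos; [lra | apply Rdiv_lt_0_compat; lra]).
  assert (Ha1 : (a <= 1)%R) by apply Rmin_l.
  assert (Ha2 : (a * K < d)%R).
  { assert (a <= d / (2 * K))%R by apply Rmin_r.
    assert (d / (2 * K) * K = d / 2)%R by (field; lra). nra. }
  rewrite (Hinv a) by lra; rewrite <- CInt_scal, <- CInt_minus; try lra.
  - rewrite (CInt_ext _ (fun p => (h (z + RtoC a * v p) - h z) * psi p))
      by (try lra; intros p _; unfold psi, dv, v; ring).
    eapply Rle_lt_trans; [apply (CInt_bound _ 0 (2 * PI) (e' * K)); [lra | |] |].
    + intros p _; apply rcont_mult; [apply rcont_minus; [apply HgC; lra | apply rcont_const] |].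
      apply HpsiC.
    + intros p _; rewrite Cmod_mult; apply Rmult_le_compat; try apply Cmod_ge_0; [| apply Hpsi].
      left; apply Hd'.
      replace (z + RtoC a * v p - z) with (RtoC a * v p) by ring.
      rewrite Cmod_mult, Cmod_R, Rabs_pos_eq by lra.
      eapply Rle_lt_trans; [| exact Ha2]; apply Rmult_le_compat_l; [lra | apply Hv2].
    + replace (2 * (e' * K) * (2 * PI - 0))%R with (e / 2)%R; [lra |].
      unfold e'; field; split; lra.
  - intros p _; apply rcont_mult; [apply HgC; lra | apply HpsiC].
  - intros p _; apply rcont_mult; [apply rcont_const | apply HpsiC].
  - intros p _; apply HpsiC.
Qed.

Lemma pow_lt_eps (x eps : R) : (0 <= x < 1)%R -> (0 < eps)%R ->
  exists N, forall n, (N <= n)%nat -> (x ^ n < eps)%R.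
Proof.
  intros Hx He.
  destruct (pow_lt_1_zero x ltac:(rewrite Rabs_pos_eq; lra) eps He) as [N HN].
  exists N; intros n Hn; specialize (HN n Hn).
  rewrite Rabs_pos_eq in HN; [exact HN | apply pow_le; lra].
Qed.

(** Geometric expansion of the kernel with exact remainder: after [n] terms there remains the
    integral of [f] times [(u / cis r p) ^ n], which tends to 0 because [Cmod u < r]. *)
Lemma kernel_series (g : R -> C) (r : R) (u : C) :
  (0 < r)%R -> (Cmod u < r)%R -> (forall p, rcont g p) ->
  csum_to (fun k => Ci * CInt (fun p => g p / cis r p ^ k) 0 (2 * PI) * u ^ k)
    (CInt (fun p => g p * (Ci * cis r p / (cis r p - u))) 0 (2 * PI)).
Proof.
  intros Hr Hu Hg.
  assert (Pi := PI_RGT_0).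
  set (ker := fun p => Ci * cis r p / (cis r p - u)).
  assert (Cker : forall p, rcont ker p) by (intros p; apply rcont_kernel, Hu).
  assert (Cq : forall k p, rcont (fun p => g p / cis r p ^ k) p).
  { intros k p; apply rcont_div; [apply Hg | apply rcont_pow, rcont_cis |].
    apply Cpow_nz, cis_neq0, Hr. }
  set (f := fun p => g p * ker p).
  assert (Cf : forall p, rcont f p) by (intros p; apply rcont_mult; auto).
  assert (Cx : forall n p, rcont (fun p => f p * (u / cis r p) ^ n) p).
  { intros n p; apply rcont_mult; [apply Cf |]; apply rcont_pow, rcont_div;
      [apply rcont_const | apply rcont_cis | apply cis_neq0, Hr]. }
  assert (E : forall n, CInt f 0 (2 * PI) -
    csumn (fun k => Ci * CInt (fun p => g p / cis r p ^ k) 0 (2 * PI) * u ^ k) n =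
    CInt (fun p => f p * (u / cis r p) ^ n) 0 (2 * PI)).
  { induction n as [| n IH].
    - simpl; rewrite (CInt_ext (fun p => f p * 1) f) by (try lra; intros; ring); ring.
    - simpl csumn.
      match goal with |- ?x - (?y + ?t) = _ => replace (x - (y + t)) with (x - y - t) by ring end.
      rewrite IH.
      replace (Ci * CInt (fun p => g p / cis r p ^ n) 0 (2 * PI) * u ^ n)
        with ((Ci * u ^ n) * CInt (fun p => g p / cis r p ^ n) 0 (2 * PI)) by ring.
      rewrite <- CInt_scal, <- CInt_minus; try lra.
      + apply CInt_ext; [lra |]; intros p _; unfold f, ker, Cdiv.
        rewrite !Cpow_mult_l, !Cpow_inv by (apply cis_neq0, Hr); simpl.
        assert (N1 := cis_neq0 r p Hr); assert (N2 := cis_minus_neq0 r p u Hu).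
        assert (N3 := Cpow_nz _ n N1).
        field; auto.
      + intros p _; apply Cx.
      + intros p _; apply rcont_mult; [apply rcont_const | apply Cq].
      + intros p _; apply Cq. }
  assert (HM : exists M, (0 < M)%R /\ forall p, (0 <= p <= 2 * PI)%R -> (Cmod (f p) <= M)%R).
  { destruct (continuity_ab_maj (fun p => Cmod (f p)) 0 (2 * PI)) as [p0 [H1 H2]]; [lra | |].
    - intros p _; apply continuity_pt_filterlim, continuous_eps.
      intros e He; destruct (proj1 (rcont_eps f p) (Cf p) e He) as [d [Hd H]].
      exists d; split; [exact Hd |]; intros x Hx; specialize (H x Hx).
      eapply Rle_lt_trans; [| exact H]; apply Rabs_le; split.
      + assert (T := Cmod_rev_triangle (f p) (f x)); rewrite Cmod_minus_sym in T; lra.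
      + apply Cmod_rev_triangle.
    - exists (Cmod (f p0) + 1)%R; split; [assert (T := Cmod_ge_0 (f p0)); lra |].
      intros p Hp; specialize (H1 p Hp); lra. }
  destruct HM as [M [HM HMf]].
  intros e He.
  assert (Hu0 := Cmod_ge_0 u).
  assert (Hx : (0 <= Cmod u / r < 1)%R).
  { split; [apply Rmult_le_pos; [lra | left; apply Rinv_0_lt_compat; lra] |].
    apply (Rmult_lt_reg_r r); [lra |]; unfold Rdiv; rewrite Rmult_assoc, Rinv_l; lra. }
  destruct (pow_lt_eps (Cmod u / r)%R (e / (4 * M * PI))%R Hx) as [N HN].
  { apply Rdiv_lt_0_compat; [lra | nra]. }
  exists N; intros n Hn; rewrite Cmod_minus_sym.
  change (CInt (fun p => g p * (Ci * cis r p / (cis r p - u))) 0 (2 * PI))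
    with (CInt f 0 (2 * PI)).
  rewrite E.
  eapply Rle_lt_trans; [apply (CInt_bound _ 0 (2 * PI) (M * (Cmod u / r) ^ n)); [lra | |] |].
  - intros p _; apply Cx.
  - intros p Hp; rewrite Cmod_mult, Cmod_pow, Cmod_div, Cmod_cis by (try apply cis_neq0; lra).
    apply Rmult_le_compat_r; [apply pow_le; lra | apply HMf, Hp].
  - specialize (HN n Hn).
    apply (Rmult_lt_compat_r (4 * M * PI)) in HN; [| nra].
    replace (e / (4 * M * PI) * (4 * M * PI))%R with e in HN by (field; split; lra).
    lra.
Qed.

Lemma cis_pow (p : R) (n : nat) : cis 1 p ^ n = cis 1 (INR n * p).
Proof.
  induction n as [| n IH].
  - simpl; unfold cis; rewrite Rmult_0_l, cos_0, sin_0.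
    apply injective_projections; simpl; ring.
  - rewrite S_INR; simpl; rewrite IH; unfold cis.
    replace ((INR n + 1) * p)%R with (p + INR n * p)%R by ring.
    rewrite cos_plus, sin_plus; apply injective_projections; simpl; ring.
Qed.

Lemma cis_scale (r p : R) : cis r p = RtoC r * cis 1 p.
Proof. unfold cis; apply injective_projections; simpl; ring. Qed.

Lemma cis_inv (p : R) : / cis 1 p = cis 1 (- p).
Proof.
  assert (N := cis_neq0 1 p ltac:(lra)).
  replace (cis 1 (- p)) with (cis 1 p * cis 1 (- p) * / cis 1 p) by (field; exact N).
  replace (cis 1 p * cis 1 (- p)) with (RtoC 1); [ring |].
  unfold cis; rewrite cos_neg, sin_neg; assert (E := sin2_cos2 p); unfold Rsqr in E.
  apply injective_projections; simpl; lra.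
Qed.

Lemma CInt_cis_inv_pow (r : R) (k : nat) : (0 < r)%R -> (0 < k)%nat ->
  CInt (fun p => 1 / cis r p ^ k) 0 (2 * PI) = 0.
Proof.
  intros Hr Hk; assert (Pi := PI_RGT_0).
  assert (Hk' : (0 < INR k)%R) by (apply lt_0_INR; exact Hk).
  set (F := fun p : R => (RtoC (/ r ^ k) * ((sin (INR k * p) / INR k)%R, (cos (INR k * p) / INR k)%R))).
  rewrite (CInt_derive F).
  - unfold F; rewrite Rmult_0_r.
    replace (INR k * (2 * PI))%R with (0 + 2 * INR k * PI)%R by ring.
    rewrite sin_period, cos_period; ring.
  - lra.
  - intros p _; apply rcont_div; [apply rcont_const | apply rcont_pow, rcont_cis |].
    apply Cpow_nz, cis_neq0, Hr.
  - intros p _.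
    replace (1 / cis r p ^ k) with (RtoC (/ r ^ k) * cis 1 (- (INR k * p))).
    + assert (0 < r ^ k)%R by (apply pow_lt; exact Hr).
      unfold F, cis; rewrite cos_neg, sin_neg; split; simpl; auto_derive; auto; field; lra.
    + rewrite (cis_scale r p), Cpow_mult_l, cis_pow, <- cis_inv.
      assert (N := cis_neq0 1 (INR k * p) ltac:(lra)).
      assert (N' : (r ^ k <> 0)%R) by (apply pow_nonzero; lra).
      rewrite <- RtoC_pow, RtoC_inv by exact N'.
      field; split; [exact N | intros E; apply RtoC_inj in E; auto].
Qed.

(** In [kernel_series] for the constant function 1, all terms except [k = 0] integrate to 0. *)
Lemma CInt_kernel (r : R) (u : C) : (0 < r)%R -> (Cmod u < r)%R ->
  CInt (fun p => Ci * cis r p / (cis r p - u)) 0 (2 * PI) = 2 * PI * Ci.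
Proof.
  intros Hr Hu; assert (Pi := PI_RGT_0).
  assert (K := kernel_series (fun _ => 1) r u Hr Hu (fun p => rcont_const 1 p)).
  rewrite (CInt_ext _ (fun p => 1 * (Ci * cis r p / (cis r p - u)))) by (try lra; intros; ring).
  apply (csum_to_unique _ _ _ K); intros e He; exists 1%nat; intros n Hn.
  assert (E : csumn (fun k => Ci * CInt (fun p => 1 / cis r p ^ k) 0 (2 * PI) * u ^ k) n
    = 2 * PI * Ci).
  { destruct n as [| n]; [lia |]; clear Hn; induction n as [| n IH].
    - simpl; rewrite (CInt_ext _ (fun _ => 1)) by (try lra; intros; field).
      rewrite CInt_const by lra; rewrite RtoC_minus, RtoC_mult; ring.
    - change (csumn (fun k => Ci * CInt (fun p => 1 / cis r p ^ k) 0 (2 * PI) * u ^ k) (S n) +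
        Ci * CInt (fun p => 1 / cis r p ^ (S n)) 0 (2 * PI) * u ^ (S n) = 2 * PI * Ci).
      rewrite IH, CInt_cis_inv_pow by (try lia; lra); ring. }
  rewrite E, Cmod_self; exact He.
Qed.

(** [Cauchy_kernel] turns the expansion of [kernel_series] into one of [h z], up to the factor
    [2 PI i]. The coefficients are integrals over the circle about [c] and so do not depend on
    [z]. *)
Lemma holo_Taylor (h : C -> C) (c : C) (r R0 : R) :
  (0 < r < R0)%R -> (forall w, (Cmod (w - c) < R0)%R -> holo h w) ->
  exists K : nat -> C, forall z, (Cmod (z - c) < r)%R ->
    csum_to (fun k => K k * (z - c) ^ k) (h z).
Proof.
  intros Hr Hh; assert (Pi := PI_RGT_0).
  exists (fun k => CInt (fun p => h (c + cis r p) / cis r p ^ k) 0 (2 * PI) / (2 * PI)).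
  intros z Hz.
  assert (PN : 2 * PI <> 0) by (rewrite <- RtoC_mult; intros E; apply RtoC_inj in E; lra).
  assert (PN' : RtoC PI <> 0) by (intros E; apply RtoC_inj in E; lra).
  assert (Hg : forall p, rcont (fun p => h (c + cis r p)) p).
  { intros p; apply (rcont_comp (fun p => c + cis r p) h).
    - apply rcont_plus; [apply rcont_const | apply rcont_cis].
    - apply holo_cont, Hh; replace (c + cis r p - c) with (cis r p) by ring.
      rewrite Cmod_cis; lra. }
  assert (K := kernel_series (fun p => h (c + cis r p)) r (z - c) ltac:(lra) Hz Hg).
  cbv beta in K; rewrite (Cauchy_kernel h c z r R0 Hr Hz Hh), CInt_kernel in K by (try exact Hz; lra).
  apply (csum_to_scal (/ (2 * PI * Ci))) in K.
  assert (NI : Ci <> 0) by (intros E; injection E; lra).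
  replace (/ (2 * PI * Ci) * (h z * (2 * PI * Ci))) with (h z) in K by (field; auto).
  revert K; apply csum_to_ext; intros k; field; auto.
Qed.

(** * Identity theorem and maximum modulus *)

Lemma csum_to_bounded (a : nat -> C) (l : C) : csum_to a l ->
  exists M, (0 < M)%R /\ forall n, (Cmod (a n) <= M)%R.
Proof.
  intros H; destruct (H 1%R ltac:(lra)) as [N HN].
  assert (F : exists M, (0 < M)%R /\ forall n, (n < N)%nat -> (Cmod (a n) <= M)%R).
  { clear HN; induction N as [| N [M [HM IH]]]; [exists 1%R; split; [lra | lia] |].
    exists (M + Cmod (a N))%R; assert (T := Cmod_ge_0 (a N)); split; [lra |]; intros n Hn.
    destruct (Nat.eq_dec n N) as [-> | D]; [lra |].
    specialize (IH n ltac:(lia)); lra. }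
  destruct F as [M [HM F]]; exists (M + 2)%R; split; [lra |]; intros n.
  destruct (le_lt_dec N n) as [L | L]; [| specialize (F n L); lra].
  assert (A := HN n L); assert (B := HN (S n) ltac:(lia)); simpl in B.
  replace (a n) with ((csumn a n + a n - l) + - (csumn a n - l)) by ring.
  eapply Rle_trans; [apply Cmod_triangle |]; rewrite Cmod_opp; lra.
Qed.

Lemma csum_to_limit_bound (a : nat -> C) (l b : C) (B : R) (m : nat) :
  csum_to a l -> (forall n, (m <= n)%nat -> (Cmod (csumn a n - b) <= B)%R) -> (Cmod (l - b) <= B)%R.
Proof.
  intros H HB; apply Rnot_lt_le; intros L.
  destruct (H (Cmod (l - b) - B)%R ltac:(lra)) as [N HN].
  specialize (HN (N + m)%nat ltac:(lia)); specialize (HB (N + m)%nat ltac:(lia)).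
  assert (T := Cmod_triangle (l - csumn a (N + m)) (csumn a (N + m) - b)).
  replace (l - csumn a (N + m) + (csumn a (N + m) - b)) with (l - b) in T by ring.
  rewrite (Cmod_minus_sym l (csumn _ _)) in T; lra.
Qed.

(** The terms are bounded at radius [rho], so for [Cmod w <= rho / 2] the tail is dominated by a
    geometric series of ratio at most 1/2, whose summation costs a factor 2. *)
Lemma power_series_tail (K : nat -> C) (H : C -> C) (r : R) : (0 < r)%R ->
  (forall w, (Cmod w < r)%R -> csum_to (fun k => (K k * w ^ k)%C) (H w)) ->
  exists rho M, (0 < rho < r)%R /\ (0 < M)%R /\ forall m w, (Cmod w <= rho / 2)%R ->
    (Cmod (H w - csumn (fun k => (K k * w ^ k)%C) m) <= M * (Cmod w / rho) ^ m)%R.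
Proof.
  intros Hr HH; set (rho := (r / 2)%R).
  assert (Hrho : (0 < rho < r)%R) by (unfold rho; lra).
  destruct (csum_to_bounded _ _ (HH (RtoC rho) ltac:(rewrite Cmod_R, Rabs_pos_eq; lra)))
    as [M [HM B]].
  exists rho, (2 * M)%R; split; [exact Hrho | split; [lra |]]; intros m w Hw.
  assert (Hw0 := Cmod_ge_0 w).
  apply (csum_to_limit_bound (fun k => (K k * w ^ k)%C) _ _ _ m); [apply HH; lra |].
  set (x := (Cmod w / rho)%R).
  assert (Hx : (0 <= x <= 1 / 2)%R).
  { unfold x; split; [apply Rmult_le_pos; [lra | left; apply Rinv_0_lt_compat; lra] |].
    apply (Rmult_le_reg_r rho); [lra |]; unfold Rdiv; rewrite Rmult_assoc, Rinv_l; lra. }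
  assert (T : forall k, (Cmod (K k * w ^ k) <= M * x ^ k)%R).
  { intros k; specialize (B k).
    rewrite Cmod_mult, Cmod_pow in *; rewrite Cmod_R, Rabs_pos_eq in B by lra.
    unfold x, Rdiv; rewrite Rpow_mult_distr, pow_inv.
    assert (P : (0 < rho ^ k)%R) by (apply pow_lt; lra).
    assert (Q : (0 <= Cmod w ^ k)%R) by (apply pow_le; lra).
    apply (Rmult_le_reg_r (rho ^ k)); [lra |].
    replace (M * (Cmod w ^ k * / rho ^ k) * rho ^ k)%R with (Cmod w ^ k * M)%R by (field; lra).
    replace (Cmod (K k) * Cmod w ^ k * rho ^ k)%R with (Cmod w ^ k * (Cmod (K k) * rho ^ k))%R
      by ring.
    apply Rmult_le_compat_l; lra. }
  intros n Hn.
  (* The subtracted term makes the induction close; it is dropped afterwards. *)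
  assert (G : (Cmod (csumn (fun k => (K k * w ^ k)%C) n - csumn (fun k => (K k * w ^ k)%C) m)
    <= 2 * M * x ^ m - 2 * M * x ^ n)%R).
  { induction Hn as [| n Hn IH]; [rewrite Cmod_self; lra |].
    simpl; replace (csumn (fun k => (K k * w ^ k)%C) n + K n * w ^ n - csumn (fun k => (K k * w ^ k)%C) m)
      with (csumn (fun k => (K k * w ^ k)%C) n - csumn (fun k => (K k * w ^ k)%C) m + K n * w ^ n) by ring.
    eapply Rle_trans; [apply Cmod_triangle |].
    specialize (T n); assert (P : (0 <= x ^ n)%R) by (apply pow_le; lra).
    assert (x * x ^ n <= 1 / 2 * x ^ n)%R by (apply Rmult_le_compat_r; lra).
    assert (M * (x * x ^ n) <= M * (1 / 2 * x ^ n))%R by (apply Rmult_le_compat_l; lra).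
    lra. }
  assert (P : (0 <= 2 * M * x ^ n)%R) by (apply Rmult_le_pos; [lra | apply pow_le; lra]).
  lra.
Qed.

Lemma csumn_0 (a : nat -> C) (n : nat) : (forall k, (k < n)%nat -> a k = 0) -> csumn a n = 0.
Proof.
  induction n as [| n IH]; intros H; simpl; [reflexivity |].
  rewrite IH, H by (intros; try apply H; lia); ring.
Qed.

(** All Taylor coefficients at [c] vanish, by induction: at a zero [u] the first remaining term
    [K m * (u - c) ^ m] is bounded by a tail of order [S m], which is impossible for [u] close to
    [c] unless [K m = 0]. The radius prescribed for [u] in the induction expresses this
    closeness. *)
Lemma disc_zero (h : C -> C) (c : C) (R0 : R) :
  (forall w, (Cmod (w - c) < R0)%R -> holo h w) ->
  (forall d, (0 < d)%R -> exists w, (0 < Cmod (w - c) < d)%R /\ h w = 0) ->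
  forall w, (Cmod (w - c) < R0)%R -> h w = 0.
Proof.
  intros Hh Hz w Hw.
  assert (Hw0 := Cmod_ge_0 (w - c)).
  set (r := ((Cmod (w - c) + R0) / 2)%R).
  destruct (holo_Taylor h c r R0) as [K HK]; [unfold r; lra | exact Hh |].
  destruct (power_series_tail K (fun u => h (c + u)) r) as [rho [M [Hrho [HM HT]]]];
    [unfold r; lra | |].
  { intros u Hu; assert (E := HK (c + u)); replace (c + u - c) with u in E by ring; auto. }
  assert (Z : forall m k, (k < m)%nat -> K k = 0).
  { induction m as [| m IH]; [lia |].
    intros k Hk; destruct (Nat.eq_dec k m) as [-> | D]; [| apply IH; lia]; clear Hk.
    apply NNPP; intros N; apply Cmod_gt_0 in N.
    assert (Pm : (0 < rho ^ S m)%R) by (apply pow_lt; lra).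
    destruct (Hz (Rmin (rho / 2) (Cmod (K m) * rho ^ S m / M))) as [u [[Hu1 Hu2] Hu3]].
    { apply Rmin_pos; [lra |]; apply Rdiv_lt_0_compat; [| lra]; apply Rmult_lt_0_compat; lra. }
    assert (L1 := Rlt_le_trans _ _ _ Hu2 (Rmin_l _ _)).
    assert (L2 := Rlt_le_trans _ _ _ Hu2 (Rmin_r _ _)).
    specialize (HT (S m) (u - c) ltac:(lra)).
    simpl csumn in HT; rewrite csumn_0 in HT by (intros k Hk; rewrite (IH k Hk); ring).
    replace (c + (u - c)) with u in HT by ring; rewrite Hu3 in HT.
    replace (0 - (0 + K m * (u - c) ^ m)) with (- (K m * (u - c) ^ m)) in HT by ring.
    rewrite Cmod_opp, Cmod_mult, Cmod_pow in HT.
    set (x := Cmod (u - c)) in *.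
    assert (Px : (0 < x ^ m)%R) by (apply pow_lt; lra).
    unfold Rdiv in HT; rewrite Rpow_mult_distr, pow_inv in HT; simpl (x ^ S m)%R in HT.
    assert (A : (Cmod (K m) <= M * (x * / rho ^ S m))%R).
    { apply (Rmult_le_reg_r (x ^ m)); [lra |].
      replace (M * (x * / rho ^ S m) * x ^ m)%R with (M * (x * x ^ m * / rho ^ S m))%R by ring.
      exact HT. }
    assert (B : (x * M < Cmod (K m) * rho ^ S m)%R).
    { apply (Rmult_lt_compat_r M) in L2; [| lra].
      replace (Cmod (K m) * rho ^ S m / M * M)%R with (Cmod (K m) * rho ^ S m)%R in L2
        by (field; lra).
      lra. }
    apply (Rmult_le_compat_r (rho ^ S m)) in A; [| lra].
    replace (M * (x * / rho ^ S m) * rho ^ S m)%R with (x * M)%R in A by (field; lra).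
    lra. }
  apply (csum_to_unique _ _ _ (HK w ltac:(unfold r; lra))).
  intros e He; exists 0%nat; intros n _.
  rewrite csumn_0, Cmod_self by (intros k _; rewrite (Z (S k) k ltac:(lia)); ring); exact He.
Qed.

Definition zeros_cluster (h : C -> C) (p : C) : Prop :=
  forall d, (0 < d)%R -> exists w, (0 < Cmod (w - p) < d)%R /\ h w = 0.

Lemma cnear_zeros_cluster (h : C -> C) (p : C) :
  cnear p (fun w => h w = 0) -> zeros_cluster h p.
Proof.
  intros [d [Hd H]] e He.
  assert (P : (0 < Rmin d e)%R) by (apply Rmin_pos; assumption).
  assert (E : Cmod (p + RtoC (Rmin d e / 2) - p) = (Rmin d e / 2)%R).
  { replace (p + RtoC (Rmin d e / 2) - p) with (RtoC (Rmin d e / 2)) by ring.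
    rewrite Cmod_R, Rabs_pos_eq; lra. }
  assert (A := Rmin_l d e); assert (B := Rmin_r d e).
  exists (p + RtoC (Rmin d e / 2)); rewrite E; split; [lra |]; apply H; rewrite E; lra.
Qed.

(** Connectedness of [[0, 1]]: around the supremum [T] of the parameters near which [h] vanishes
    there is a disc of holomorphy, in which vanishing spreads by [disc_zero]; so [T] is attained and
    equals 1. Segments are enough for all domains below: the slit plane is star-shaped, the
    half-plane convex, and any two points needed in [inW] are joined by two segments. *)
Lemma identity_segment (h : C -> C) (p q : C) :
  (forall t, (0 <= t <= 1)%R -> cnear (p + RtoC t * (q - p)) (holo h)) ->
  zeros_cluster h p -> cnear q (fun w => h w = 0).
Proof.
  intros Hh Hz.
  set (g := fun t : R => p + RtoC t * (q - p)) in *.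
  assert (Hg : forall s t, Cmod (g s - g t) = (Rabs (s - t) * Cmod (q - p))%R).
  { intros s t; rewrite <- Cmod_R, <- Cmod_mult; f_equal; unfold g; rewrite RtoC_minus; ring. }
  set (L := (Cmod (q - p) + 1)%R).
  assert (HL : (0 < L)%R) by (unfold L; assert (T := Cmod_ge_0 (q - p)); lra).
  assert (HgL : forall s t, (Cmod (g s - g t) <= Rabs (s - t) * L)%R).
  { intros s t; rewrite Hg; apply Rmult_le_compat_l; [apply Rabs_pos | unfold L; lra]. }
  set (Z := fun t => cnear (g t) (fun w => h w = 0)).
  set (S := fun t => (0 <= t <= 1)%R /\ Z t).
  assert (step : forall T, (0 <= T <= 1)%R -> exists d, (0 < d)%R /\
    forall t s, (Rabs (t - T) < d)%R -> (Rabs (s - T) < d)%R -> Z t -> Z s).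
  { intros T HT; destruct (Hh T HT) as [rho [Hrho H]].
    (* [L] bounds the speed of [g], so both points are within [rho / 4] of [g T]: the disc of radius
       [rho / 2] about [g t] contains [g s] and stays in the domain. *)
    exists (rho / (4 * L))%R; split; [apply Rdiv_lt_0_compat; lra |]; intros t s Ht Hs HZt.
    assert (E : (rho / (4 * L) * L = rho / 4)%R) by (field; lra).
    assert (Dt : (Cmod (g t - g T) < rho / 4)%R).
    { eapply Rle_lt_trans; [apply HgL |]; rewrite <- E; apply Rmult_lt_compat_r; lra. }
    assert (Ds : (Cmod (g s - g T) < rho / 4)%R).
    { eapply Rle_lt_trans; [apply HgL |]; rewrite <- E; apply Rmult_lt_compat_r; lra. }
    assert (D : forall w, (Cmod (w - g t) < rho / 2)%R -> h w = 0).
    { apply disc_zero; [| apply cnear_zeros_cluster, HZt].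
      intros w Hw; apply H; change (Cmod (w - g T) < rho)%R.
      replace (w - g T) with ((w - g t) + (g t - g T)) by ring.
      eapply Rle_lt_trans; [apply Cmod_triangle | lra]. }
    apply (cnear_impl _ (fun w => (Cmod (w - g t) < rho / 2)%R) _ D), cnear_ball.
    replace (g s - g t) with ((g s - g T) + (g T - g t)) by ring.
    eapply Rle_lt_trans; [apply Cmod_triangle |]; rewrite (Cmod_minus_sym (g T)); lra. }
  assert (S0 : S 0%R).
  { split; [lra |]; destruct (Hh 0%R ltac:(lra)) as [rho [Hrho H]].
    exists rho; split; [exact Hrho |]; apply disc_zero; [exact H |].
    unfold g; replace (p + RtoC 0 * (q - p)) with p by ring; exact Hz. }
  destruct (completeness S) as [T [HT1 HT2]];
    [exists 1%R; intros t [Ht _]; lra | exists 0%R; exact S0 |].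
  assert (HT : (0 <= T <= 1)%R).
  { split; [apply HT1, S0 | apply HT2; intros t [Ht _]; lra]. }
  destruct (step T HT) as [d [Hd Hstep]].
  assert (Near : exists t, S t /\ (T - d < t <= T)%R).
  { apply NNPP; intros N.
    assert (T <= T - d)%R; [| lra].
    apply HT2; intros t Ht; apply Rnot_lt_le; intros K; apply N; exists t.
    split; [exact Ht |]; split; [lra | apply HT1, Ht]. }
  destruct Near as [t [[Ht1 Ht2] Ht3]].
  assert (Ft : (Rabs (t - T) < d)%R) by (apply Rabs_def1; lra).
  destruct (Rle_lt_or_eq_dec T 1 ltac:(lra)) as [TL | TE].
  - set (s := Rmin 1 (T + d / 2)).
    assert (s <= T + d / 2)%R by apply Rmin_r; assert (s <= 1)%R by apply Rmin_l.
    assert (T < s)%R by (apply Rmin_glb_lt; lra).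
    assert (s <= T)%R; [| lra].
    apply HT1; split; [lra |]; apply (Hstep t s); [exact Ft | apply Rabs_def1; lra | exact Ht2].
  - assert (Z 1%R) as Z1 by (apply (Hstep t 1%R); [exact Ft | apply Rabs_def1; lra | exact Ht2]).
    unfold Z, g in Z1; replace (p + RtoC 1 * (q - p)) with q in Z1 by ring; exact Z1.
Qed.

Lemma polar_form (z : C) : exists t, z = cis (Cmod z) t.
Proof.
  destruct (Ceq_dec z 0) as [-> | N].
  - exists 0%R; rewrite Cmod_0; unfold cis; rewrite !Rmult_0_l; reflexivity.
  - apply Cmod_gt_0 in N; set (m := Cmod z) in *.
    set (a := (Re z / m)%R); set (b := (Im z / m)%R).
    assert (E : (a * a + b * b = 1)%R).
    { assert (Q := Cmod2_alt z); fold m in Q; unfold a, b.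
      replace (Re z / m * (Re z / m) + Im z / m * (Im z / m))%R
        with ((Re z ^ 2 + Im z ^ 2) / m ^ 2)%R by (field; lra).
      rewrite <- Q; field; lra. }
    assert (Ha : (-1 <= a <= 1)%R) by nra.
    assert (C1 := cos_acos a Ha); assert (S1 := sin_acos a Ha).
    assert (R1 : Re z = (m * a)%R) by (unfold a; field; lra).
    assert (R2 : Im z = (m * b)%R) by (unfold b; field; lra).
    assert (Sb : sqrt (1 - Rsqr a) = Rabs b).
    { rewrite <- sqrt_Rsqr_abs; f_equal; unfold Rsqr; lra. }
    destruct (Rle_dec 0 b) as [Hb | Hb].
    + exists (acos a); unfold cis; rewrite C1, S1, Sb, Rabs_pos_eq by exact Hb.
      apply injective_projections; simpl; assumption.
    + exists (- acos a)%R; unfold cis; rewrite cos_neg, sin_neg, C1, S1, Sb, Rabs_left by lra.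
      apply injective_projections; simpl; [exact R1 |]; rewrite Ropp_involutive; exact R2.
Qed.

(** If [K m] is the first nonzero coefficient of positive index, then along the direction in which
    [K m * w ^ m] is a positive multiple of [h c] the modulus grows by a multiple of [t ^ m], which
    the tail of order [t ^ S m] cannot compensate. *)
Lemma maximum_modulus (h : C -> C) (c : C) :
  cnear c (holo h) -> cnear c (fun w => (Cmod (h w) <= Cmod (h c))%R) ->
  cnear c (fun w => h w = h c).
Proof.
  intros Hh Hm.
  destruct (cnear_and _ _ _ Hh Hm) as [R0 [HR0 H]].
  destruct (holo_Taylor h c (R0 / 2) R0) as [K HK]; [lra | intros; apply H; assumption |].
  destruct (power_series_tail K (fun u => h (c + u)) (R0 / 2)) as [rho [M [Hrho [HM HT]]]]; [lra | |].
  { intros u Hu; assert (E := HK (c + u)); replace (c + u - c) with u in E by ring; auto. }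
  assert (K0 : K 0%nat = h c).
  { assert (A := HT 1%nat 0); rewrite Cmod_0 in A; specialize (A ltac:(lra)); simpl in A.
    replace (c + 0) with c in A by ring.
    apply Cmod_small_eq; intros e He; rewrite Cmod_minus_sym.
    replace (h c - K 0%nat) with (h c - (0 + K 0%nat * 1)) by ring.
    unfold Rdiv in A; rewrite !Rmult_0_l, Rmult_0_r in A; lra. }
  destruct (Ceq_dec (h c) 0) as [E0 | N0].
  { exists R0; split; [lra |]; intros w Hw; destruct (H w Hw) as [_ B].
    rewrite E0 in *; rewrite Cmod_0 in B; apply Cmod_eq_0.
    assert (T := Cmod_ge_0 (h w)); lra. }
  assert (Z : forall m k, (0 < k < m)%nat -> K k = 0).
  { induction m as [| m IH]; [lia |].
    intros k Hk; destruct (Nat.eq_dec k m) as [-> | D]; [| apply IH; lia].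
    apply NNPP; intros N.
    assert (PK := proj1 (Cmod_gt_0 _) N); assert (P0 := proj1 (Cmod_gt_0 _) N0).
    destruct (polar_form (h c / K m)) as [th Hth].
    set (r := Cmod (h c / K m)) in *.
    assert (Hr : (0 < r)%R) by (unfold r; rewrite Cmod_div by exact N; apply Rdiv_lt_0_compat; lra).
    (* An m-th root of the unit factor of [h c / K m], so that [K m * om ^ m] is [h c / r]. *)
    set (om := cis 1 (th / INR m)).
    assert (Hm0 : (0 < INR m)%R) by (apply lt_0_INR; lia).
    assert (Eom : K m * om ^ m = h c * RtoC (/ r)).
    { unfold om; rewrite cis_pow; replace (INR m * (th / INR m))%R with th by (field; lra).
      assert (Nr : RtoC r <> 0) by (intros E; apply RtoC_inj in E; lra).
      rewrite RtoC_inv by lra.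
      replace (h c * / RtoC r) with (K m * ((h c / K m) / RtoC r)) by (field; auto).
      rewrite Hth, (cis_scale r th); field; exact Nr. }
    assert (Pm : (0 < rho ^ S m)%R) by (apply pow_lt; lra).
    (* For this [t] the tail is at most half of the gain [Cmod (h c) * t ^ m / r]. *)
    set (t := Rmin (rho / 2) (Cmod (h c) * rho ^ S m / (2 * M * r))).
    assert (Ht : (0 < t)%R).
    { apply Rmin_pos; [lra |]; apply Rdiv_lt_0_compat; apply Rmult_lt_0_compat; lra. }
    assert (Ht1 : (t <= rho / 2)%R) by apply Rmin_l.
    assert (Ht2 : (t * (2 * M * r) <= Cmod (h c) * rho ^ S m)%R).
    { assert (A : (t <= Cmod (h c) * rho ^ S m / (2 * M * r))%R) by apply Rmin_r.
      assert (Q : (0 < 2 * M * r)%R) by (repeat apply Rmult_lt_0_compat; lra).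
      apply (Rmult_le_compat_r (2 * M * r)) in A; [| lra].
      replace (Cmod (h c) * rho ^ S m / (2 * M * r) * (2 * M * r))%R
        with (Cmod (h c) * rho ^ S m)%R in A by (field; lra).
      exact A. }
    set (w := RtoC t * om).
    assert (Ew : Cmod w = t).
    { unfold w, om; rewrite Cmod_mult, Cmod_R, Cmod_cis, Rabs_pos_eq by lra; ring. }
    assert (A := HT (S m) w ltac:(lra)); rewrite Ew in A.
    assert (F : csumn (fun k => (K k * w ^ k)%C) (S m) = h c * RtoC (1 + t ^ m / r)).
    { assert (Q : forall j, (0 < j)%nat -> (j <= m)%nat ->
        csumn (fun k => (K k * w ^ k)%C) j = h c).
      { intros j Hj; induction Hj as [| j Hj IHj]; intros Hjm; simpl.
        - rewrite K0; ring.
        - rewrite IHj, (IH j) by lia; ring. }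
      simpl; rewrite (Q m) by lia.
      unfold w; rewrite Cpow_mult_l, <- RtoC_pow.
      replace (K m * (RtoC (t ^ m) * om ^ m)) with (RtoC (t ^ m) * (K m * om ^ m)) by ring.
      rewrite Eom, RtoC_plus; unfold Rdiv; rewrite RtoC_mult; ring. }
    rewrite F in A.
    destruct (H (c + w)) as [_ B].
    { replace (c + w - c) with w by ring; lra. }
    assert (T := Cmod_rev_triangle (h c * RtoC (1 + t ^ m / r)) (h (c + w))).
    rewrite Cmod_minus_sym in T.
    assert (Ptm : (0 < t ^ m)%R) by (apply pow_lt; lra).
    assert (Pq : (0 < t ^ m / r)%R) by (apply Rdiv_lt_0_compat; lra).
    rewrite Cmod_mult, Cmod_R, Rabs_pos_eq in T by lra.
    assert (G : (Cmod (h c) * (t ^ m / r) <= M * (t / rho) ^ S m)%R) by lra.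
    unfold Rdiv in G; rewrite Rpow_mult_distr, pow_inv in G; simpl (t ^ S m)%R in G.
    assert (G' : (Cmod (h c) * rho ^ S m <= M * t * r)%R).
    { apply (Rmult_le_reg_r (t ^ m)); [lra |].
      apply (Rmult_le_compat_r (rho ^ S m * r)) in G; [| apply Rmult_le_pos; lra].
      replace (Cmod (h c) * (t ^ m * / r) * (rho ^ S m * r))%R
        with (Cmod (h c) * rho ^ S m * t ^ m)%R in G by (field; lra).
      replace (M * (t * t ^ m * / rho ^ S m) * (rho ^ S m * r))%R with (M * t * r * t ^ m)%R in G
        by (field; lra).
      exact G. }
    assert (0 < M * t * r)%R by (repeat apply Rmult_lt_0_compat; lra). lra. }
  exists (R0 / 2)%R; split; [lra |]; intros w Hw.
  apply (csum_to_unique _ _ _ (HK w Hw)); intros e He; exists 1%nat; intros n Hn.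
  assert (E : csumn (fun k => K k * (w - c) ^ k) n = h c).
  { induction Hn as [| n Hn IH]; simpl; [rewrite K0; ring |].
    rewrite IH, (Z (S n) n) by lia; ring. }
  rewrite E, Cmod_self; exact He.
Qed.

(** Bisection keeps a quarter whose points of [D] dominate [g] on all of [D]. If every quarter
    failed at some point, the best of these four points would be dominated inside the whole
    rectangle, hence inside one quarter. The limit point is in [D] by closedness and maximal by
    continuity. *)
Lemma compact_max (D : C -> Prop) (g : C -> R) (a b c d : R) :
  (forall p, D p -> (a <= Re p <= b)%R /\ (c <= Im p <= d)%R) ->
  (exists p, D p) ->
  (forall p, (forall e, (0 < e)%R -> exists q, D q /\ (Cmod (q - p) < e)%R) -> D p) ->
  (forall p, D p -> forall e, (0 < e)%R -> cnear p (fun q => (Rabs (g q - g p) < e)%R)) ->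
  exists p, D p /\ forall q, D q -> (g q <= g p)%R.
Proof.
  intros Hb [p0 Hp0] Hcl Hg.
  destruct (Hb p0 Hp0) as [B1 B2].
  destruct (rectangle_bisection (fun x1 x2 y1 y2 n => forall q, D q ->
    exists p, D p /\ (x1 <= Re p <= x2)%R /\ (y1 <= Im p <= y2)%R /\ (g q <= g p)%R) a b c d)
    as [x [y [Hx [Hy Hlim]]]]; try lra.
  - intros q Hq; exists q; destruct (Hb q Hq); repeat split; try assumption; lra.
  - intros n x1 x2 y1 y2 Hx1 Hx2 Hy1 Hy2 H mx my.
    apply NNPP; intros N.
    apply not_or_and in N; destruct N as [N1 N].
    apply not_or_and in N; destruct N as [N2 N].
    apply not_or_and in N; destruct N as [N3 N4].
    apply not_all_ex_not in N1, N2, N3, N4.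
    destruct N1 as [q1 N1], N2 as [q2 N2], N3 as [q3 N3], N4 as [q4 N4].
    apply imply_to_and in N1, N2, N3, N4.
    destruct N1 as [D1 N1], N2 as [D2 N2], N3 as [D3 N3], N4 as [D4 N4].
    assert (exists q, D q /\ (g q1 <= g q)%R /\ (g q2 <= g q)%R /\ (g q3 <= g q)%R /\
      (g q4 <= g q)%R) as [q [Dq [G1 [G2 [G3 G4]]]]].
    { assert (two : forall u v, D u -> D v -> exists q, D q /\ (g u <= g q)%R /\ (g v <= g q)%R).
      { intros u v Du Dv; destruct (Rle_dec (g u) (g v)); [exists v | exists u];
          repeat split; try assumption; lra. }
      destruct (two q1 q2 D1 D2) as [u [Du [? ?]]], (two q3 q4 D3 D4) as [v [Dv [? ?]]].
      destruct (two u v Du Dv) as [q [Dq [? ?]]]; exists q; repeat split; try assumption; lra. }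
    destruct (H q Dq) as [p [Dp [P1 [P2 P3]]]].
    destruct (Rle_dec (Re p) mx), (Rle_dec (Im p) my);
      [apply N1 | apply N3 | apply N2 | apply N4];
      exists p; repeat split; try assumption; lra.
  - set (z := (x, y)).
    assert (near : forall e, (0 < e)%R -> forall q, D q ->
      exists p, D p /\ (Cmod (p - z) < e)%R /\ (g q <= g p)%R).
    { intros e He q Hq.
      destruct (Pow_x_infinity 2 ltac:(rewrite Rabs_pos_eq; lra)
        (((b - a) + (d - c) + 1) / e)%R) as [n Hn].
      specialize (Hn n (le_n n)).
      assert (P2 : (0 < 2 ^ n)%R) by (apply pow_lt; lra).
      rewrite Rabs_pos_eq in Hn by lra.
      destruct (Hlim n) as [x1 [x2 [y1 [y2 [H [Q1 [Q2 [Q3 [Q4 [Q5 Q6]]]]]]]]]].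
      destruct (H q Hq) as [p [Dp [P3 [P4 P5]]]]; exists p; split; [exact Dp | split; [| exact P5]].
      eapply Rle_lt_trans; [apply Cmod_le_Re_Im |].
      assert (A1 : (Rabs (Re (p - z)) <= x2 - x1)%R)
        by (apply Rabs_le; unfold Re in *; simpl; lra).
      assert (A2 : (Rabs (Im (p - z)) <= y2 - y1)%R)
        by (apply Rabs_le; unfold Im in *; simpl; lra).
      apply (Rle_lt_trans _ ((b - a + (d - c)) / 2 ^ n)%R).
      - unfold Rdiv in *; lra.
      - apply (Rmult_lt_reg_r (2 ^ n)); [lra |].
        replace ((b - a + (d - c)) / 2 ^ n * 2 ^ n)%R with (b - a + (d - c))%R by (field; lra).
        apply Rge_le in Hn; apply (Rmult_le_compat_r e) in Hn; [| lra].
        replace ((b - a + (d - c) + 1) / e * e)%R with (b - a + (d - c) + 1)%R in Hn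
          by (field; lra).
        lra. }
    assert (Dz : D z).
    { apply Hcl; intros e He; destruct (near e He p0 Hp0) as [p [? [? _]]]; exists p; auto. }
    exists z; split; [exact Dz |]; intros q Hq; apply Rnot_lt_le; intros L.
    destruct (Hg z Dz (g q - g z)%R ltac:(lra)) as [e [He K]].
    destruct (near e He q Hq) as [p [Dp [Hp1 Hp2]]].
    specialize (K p Hp1); apply Rabs_def2 in K; lra.
Qed.

(** * Series of holomorphic functions *)

Lemma sum_n_csumn (a : nat -> C) (n : nat) :
  sum_n (G := AbelianGroup.AbelianMonoid C_AbelianGroup) a n = csumn a (S n).
Proof.
  induction n as [| n IH]; [rewrite sum_O; simpl; ring |].
  rewrite sum_Sn, IH; reflexivity.
Qed.

Lemma is_series_csum_to (a : nat -> C) (l : C) :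
  is_series (K := C_AbsRing) (V := C_NormedModule) a l <-> csum_to a l.
Proof.
  split.
  - intros H e He.
    destruct (H (fun w => (Cmod (w - l) < e)%R)) as [N HN].
    { apply (proj2 (locally_cnear l _)); exists e; split; auto. }
    exists (S N); intros n Hn; destruct n as [| n]; [lia |].
    rewrite <- sum_n_csumn; apply HN; lia.
  - intros H P HP; apply (proj1 (locally_cnear l P)) in HP; destruct HP as [d [Hd HP]].
    destruct (H d Hd) as [N HN]; exists N; intros n Hn; apply HP.
    assert (E := HN (S n) ltac:(lia)); rewrite <- sum_n_csumn in E; exact E.
Qed.

Lemma is_series_eps (a : nat -> R) (l : R) : is_series a l ->
  forall e, (0 < e)%R -> exists N, forall n, (N <= n)%nat -> (Rabs (sum_n a n - l) < e)%R.
Proof.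
  intros H e He.
  exact (proj1 (filterlim_locally (sum_n a) l) H (mkposreal e He)).
Qed.

Definition Cser (a : nat -> C) : C :=
  (Series (fun n => Re (a n)), Series (fun n => Im (a n))).

Lemma Cser_correct (a : nat -> C) : ex_series (fun n => Cmod (a n)) -> csum_to a (Cser a).
Proof.
  intros H e He.
  assert (S1 : ex_series (fun n => Re (a n))).
  { apply (ex_series_le (V := R_CompleteNormedModule) _ _ (fun n => re_le_Cmod (a n)) H). }
  assert (S2 : ex_series (fun n => Im (a n))).
  { apply (ex_series_le (V := R_CompleteNormedModule) _ _ (fun n => im_le_Cmod (a n)) H). }
  destruct (is_series_eps _ _ (Series_correct _ S1) (e / 2)%R ltac:(lra)) as [N HN].
  destruct (is_series_eps _ _ (Series_correct _ S2) (e / 2)%R ltac:(lra)) as [N' HN'].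
  exists (S (N + N')); intros n Hn; destruct n as [| n]; [lia |].
  specialize (HN n ltac:(lia)); specialize (HN' n ltac:(lia)).
  assert (E1 : sum_n (fun n => Re (a n)) n = Re (csumn a (S n))).
  { clear; induction n as [| n IH]; [rewrite sum_O; unfold Re; simpl; ring |].
    rewrite sum_Sn, IH; reflexivity. }
  assert (E2 : sum_n (fun n => Im (a n)) n = Im (csumn a (S n))).
  { clear; induction n as [| n IH]; [rewrite sum_O; unfold Im; simpl; ring |].
    rewrite sum_Sn, IH; reflexivity. }
  rewrite E1 in HN; rewrite E2 in HN'.
  eapply Rle_lt_trans; [apply Cmod_le_Re_Im |].
  unfold Cser; simpl in *; unfold Rminus in *; lra.
Qed.

Lemma csum_to_le (a : nat -> C) (l : C) (b : nat -> R) :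
  csum_to a l -> (forall n, (Cmod (a n) <= b n)%R) -> ex_series b -> (Cmod l <= Series b)%R.
Proof.
  intros Ha Hab Hb.
  replace l with (l - 0) by ring.
  apply (csum_to_limit_bound a l 0 _ 1 Ha); intros n Hn.
  assert (Pb : forall k, (0 <= b k)%R) by (intros k; eapply Rle_trans; [apply Cmod_ge_0 | apply Hab]).
  destruct n as [| n]; [lia |].
  apply (Rle_trans _ (sum_n b n)).
  - clear Hn; replace (csumn a (S n) - 0) with (csumn a (S n)) by ring.
    induction n as [| n IH].
    + rewrite sum_O; simpl; replace (0 + a 0%nat) with (a 0%nat) by ring; apply Hab.
    + rewrite sum_Sn; change (csumn a (S (S n))) with (csumn a (S n) + a (S n)).
      eapply Rle_trans; [apply Cmod_triangle |]; apply Rplus_le_compat; auto.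
  - apply (is_lim_seq_incr_compare (sum_n b)); [apply (Series_correct _ Hb) |].
    intros m; rewrite sum_Sn; unfold plus; simpl; specialize (Pb (S m)); lra.
Qed.

(* Weierstrass-type criterion, phrased with a uniform second-order Taylor bound. *)
Lemma cderiv_series (f df : nat -> C -> C) (F : C -> C) (z L : C) (d : R) (b : nat -> R) :
  (0 < d)%R -> ex_series b ->
  (forall n w, (Cmod (w - z) < d)%R ->
     (Cmod (f n w - f n z - df n z * (w - z)) <= b n * Cmod (w - z) ^ 2)%R) ->
  (forall w, (Cmod (w - z) < d)%R -> csum_to (fun n => f n w) (F w)) ->
  csum_to (fun n => df n z) L -> cderiv F z L.
Proof.
  intros Hd Hb Hf HF HL e He.
  set (S := (Rabs (Series b) + 1)%R).
  assert (HS : (0 < S)%R) by (unfold S; assert (T := Rabs_pos (Series b)); lra).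
  exists (Rmin d (e / S)); split; [apply Rmin_pos; [exact Hd | apply Rdiv_lt_0_compat; lra] |].
  intros w Hw.
  assert (W1 := Rlt_le_trans _ _ _ Hw (Rmin_l _ _)).
  assert (W2 := Rlt_le_trans _ _ _ Hw (Rmin_r _ _)).
  assert (A : (Cmod (F w - F z - L * (w - z)) <= Series (fun n => b n * Cmod (w - z) ^ 2))%R).
  { apply (csum_to_le (fun n => f n w + ((-(1)) * f n z + (- (w - z)) * df n z))).
    - replace (F w - F z - L * (w - z)) with (F w + ((-(1)) * F z + (- (w - z)) * L)) by ring.
      apply csum_to_plus; [apply HF, W1 |]; apply csum_to_plus; apply csum_to_scal.
      + apply HF; rewrite Cmod_self; exact Hd.
      + exact HL.
    - intros n; replace (f n w + ((-(1)) * f n z + (- (w - z)) * df n z))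
        with (f n w - f n z - df n z * (w - z)) by ring; apply Hf, W1.
    - apply (ex_series_ext (fun n => Cmod (w - z) ^ 2 * b n)%R); [intros; apply Rmult_comm |].
      apply (ex_series_scal (K := R_AbsRing) (V := R_NormedModule)), Hb. }
  eapply Rle_trans; [exact A |].
  rewrite Series_scal_r; set (x := Cmod (w - z)) in *.
  assert (Hx : (0 <= x)%R) by apply Cmod_ge_0.
  apply (Rmult_lt_compat_r S) in W2; [| exact HS].
  replace (e / S * S)%R with e in W2 by (field; lra).
  assert (Q : (Series b <= S)%R) by (unfold S; assert (T := Rle_abs (Series b)); lra).
  nra.
Qed.

(** The remainder for [S m] is [w] times the one for [m] plus [m z^(m-1) (w - z)^2]. The factor
    [rho ^ 2] on the left avoids an exponent [m - 2]. *)
Lemma pow_second_order (rho : R) (z w : C) (m : nat) :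
  (0 < rho)%R -> (Cmod z <= rho)%R -> (Cmod w <= rho)%R ->
  (rho ^ 2 * Cmod (w ^ m - z ^ m - RtoC (INR m) * z ^ pred m * (w - z))
   <= INR m ^ 2 * rho ^ m * Cmod (w - z) ^ 2)%R.
Proof.
  intros Hr Hz Hw; induction m as [| m IH].
  - simpl; replace (1 - 1 - 0 * 1 * (w - z)) with (RtoC 0) by ring; rewrite Cmod_0.
    right; ring.
  - set (x := Cmod (w - z)) in *.
    assert (Hx : (0 <= x)%R) by apply Cmod_ge_0.
    assert (Hm : (0 <= INR m)%R) by apply pos_INR.
    assert (Pm : (0 < rho ^ m)%R) by (apply pow_lt; exact Hr).
    set (D := w ^ m - z ^ m - RtoC (INR m) * z ^ pred m * (w - z)) in *.
    assert (E : w ^ S m - z ^ S m - RtoC (INR (S m)) * z ^ pred (S m) * (w - z) =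
      w * D + RtoC (INR m) * z ^ pred m * ((w - z) * (w - z))).
    { unfold D; rewrite S_INR, RtoC_plus; simpl pred; destruct m as [| m]; simpl; ring. }
    rewrite E; clear E.
    assert (T1 : (Cmod (w * D) <= rho * Cmod D)%R).
    { rewrite Cmod_mult; apply Rmult_le_compat_r; [apply Cmod_ge_0 | exact Hw]. }
    assert (T2 : (rho * Cmod (RtoC (INR m) * z ^ pred m) <= INR m * rho ^ m)%R).
    { destruct m as [| m]; [simpl; rewrite Cmult_0_l, Cmod_0; lra |].
      rewrite Cmod_mult, Cmod_R, Rabs_pos_eq, Cmod_pow by exact Hm; simpl pred.
      assert (Cmod z ^ m <= rho ^ m)%R by (apply pow_incr; split; [apply Cmod_ge_0 | exact Hz]).
      simpl (rho ^ S m)%R.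
      replace (rho * (INR (S m) * Cmod z ^ m))%R with (INR (S m) * rho * Cmod z ^ m)%R by ring.
      replace (INR (S m) * (rho * rho ^ m))%R with (INR (S m) * rho * rho ^ m)%R by ring.
      apply Rmult_le_compat_l; [apply Rmult_le_pos; lra | assumption]. }
    assert (T3 : (Cmod (RtoC (INR m) * z ^ pred m * ((w - z) * (w - z))) =
      Cmod (RtoC (INR m) * z ^ pred m) * x ^ 2)%R).
    { rewrite !Cmod_mult; fold x; ring. }
    apply (Rle_trans _ (rho ^ 2 * (rho * Cmod D + Cmod (RtoC (INR m) * z ^ pred m) * x ^ 2))%R).
    { apply Rmult_le_compat_l; [nra |].
      eapply Rle_trans; [apply Cmod_triangle |]; rewrite T3; lra. }
    rewrite S_INR; simpl (rho ^ S m)%R.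
    set (u := Cmod (RtoC (INR m) * z ^ pred m)) in *.
    assert (Z1 : (rho * (rho ^ 2 * Cmod D) <= rho * (INR m ^ 2 * rho ^ m * x ^ 2))%R)
      by (apply Rmult_le_compat_l; lra).
    assert (Z2 : (rho * x ^ 2 * (rho * u) <= rho * x ^ 2 * (INR m * rho ^ m))%R).
    { apply Rmult_le_compat_l; [| exact T2]. apply Rmult_le_pos; [lra | nra]. }
    assert (Z3 : (0 <= rho * x ^ 2 * ((INR m + 1) * rho ^ m))%R).
    { repeat apply Rmult_le_pos; try lra; nra. }
    nra.
Qed.

Lemma pow_anti (x : R) (n m : nat) : (0 <= x <= 1)%R -> (n <= m)%nat -> (x ^ m <= x ^ n)%R.
Proof.
  intros Hx H; induction H as [| m H IH]; [lra |]; simpl.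
  assert (0 <= x ^ m)%R by (apply pow_le; lra); nra.
Qed.

(** With [y = sqrt x] it suffices to bound [n y^n]; Bernoulli's inequality for [/ y = 1 + k] gives
    the bound [/ k]. *)
Lemma square_pow_bound (x : R) : (0 < x < 1)%R ->
  exists B, (0 < B)%R /\ forall n, (INR n ^ 2 * x ^ n <= B)%R.
Proof.
  intros Hx.
  set (y := sqrt x).
  assert (Hy0 : (0 < y)%R) by (apply sqrt_lt_R0; lra).
  assert (Hyy : (y * y = x)%R) by (apply sqrt_sqrt; lra).
  assert (Hy1 : (y < 1)%R) by nra.
  set (k := (/ y - 1)%R).
  assert (Hk : (0 < k)%R).
  { unfold k; assert (1 < / y)%R; [| lra].
    apply (Rmult_lt_reg_r y); [lra |]; rewrite Rinv_l; lra. }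
  assert (G : forall n, (INR n * y ^ n <= / k)%R).
  { intros n.
    assert (Bern : (1 + INR n * k <= (1 + k) ^ n)%R).
    { apply poly; exact Hk. }
    replace (1 + k)%R with (/ y)%R in Bern by (unfold k; ring).
    rewrite pow_inv in Bern.
    assert (P : (0 < y ^ n)%R) by (apply pow_lt; lra).
    apply (Rmult_le_compat_r (y ^ n)) in Bern; [| lra].
    rewrite Rinv_l in Bern by lra.
    apply (Rmult_le_reg_r k); [exact Hk |]; rewrite Rinv_l by lra; nra. }
  exists (/ k * / k)%R; split; [assert (0 < / k)%R by (apply Rinv_0_lt_compat; lra); nra |].
  intros n; rewrite <- Hyy, Rpow_mult_distr.
  replace (INR n ^ 2 * (y ^ n * y ^ n))%R with ((INR n * y ^ n) * (INR n * y ^ n))%R by ring.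
  assert (P : (0 <= INR n * y ^ n)%R)
    by (apply Rmult_le_pos; [apply pos_INR | apply pow_le; lra]).
  apply Rmult_le_compat; auto.
Qed.

(** Free exponents let one definition serve the hypergeometric series ([e n = n]) and the theta
    series (quadratic [e]). *)
Definition gps (c : nat -> R) (e : nat -> nat) (z : C) : C := Cser (fun n => RtoC (c n) * z ^ e n).

(** These conditions make the geometric series a majorant on the unit disc. *)
Definition gps_ok (c : nat -> R) (e : nat -> nat) : Prop :=
  (forall n, (Rabs (c n) <= 1)%R) /\ (forall n, (n <= e n)%nat).

Lemma gps_term_bound (c : nat -> R) (e : nat -> nat) (z : C) (n : nat) : gps_ok c e ->
  (Cmod z <= 1)%R -> (Cmod (RtoC (c n) * z ^ e n) <= Cmod z ^ n)%R.
Proof.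
  intros [Hc He] Hz; rewrite Cmod_mult, Cmod_R, Cmod_pow.
  assert (H := pow_anti (Cmod z) n (e n) (conj (Cmod_ge_0 z) Hz) (He n)).
  assert (P := pow_le (Cmod z) (e n) (Cmod_ge_0 z)).
  specialize (Hc n); assert (Q := Rabs_pos (c n)); nra.
Qed.

Lemma ex_series_pow (x : R) : (0 <= x < 1)%R -> ex_series (fun n => (x ^ n)%R).
Proof. intros Hx; apply ex_series_geom; rewrite Rabs_pos_eq; lra. Qed.

Lemma gps_correct (c : nat -> R) (e : nat -> nat) (z : C) : gps_ok c e -> (Cmod z < 1)%R ->
  csum_to (fun n => RtoC (c n) * z ^ e n) (gps c e z).
Proof.
  intros H Hz; apply Cser_correct.
  apply (ex_series_le (V := R_CompleteNormedModule) _ (fun n => (Cmod z ^ n)%R)).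
  - intros n; unfold norm; simpl; unfold abs; simpl; rewrite Rabs_pos_eq by apply Cmod_ge_0.
    apply gps_term_bound; [exact H | lra].
  - apply ex_series_pow; split; [apply Cmod_ge_0 | exact Hz].
Qed.

(** Two radii [rho < sg] are inserted between [Cmod z] and 1. The factor [e n ^ 2] of the
    second-order bound is absorbed by [(rho / sg) ^ e n], which leaves the summable majorant
    [sg ^ n]. *)
Lemma holo_gps (c : nat -> R) (e : nat -> nat) (z : C) : gps_ok c e -> (Cmod z < 1)%R ->
  holo (gps c e) z.
Proof.
  intros Hok Hz; assert (Hz0 := Cmod_ge_0 z).
  set (rho := ((1 + Cmod z) / 2)%R); set (sg := ((1 + rho) / 2)%R).
  assert (Hr : (0 < rho < 1)%R) by (unfold rho; lra).
  assert (Hs : (rho < sg < 1)%R) by (unfold sg; lra).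
  destruct (square_pow_bound (rho / sg)%R) as [B [HB HBn]].
  { split; [apply Rdiv_lt_0_compat; lra |].
    apply (Rmult_lt_reg_r sg); [lra |]; unfold Rdiv; rewrite Rmult_assoc, Rinv_l; lra. }
  assert (HB' : forall m, (INR m ^ 2 * rho ^ m <= B * sg ^ m)%R).
  { intros m; specialize (HBn m); unfold Rdiv in HBn; rewrite Rpow_mult_distr, pow_inv in HBn.
    assert (P : (0 < sg ^ m)%R) by (apply pow_lt; lra).
    apply (Rmult_le_compat_r (sg ^ m)) in HBn; [| lra].
    replace (INR m ^ 2 * (rho ^ m * / sg ^ m) * sg ^ m)%R with (INR m ^ 2 * rho ^ m)%R in HBn
      by (field; lra).
    exact HBn. }
  assert (Hse : forall n, (sg ^ e n <= sg ^ n)%R)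
    by (intros n; apply pow_anti; [lra | apply Hok]).
  assert (Sg : ex_series (fun n => (sg ^ n)%R)) by (apply ex_series_pow; lra).
  set (df := fun n (w : C) => RtoC (c n) * (RtoC (INR (e n)) * w ^ pred (e n))).
  assert (Hdf : csum_to (fun n => df n z) (Cser (fun n => df n z))).
  { apply Cser_correct.
    apply (ex_series_le (V := R_CompleteNormedModule) _ (fun n => B / rho * sg ^ n)%R).
    - intros n; unfold norm; simpl; unfold abs; simpl; rewrite Rabs_pos_eq by apply Cmod_ge_0.
      unfold df; rewrite !Cmod_mult, !Cmod_R, Cmod_pow, (Rabs_pos_eq (INR _)) by apply pos_INR.
      destruct Hok as [Hc _]; specialize (Hc n); assert (Q := Rabs_pos (c n)).
      assert (A : (INR (e n) * Cmod z ^ pred (e n) <= B / rho * sg ^ n)%R).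
      { apply (Rmult_le_reg_r rho); [lra |].
        replace (B / rho * sg ^ n * rho)%R with (B * sg ^ n)%R by (field; lra).
        apply (Rle_trans _ (INR (e n) ^ 2 * rho ^ e n)%R).
        - destruct (e n) as [| m]; [simpl; lra |]; simpl pred.
          assert (Cmod z ^ m <= rho ^ m)%R by (apply pow_incr; split; [lra | unfold rho; lra]).
          assert (0 < rho ^ m)%R by (apply pow_lt; lra).
          assert (0 <= Cmod z ^ m)%R by (apply pow_le; lra).
          assert (1 <= INR (S m))%R by (rewrite S_INR; assert (X := pos_INR m); lra).
          simpl (rho ^ S m)%R.
          set (N := INR (S m)) in *.
          apply (Rle_trans _ (N * rho ^ m * rho)%R).
          + apply Rmult_le_compat_r; [lra |]; apply Rmult_le_compat_l; lra.
          + replace (N ^ 2 * (rho * rho ^ m))%R with (N * (N * rho ^ m * rho))%R by ring.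
            assert (0 <= N * rho ^ m * rho)%R by (repeat apply Rmult_le_pos; lra). nra.
        - eapply Rle_trans; [apply HB' |]; apply Rmult_le_compat_l; [lra | apply Hse]. }
      assert (0 <= INR (e n) * Cmod z ^ pred (e n))%R
        by (apply Rmult_le_pos; [apply pos_INR | apply pow_le; lra]).
      nra.
    - apply (ex_series_scal (K := R_AbsRing) (V := R_NormedModule)), Sg. }
  exists (Cser (fun n => df n z)).
  apply (cderiv_series (fun n w => RtoC (c n) * w ^ e n) df (gps c e) z _
    (rho - Cmod z) (fun n => (B / rho ^ 2 * sg ^ n)%R)).
  - unfold rho; lra.
  - apply (ex_series_scal (K := R_AbsRing) (V := R_NormedModule)), Sg.
  - intros n w Hw.
    assert (Hw' : (Cmod w <= rho)%R).
    { replace w with ((w - z) + z) by ring; eapply Rle_trans; [apply Cmod_triangle | lra]. }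
    unfold df.
    replace (RtoC (c n) * w ^ e n - RtoC (c n) * z ^ e n
      - RtoC (c n) * (RtoC (INR (e n)) * z ^ pred (e n)) * (w - z))
      with (RtoC (c n) * (w ^ e n - z ^ e n - RtoC (INR (e n)) * z ^ pred (e n) * (w - z))) by ring.
    rewrite Cmod_mult, Cmod_R.
    assert (A := pow_second_order rho z w (e n) ltac:(lra) ltac:(unfold rho; lra) Hw').
    set (X := Cmod (w ^ e n - z ^ e n - RtoC (INR (e n)) * z ^ pred (e n) * (w - z))) in *.
    assert (HX : (0 <= X)%R) by apply Cmod_ge_0.
    destruct Hok as [Hc _]; specialize (Hc n).
    apply (Rle_trans _ X); [nra |].
    apply (Rmult_le_reg_l (rho ^ 2)); [nra |].
    eapply Rle_trans; [exact A |].
    replace (rho ^ 2 * (B / rho ^ 2 * sg ^ n * Cmod (w - z) ^ 2))%R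
      with (B * sg ^ n * Cmod (w - z) ^ 2)%R by (field; lra).
    apply Rmult_le_compat_r; [assert (T := Cmod_ge_0 (w - z)); nra |].
    eapply Rle_trans; [apply HB' |]; apply Rmult_le_compat_l; [lra | apply Hse].
  - intros w Hw; apply gps_correct; [exact Hok |].
    replace w with ((w - z) + z) by ring; eapply Rle_lt_trans; [apply Cmod_triangle |].
    unfold rho in *; lra.
  - exact Hdf.
Qed.

Lemma gps_real (c : nat -> R) (e : nat -> nat) (x : R) :
  gps c e (RtoC x) = RtoC (Series (fun n => (c n * x ^ e n)%R)).
Proof.
  unfold gps, Cser.
  assert (E : forall n, RtoC (c n) * RtoC x ^ e n = RtoC (c n * x ^ e n)%R)
    by (intros n; rewrite RtoC_mult, RtoC_pow; reflexivity).
  apply injective_projections.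
  - apply (Series_ext (fun n => Re (RtoC (c n) * RtoC x ^ e n))); intros n; rewrite E; reflexivity.
  - transitivity (Series (fun _ => 0%R)).
    + apply (Series_ext (fun n => Im (RtoC (c n) * RtoC x ^ e n))); intros n; rewrite E; reflexivity.
    + rewrite (Series_ext _ (fun _ => (0 * 1)%R)) by (intros; ring).
      rewrite Series_scal_l; apply Rmult_0_l.
Qed.

Lemma Cconj_pow (z : C) (n : nat) : Cconj (z ^ n) = Cconj z ^ n.
Proof. induction n as [| n IH]; simpl; [apply injective_projections; simpl; ring |].
  rewrite Cmult_conj, IH; reflexivity. Qed.

Lemma gps_conj (c : nat -> R) (e : nat -> nat) (z : C) :
  gps c e (Cconj z) = Cconj (gps c e z).
Proof.
  assert (E : forall n, RtoC (c n) * Cconj z ^ e n = Cconj (RtoC (c n) * z ^ e n)).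
  { intros n; rewrite Cmult_conj, Cconj_pow; f_equal.
    apply injective_projections; simpl; ring. }
  unfold gps, Cser; apply injective_projections.
  - apply (Series_ext (fun n => Re (RtoC (c n) * Cconj z ^ e n))); intros n; rewrite E; reflexivity.
  - transitivity (Series (fun n => - Im (RtoC (c n) * z ^ e n))%R).
    + apply (Series_ext (fun n => Im (RtoC (c n) * Cconj z ^ e n))); intros n; rewrite E; reflexivity.
    + apply (Series_opp (fun n => Im (RtoC (c n) * z ^ e n))).
Qed.

(** * The hypergeometric equation on the real line *)

Open Scope R_scope.

(** The coefficient [((a, n) / n!)^2] of F(a, a, 1; x). *)
Fixpoint hc (a : R) (n : nat) : R :=
  match n with
  | O => 1
  | S m => hc a m * ((a + INR m) / INR (S m)) ^ 2
  end.

Lemma hc_bounds (a : R) (n : nat) : 0 <= a <= 1 -> 0 <= hc a n <= 1.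
Proof.
  intros Ha; induction n as [| n IH]; cbn [hc]; [lra |].
  assert (Hn := pos_INR n).
  assert (H : 0 <= (a + INR n) / INR (S n) <= 1).
  { rewrite S_INR; split; [apply Rmult_le_pos; [lra | left; apply Rinv_0_lt_compat; lra] |].
    apply (Rmult_le_reg_r (INR n + 1)); [lra |].
    unfold Rdiv; rewrite Rmult_assoc, Rinv_l; lra. }
  set (x := (a + INR n) / INR (S n)) in *.
  assert (H2 : 0 <= x ^ 2 <= 1) by (split; [apply pow2_ge_0 | rewrite <- (pow1 2); apply pow_incr; lra]).
  split; [apply Rmult_le_pos; lra |].
  rewrite <- (Rmult_1_l 1); apply Rmult_le_compat; lra.
Qed.

Lemma hc_S (a : R) (n : nat) : INR (S n) ^ 2 * hc a (S n) = (a + INR n) ^ 2 * hc a n.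
Proof.
  cbn [hc]; assert (0 < INR (S n)) by (apply lt_0_INR; lia); field; lra.
Qed.

Lemma hc_radius (a x : R) : 0 <= a <= 1 -> Rabs x < 1 -> Rbar_lt (Rabs x) (CV_radius (hc a)).
Proof.
  intros Ha Hx.
  apply (Rbar_lt_le_trans _ 1); [exact Hx |].
  apply (proj1 (CV_radius_bounded (hc a))); exists 1; intros n.
  rewrite pow1, Rmult_1_r, Rabs_pos_eq; apply hc_bounds, Ha.
Qed.

Definition Fr (a x : R) : R := PSeries (hc a) x.
Definition Fr1 (a x : R) : R := PSeries (PS_derive (hc a)) x.
Definition Fr2 (a x : R) : R := PSeries (PS_derive (PS_derive (hc a))) x.

Lemma is_derive_Fr (a x : R) : 0 <= a <= 1 -> Rabs x < 1 -> is_derive (Fr a) x (Fr1 a x).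
Proof. intros Ha Hx; apply is_derive_PSeries, hc_radius; assumption. Qed.

Lemma is_derive_Fr1 (a x : R) : 0 <= a <= 1 -> Rabs x < 1 -> is_derive (Fr1 a) x (Fr2 a x).
Proof.
  intros Ha Hx; apply is_derive_PSeries; rewrite CV_radius_derive; apply hc_radius; assumption.
Qed.

(** Comparing coefficients in [x F'' + F' = x^2 F'' + (1 + 2 a) x F' + a^2 F] gives exactly the
    recursion [hc_S]. *)
Lemma Fr_ODE (a x : R) : 0 <= a <= 1 -> Rabs x < 1 ->
  x * (1 - x) * Fr2 a x + (1 - (2 * a + 1) * x) * Fr1 a x = a ^ 2 * Fr a x.
Proof.
  intros Ha Hx.
  assert (R0 := hc_radius a x Ha Hx).
  set (h := hc a) in *; set (h1 := PS_derive h); set (h2 := PS_derive h1).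
  assert (E0 : ex_pseries h x) by (apply CV_radius_inside; exact R0).
  assert (E1 : ex_pseries h1 x).
  { apply CV_radius_inside; unfold h1; rewrite CV_radius_derive; exact R0. }
  assert (E2 : ex_pseries h2 x).
  { apply CV_radius_inside; unfold h2, h1; rewrite !CV_radius_derive; exact R0. }
  assert (I1 := ex_pseries_incr_1 h1 x E1).
  assert (I2 := ex_pseries_incr_1 h2 x E2).
  assert (I3 := ex_pseries_incr_1 _ x I2).
  assert (L : PSeries (PS_plus (PS_incr_1 h2) h1) x = x * Fr2 a x + Fr1 a x).
  { rewrite PSeries_plus, PSeries_incr_1 by assumption; reflexivity. }
  assert (R : PSeries (PS_plus (PS_incr_1 (PS_incr_1 h2))
      (PS_plus (PS_scal (1 + 2 * a) (PS_incr_1 h1)) (PS_scal (a ^ 2) h))) x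
    = x * (x * Fr2 a x) + ((1 + 2 * a) * (x * Fr1 a x) + a ^ 2 * Fr a x)).
  { rewrite !PSeries_plus, !PSeries_scal, !PSeries_incr_1; try assumption; try reflexivity.
    - apply (ex_pseries_scal (K := R_AbsRing) (V := R_NormedModule)); [apply Rmult_comm | exact I1].
    - apply (ex_pseries_scal (K := R_AbsRing) (V := R_NormedModule)); [apply Rmult_comm | exact E0].
    - apply ex_pseries_plus; apply (ex_pseries_scal (K := R_AbsRing) (V := R_NormedModule));
        try apply Rmult_comm; assumption. }
  assert (E : PSeries (PS_plus (PS_incr_1 h2) h1) x =
    PSeries (PS_plus (PS_incr_1 (PS_incr_1 h2))
      (PS_plus (PS_scal (1 + 2 * a) (PS_incr_1 h1)) (PS_scal (a ^ 2) h))) x).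
  { apply PSeries_ext; intros n.
    assert (K := hc_S a n); fold h in K.
    unfold h2, h1, PS_derive, PS_plus, PS_scal, PS_incr_1; clear -K.
    destruct n as [| [| n]]; cbv -[h INR pow Rmult Rplus IZR];
      rewrite ?S_INR in *; simpl INR in *; nra. }
  rewrite L, R in E; lra.
Qed.

Lemma Series_nonneg (a : nat -> R) : (forall n, 0 <= a n) -> ex_series a -> 0 <= Series a.
Proof.
  intros Ha Hs; replace 0 with (Series (fun n => 0 * a n)) by (rewrite Series_scal_l; ring).
  apply Series_le; [| exact Hs]; intros n; specialize (Ha n); lra.
Qed.

Lemma PSeries_nonneg_ge (c : nat -> R) (x : R) : (forall n, 0 <= c n) -> 0 <= x ->
  Rbar_lt (Rabs x) (CV_radius c) -> c 0%nat <= PSeries c x.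
Proof.
  intros Hc Hx HR.
  assert (E := CV_radius_inside _ _ HR).
  rewrite PSeries_decr_1 by exact E.
  assert (0 <= PSeries (PS_decr_1 c) x); [| nra].
  apply Series_nonneg.
  - intros n; apply Rmult_le_pos; [apply Hc | apply pow_le, Hx].
  - apply ex_pseries_R, ex_pseries_decr_1; [| exact E].
    destruct (Req_dec x 0) as [-> | N]; [left; reflexivity |].
    right; exists (/ x); apply Rinv_l, N.
Qed.

Lemma Fr_0 (a : R) : Fr a 0 = 1.
Proof. unfold Fr; rewrite PSeries_0; reflexivity. Qed.

Lemma Fr_ge1 (a x : R) : 0 <= a <= 1 -> 0 <= x < 1 -> 1 <= Fr a x.
Proof.
  intros Ha Hx; apply (PSeries_nonneg_ge (hc a)).
  - intros n; apply hc_bounds, Ha.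
  - lra.
  - apply hc_radius; [exact Ha | rewrite Rabs_pos_eq; lra].
Qed.

Lemma Fr_increasing (a x y : R) : 0 < a <= 1 -> 0 <= x < y -> y < 1 -> Fr a x < Fr a y.
Proof.
  intros Ha Hxy Hy.
  assert (D : forall t, x <= t <= y -> is_derive (Fr a) t (Fr1 a t)).
  { intros t Ht; apply is_derive_Fr; [lra | rewrite Rabs_pos_eq; lra]. }
  destruct (MVT_gen (Fr a) x y (Fr1 a)) as [t [Ht E]].
  - rewrite Rmin_left, Rmax_right by lra; intros t Ht; apply D; lra.
  - rewrite Rmin_left, Rmax_right by lra; intros t Ht.
    apply continuity_pt_filterlim, (ex_derive_continuous (K := R_AbsRing) (V := R_NormedModule)).
    eexists; apply D; lra.
  - rewrite Rmin_left, Rmax_right in Ht by lra.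
    assert (P : PS_derive (hc a) 0%nat <= Fr1 a t).
    { apply PSeries_nonneg_ge; [| lra |].
      - intros n; apply Rmult_le_pos; [apply pos_INR | apply hc_bounds; lra].
      - rewrite CV_radius_derive; apply hc_radius; [lra | rewrite Rabs_pos_eq; lra]. }
    assert (Q : PS_derive (hc a) 0%nat = a ^ 2) by (unfold PS_derive; simpl; field).
    assert (0 < a ^ 2) by (apply pow_lt; lra).
    rewrite Q in P; nra.
Qed.

(* Two solutions of [(P y')' = Q y] with [P 0 = 0] have zero Wronskian. *)
Lemma singular_ODE_unique (P Q G H G1 H1 : R -> R) (a b : R) :
  a < 0 < b ->
  (forall x, a < x < b -> is_derive G x (G1 x)) ->
  (forall x, a < x < b -> is_derive H x (H1 x)) ->
  (forall x, a < x < b -> is_derive (fun t => P t * G1 t) x (Q x * G x)) ->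
  (forall x, a < x < b -> is_derive (fun t => P t * H1 t) x (Q x * H x)) ->
  P 0 = 0 -> (forall x, 0 < x < b -> P x <> 0) -> (forall x, 0 <= x < b -> H x <> 0) ->
  G 0 = H 0 -> forall x, 0 <= x < b -> G x = H x.
Proof.
  intros Hab DG DH DPG DPH P0 PN HN GH x Hx.
  destruct (Req_dec x 0) as [-> | Nx]; [exact GH |].
  assert (const : forall f df : R -> R, (forall t, a < t < b -> is_derive f t (df t)) ->
    forall y, 0 < y < b -> (forall t, 0 < t < y -> df t = 0) -> f y = f 0).
  { intros f df Df y Hy Z.
    destruct (MVT_cor2 f (fun t => df t) 0 y) as [t [E Ht]]; [lra | |].
    - intros t Ht; apply is_derive_Reals, Df; lra.
    - rewrite (Z t Ht), Rmult_0_l in E; lra. }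
  assert (W : forall y, 0 < y < b -> G1 y * H y = G y * H1 y).
  { intros y Hy.
    (* [P] times the Wronskian is constant, and it vanishes at the singular point 0; this takes the
       place of a second initial condition. *)
    assert (E : (P y * G1 y) * H y - G y * (P y * H1 y) = (P 0 * G1 0) * H 0 - G 0 * (P 0 * H1 0)).
    { apply (const (fun t => (P t * G1 t) * H t - G t * (P t * H1 t)) (fun _ => 0));
        [| exact Hy | reflexivity].
      intros t Ht.
      replace 0 with ((Q t * G t) * H t + (P t * G1 t) * H1 t
        - (G1 t * (P t * H1 t) + G t * (Q t * H t))) by ring.
      apply (is_derive_minus (K := R_AbsRing) (V := R_NormedModule)).
      - apply (is_derive_mult (K := R_AbsRing) (fun t => P t * G1 t) H t);
          [apply DPG, Ht | apply DH, Ht | apply Rmult_comm].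
      - apply (is_derive_mult (K := R_AbsRing) G (fun t => P t * H1 t) t);
          [apply DG, Ht | apply DPH, Ht | apply Rmult_comm]. }
    rewrite P0 in E; specialize (PN y Hy).
    assert (E' : P y * (G1 y * H y - G y * H1 y) = 0) by lra.
    apply Rmult_integral in E'; destruct E' as [E' | E']; [contradiction | lra]. }
  destruct (MVT_cor2 (fun t => G t / H t) (fun t => (G1 t * H t - G t * H1 t) / H t ^ 2) 0 x)
    as [t [E Ht]]; [lra | |].
  - intros t Ht; apply is_derive_Reals.
    apply is_derive_div; [apply DG; lra | apply DH; lra | apply HN; lra].
  - rewrite (W t) in E by lra.
    assert (N0 := HN 0 ltac:(lra)); assert (N1 := HN x Hx).
    rewrite GH in E.
    replace (H 0 / H 0) with 1 in E by (field; exact N0).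
    assert (E2 : G x / H x = 1).
    { replace ((G t * H1 t - G t * H1 t) / H t ^ 2 * (x - 0)) with 0 in E;
        [lra | unfold Rdiv; ring]. }
    replace (G x) with (G x / H x * H x) by (field; exact N1); rewrite E2; ring.
Qed.

(** * Quadratic transformations of the hypergeometric function *)

Lemma is_derive_eq (f : R -> R) (x l m : R) : is_derive f x l -> l = m -> is_derive f x m.
Proof. intros H <-; exact H. Qed.

Lemma is_derive_Fr_comp (a x l : R) (u : R -> R) : 0 <= a <= 1 -> Rabs (u x) < 1 ->
  is_derive u x l -> is_derive (fun t => Fr a (u t)) x (Fr1 a (u x) * l).
Proof.
  intros Ha Hu H; eapply is_derive_eq.
  - apply (is_derive_comp (K := R_AbsRing) (V := R_NormedModule) (Fr a) u);
      [apply is_derive_Fr; eassumption | exact H].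
  - apply Rmult_comm.
Qed.

Lemma is_derive_Fr1_comp (a x l : R) (u : R -> R) : 0 <= a <= 1 -> Rabs (u x) < 1 ->
  is_derive u x l -> is_derive (fun t => Fr1 a (u t)) x (Fr2 a (u x) * l).
Proof.
  intros Ha Hu H; eapply is_derive_eq.
  - apply (is_derive_comp (K := R_AbsRing) (V := R_NormedModule) (Fr1 a) u);
      [apply is_derive_Fr1; eassumption | exact H].
  - apply Rmult_comm.
Qed.

Lemma is_derive_prod (f g : R -> R) (x l m : R) : is_derive f x l -> is_derive g x m ->
  is_derive (fun t => f t * g t) x (l * g x + f x * m).
Proof.
  intros Hf Hg; apply (is_derive_mult (K := R_AbsRing) f g x l m Hf Hg Rmult_comm).
Qed.

Lemma is_derive_sum (f g : R -> R) (x l m : R) : is_derive f x l -> is_derive g x m ->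
  is_derive (fun t => f t + g t) x (l + m).
Proof. apply (is_derive_plus (K := R_AbsRing) (V := R_NormedModule)). Qed.

(** The self-adjoint form [(x (1 - x) F')' = F / 4] of the equation for [a = 1/2], composed with
    [u]. *)
Lemma is_derive_half_comp (u : R -> R) (x l : R) : Rabs (u x) < 1 -> is_derive u x l ->
  is_derive (fun t => u t * (1 - u t) * Fr1 (1 / 2) (u t)) x (l * Fr (1 / 2) (u x) / 4).
Proof.
  intros Hu H; eapply is_derive_eq.
  - apply (is_derive_comp (K := R_AbsRing) (V := R_NormedModule)
      (fun t => t * (1 - t) * Fr1 (1 / 2) t) u x); [| exact H].
    apply is_derive_prod with (f := fun t => t * (1 - t));
      [auto_derive; [auto | reflexivity] | apply is_derive_Fr1; [lra | exact Hu]].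
  - unfold scal; simpl; unfold mult; simpl.
    assert (O := Fr_ODE (1 / 2) (u x) ltac:(lra) Hu).
    replace (l * Fr (1 / 2) (u x) / 4) with (l * ((1 / 2) ^ 2 * Fr (1 / 2) (u x))) by field.
    rewrite <- O; field.
Qed.

(** Differentiability across the singular point 0 excludes the logarithmic solutions, so the value
    at 0 determines [G]. *)
Lemma half_ODE_unique (G G1 : R -> R) (a b : R) : a < 0 < b -> -1 < a -> b <= 1 ->
  (forall x, a < x < b -> is_derive G x (G1 x)) ->
  (forall x, a < x < b -> is_derive (fun t => t * (1 - t) * G1 t) x (1 / 4 * G x)) ->
  G 0 = 1 -> forall x, 0 <= x < b -> G x = Fr (1 / 2) x.
Proof.
  intros Hab Ha Hb DG DPG G0.
  apply (singular_ODE_unique (fun t => t * (1 - t)) (fun _ => 1 / 4) G (Fr (1 / 2)) G1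
    (Fr1 (1 / 2)) a b); try assumption.
  - intros x Hx; apply is_derive_Fr; [lra | apply Rabs_def1; lra].
  - intros x Hx; eapply is_derive_eq.
    + apply (is_derive_half_comp (fun t => t) x 1); [apply Rabs_def1; lra |].
      apply (is_derive_id (K := R_AbsRing)).
    + field.
  - ring.
  - intros x Hx; nra.
  - intros x Hx; assert (T := Fr_ge1 (1 / 2) x ltac:(lra) ltac:(lra)); lra.
  - rewrite Fr_0; exact G0.
Qed.

(** The equation for [a = 1/4] pulled back by [u = 4 t (1 - t)] is the one for [a = 1/2]. At
    [x = 1/2] the map [u] reaches its critical value 1, the next singular point. *)
Lemma Fr_quadratic (x : R) : 0 <= x < 1 / 2 -> Fr (1 / 4) (4 * x * (1 - x)) = Fr (1 / 2) x.
Proof.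
  set (u := fun t => 4 * t * (1 - t)).
  (* The end [-1 / 10] provides a neighbourhood of 0 on which [u] stays in the disc of
     convergence. *)
  assert (Hu : forall t, -1 / 10 < t < 1 / 2 -> Rabs (u t) < 1)
    by (intros t Ht; apply Rabs_def1; unfold u; nra).
  assert (Du : forall t, is_derive u t (4 * (1 - 2 * t)))
    by (intros t; unfold u; auto_derive; [auto | ring]).
  apply (half_ODE_unique (fun t => Fr (1 / 4) (u t))
    (fun t => Fr1 (1 / 4) (u t) * (4 * (1 - 2 * t))) (-1 / 10) (1 / 2)); try lra.
  - intros t Ht; apply is_derive_Fr_comp; [lra | apply Hu, Ht | apply Du].
  - intros t Ht.
    apply (is_derive_ext (fun t => u t * (1 - 2 * t) * Fr1 (1 / 4) (u t)));
      [intros s; unfold u; simpl; ring |].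
    eapply is_derive_eq.
    + apply (is_derive_prod (fun t => u t * (1 - 2 * t)));
        [| apply is_derive_Fr1_comp; [lra | apply Hu, Ht | apply Du]].
      apply is_derive_prod; [apply Du | auto_derive; [auto | reflexivity]].
    + assert (O := Fr_ODE (1 / 4) (u t) ltac:(lra) (Hu t Ht)).
      replace (1 / 4 * Fr (1 / 4) (u t)) with (4 * ((1 / 4) ^ 2 * Fr (1 / 4) (u t))) by field.
      rewrite <- O; unfold u; field.
  - unfold u; replace (4 * 0 * (1 - 0)) with 0 by ring; apply Fr_0.
Qed.

(** As [1 - u = (1 - 2 x)^2], together with [Fr_quadratic] this is Euler's transformation
    [F(1/4,1/4,1;z) = (1 - z)^(1/2) F(3/4,3/4,1;z)]; it is obtained from the differential equation
    in the same way. *)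
Lemma Fr_quadratic_34 (x : R) : 0 <= x < 1 / 2 ->
  (1 - 2 * x) * Fr (3 / 4) (4 * x * (1 - x)) = Fr (1 / 2) x.
Proof.
  set (u := fun t => 4 * t * (1 - t)).
  assert (Hu : forall t, -1 / 10 < t < 1 / 2 -> Rabs (u t) < 1)
    by (intros t Ht; apply Rabs_def1; unfold u; nra).
  assert (Du : forall t, is_derive u t (4 * (1 - 2 * t)))
    by (intros t; unfold u; auto_derive; [auto | ring]).
  apply (half_ODE_unique (fun t => (1 - 2 * t) * Fr (3 / 4) (u t))
    (fun t => -2 * Fr (3 / 4) (u t) + (1 - 2 * t) * (Fr1 (3 / 4) (u t) * (4 * (1 - 2 * t))))
    (-1 / 10) (1 / 2)); try lra.
  - intros t Ht; apply (is_derive_prod (fun t => 1 - 2 * t) (fun t => Fr (3 / 4) (u t))).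
    + auto_derive; [auto | ring].
    + apply is_derive_Fr_comp; [lra | apply Hu, Ht | apply Du].
  - intros t Ht.
    apply (is_derive_ext (fun t => u t * (- 1 / 2 * Fr (3 / 4) (u t) +
      (1 - 2 * t) ^ 2 * Fr1 (3 / 4) (u t)))); [intros s; unfold u; simpl; field |].
    eapply is_derive_eq.
    + apply (is_derive_prod u); [apply Du |].
      apply is_derive_sum; apply is_derive_prod.
      * apply (is_derive_const (K := R_AbsRing) (V := R_NormedModule)).
      * apply is_derive_Fr_comp; [lra | apply Hu, Ht | apply Du].
      * auto_derive; [auto | reflexivity].
      * apply is_derive_Fr1_comp; [lra | apply Hu, Ht | apply Du].
    + assert (O := Fr_ODE (3 / 4) (u t) ltac:(lra) (Hu t Ht)).
      replace (1 / 4 * ((1 - 2 * t) * Fr (3 / 4) (u t))) with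
        ((1 - 2 * t) * (4 * ((3 / 4) ^ 2 * Fr (3 / 4) (u t)) - 2 * Fr (3 / 4) (u t))) by field.
      rewrite <- O; unfold zero; simpl; unfold u; field.
  - unfold u; replace (4 * 0 * (1 - 0)) with 0 by ring; rewrite Fr_0; ring.
Qed.

(** Both sides solve the pull-back of the equation for [a = 1/2] by [u = 4 t / (1 + t)^2], that is
    [(P y')' = Q y] with [P = u (1 - u) / u' = t (1 - t) / (1 + t)] and [Q = u' / 4]. *)
Lemma Fr_Landen (k : R) : 0 <= k < 1 ->
  Fr (1 / 2) (4 * k / (1 + k) ^ 2) = (1 + k) * Fr (1 / 2) (k ^ 2).
Proof.
  set (u := fun t => 4 * t / (1 + t) ^ 2).
  assert (Hu : forall t, -1 / 10 < t < 1 -> Rabs (u t) < 1).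
  { intros t Ht; unfold u; assert (0 < (1 + t) ^ 2) by (apply pow_lt; lra).
    apply Rabs_def1; [| apply Ropp_lt_cancel; rewrite Ropp_involutive];
      apply (Rmult_lt_reg_r ((1 + t) ^ 2)); try lra.
    - replace (4 * t / (1 + t) ^ 2 * (1 + t) ^ 2) with (4 * t) by (field; lra).
      assert (0 < (1 - t) ^ 2) by (apply pow_lt; lra). nra.
    - replace (- (4 * t / (1 + t) ^ 2) * (1 + t) ^ 2) with (- 4 * t) by (field; lra).
      nra. }
  assert (Du : forall t, -1 / 10 < t < 1 -> is_derive u t (4 * (1 - t) / (1 + t) ^ 3)).
  { intros t Ht; unfold u; auto_derive; [| field; lra].
    assert (0 < (1 + t) * ((1 + t) * 1)) by (simpl in *; nra); lra. }
  assert (Hv : forall t, -1 / 10 < t < 1 -> Rabs (t ^ 2) < 1)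
    by (intros t Ht; apply Rabs_def1; nra).
  assert (Dv : forall t, is_derive (fun t => t ^ 2) t (2 * t))
    by (intros t; auto_derive; [auto | ring]).
  apply (singular_ODE_unique (fun t => t * (1 - t) / (1 + t)) (fun t => (1 - t) / (1 + t) ^ 3)
    (fun t => Fr (1 / 2) (u t)) (fun t => (1 + t) * Fr (1 / 2) (t ^ 2))
    (fun t => Fr1 (1 / 2) (u t) * (4 * (1 - t) / (1 + t) ^ 3))
    (fun t => 1 * Fr (1 / 2) (t ^ 2) + (1 + t) * (Fr1 (1 / 2) (t ^ 2) * (2 * t)))
    (-1 / 10) 1).
  - lra.
  - intros t Ht; apply is_derive_Fr_comp; [lra | apply Hu, Ht | apply Du, Ht].
  - intros t Ht; apply (is_derive_prod (fun t => 1 + t) (fun t => Fr (1 / 2) (t ^ 2)));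
      [auto_derive; [auto | ring] |].
    apply is_derive_Fr_comp; [lra | apply Hv, Ht | apply Dv].
  - intros t Ht; eapply is_derive_eq.
    + eapply (is_derive_ext_loc (fun t => u t * (1 - u t) * Fr1 (1 / 2) (u t))).
      * assert (P : 0 < 1 + t) by lra.
        exists (mkposreal _ P); intros s Hs.
        assert (0 < 1 + s).
        { unfold ball in Hs; simpl in Hs; unfold AbsRing_ball, abs, minus, plus, opp in Hs;
            simpl in Hs; apply Rabs_def2 in Hs; lra. }
        unfold u; simpl; field; lra.
      * apply is_derive_half_comp; [apply Hu, Ht | apply Du, Ht].
    + simpl; field; lra.
  - intros t Ht; eapply is_derive_eq.
    (* Regrouped so that the first derivative occurs only inside the self-adjoint expression at
       [t ^ 2], whose derivative is given by [is_derive_half_comp]. *)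
    + eapply (is_derive_ext_loc (fun t => t * (1 - t) / (1 + t) * Fr (1 / 2) (t ^ 2) +
        2 / (1 + t) * (t ^ 2 * (1 - t ^ 2) * Fr1 (1 / 2) (t ^ 2)))).
      * assert (P : 0 < 1 + t) by lra.
        exists (mkposreal _ P); intros s Hs.
        assert (0 < 1 + s).
        { unfold ball in Hs; simpl in Hs; unfold AbsRing_ball, abs, minus, plus, opp in Hs;
            simpl in Hs; apply Rabs_def2 in Hs; lra. }
        simpl; field; lra.
      * apply is_derive_sum; apply is_derive_prod.
        -- auto_derive; [lra | reflexivity].
        -- apply is_derive_Fr_comp; [lra | apply Hv, Ht | apply Dv].
        -- auto_derive; [lra | reflexivity].
        -- apply (is_derive_half_comp (fun t => t ^ 2)); [apply Hv, Ht | apply Dv].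
    + simpl; field; lra.
  - field.
  - intros t Ht; assert (0 < t * (1 - t) / (1 + t)); [| lra].
    apply Rdiv_lt_0_compat; nra.
  - intros t Ht.
    assert (T := Fr_ge1 (1 / 2) (t ^ 2) ltac:(lra) ltac:(split; [apply pow2_ge_0 | nra])).
    assert (0 < (1 + t) * Fr (1 / 2) (t ^ 2)) by nra. lra.
  - unfold u; replace (4 * 0 / (1 + 0) ^ 2) with 0 by field.
    replace (0 ^ 2) with 0 by ring; rewrite Fr_0; ring.
Qed.

Open Scope C_scope.

(** * Continuation of the hypergeometric functions *)

Definition offneg (z : C) : Prop := ~ (Re z <= 0 /\ Im z = 0)%R.
Definition slit (z : C) : Prop := ~ (1 <= Re z /\ Im z = 0)%R.

Lemma slit_offneg (z : C) : slit z <-> offneg (1 - z).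
Proof. unfold slit, offneg, Re, Im; simpl; lra. Qed.

Lemma cnear_offneg (z : C) : offneg z -> cnear z offneg.
Proof.
  intros H; destruct (Rlt_dec 0 (Re z)) as [P | P].
  - exists (Re z); split; [exact P |]; intros w Hw [K _].
    assert (A := re_le_Cmod (w - z)); change (Re (w - z)) with (Re w + - Re z)%R in A.
    rewrite Rabs_left in A by lra; lra.
  - assert (N : Im z <> 0%R) by (intros E; apply H; split; [lra | exact E]).
    exists (Rabs (Im z)); split; [apply Rabs_pos_lt, N |]; intros w Hw [_ K].
    assert (A := im_le_Cmod (w - z)); change (Im (w - z)) with (Im w + - Im z)%R in A.
    rewrite K, Rplus_0_l, Rabs_Ropp in A; lra.
Qed.

Lemma cnear_slit (z : C) : slit z -> cnear z slit.
Proof.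
  intros H; apply slit_offneg in H; destruct (cnear_offneg _ H) as [d [Hd K]].
  exists d; split; [exact Hd |]; intros w Hw; apply slit_offneg, K.
  replace (1 - w - (1 - z)) with (- (w - z)) by ring; rewrite Cmod_opp; exact Hw.
Qed.

Lemma Re_plus (a b : C) : Re (a + b) = (Re a + Re b)%R.
Proof. reflexivity. Qed.

Lemma pos_Re_neq0 (z : C) : (0 < Re z)%R -> z <> 0.
Proof. intros H K; rewrite K in H; unfold Re in H; simpl in H; lra. Qed.

(** The principal branch in coordinates; on the negative real axis [a = 0] and the value is junk. *)
Definition Csqrt (z : C) : C :=
  let a := sqrt ((Cmod z + Re z) / 2) in (a, (Im z / (2 * a))%R).

Lemma Csqrt_spec (z : C) : offneg z -> Csqrt z * Csqrt z = z /\ (0 < Re (Csqrt z))%R.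
Proof.
  intros H.
  assert (Q := Cmod2_alt z); assert (M := Cmod_ge_0 z).
  assert (P : (0 < (Cmod z + Re z) / 2)%R).
  { destruct (Rlt_dec 0 (Cmod z + Re z)) as [L | L]; [lra |]; exfalso.
    assert (Rabs (Re z) <= Cmod z)%R by apply re_le_Cmod.
    assert (Re z <= 0)%R by lra.
    rewrite Rabs_left1 in * by lra.
    assert (E : Cmod z = (- Re z)%R) by lra.
    rewrite E in Q; apply H; split; [lra | nra]. }
  set (a := sqrt ((Cmod z + Re z) / 2)).
  assert (Ha : (0 < a)%R) by (apply sqrt_lt_R0, P).
  assert (Haa : (a * a = (Cmod z + Re z) / 2)%R) by (apply sqrt_sqrt; lra).
  split; [| exact Ha].
  unfold Csqrt; fold a; apply injective_projections; simpl; [| unfold Im; field; lra].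
  change (fst z) with (Re z).
  replace (a * a - Im z / (2 * a) * (Im z / (2 * a)))%R
    with (a * a - Im z ^ 2 / (4 * (a * a)))%R by (field; lra).
  rewrite Haa; replace (Im z ^ 2)%R with (Cmod z ^ 2 - Re z ^ 2)%R by lra; field; lra.
Qed.

Lemma offneg_sqr (w : C) : (0 < Re w)%R -> offneg (w * w).
Proof.
  intros Hw [A B]; unfold Re, Im in *; simpl in *.
  assert (E : (fst w * snd w = 0)%R) by lra.
  apply Rmult_integral in E; destruct E as [E | E]; [lra |].
  rewrite E in A; assert (0 < fst w * fst w)%R by (apply Rmult_lt_0_compat; exact Hw); lra.
Qed.

Lemma Csqrt_unique (w : C) : (0 < Re w)%R -> Csqrt (w * w) = w.
Proof.
  intros Hw.
  destruct (Csqrt_spec _ (offneg_sqr w Hw)) as [E P]; set (s := Csqrt (w * w)) in *.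
  assert (F : (s - w) * (s + w) = 0) by (replace ((s - w) * (s + w)) with (s * s - w * w) by ring;
    rewrite E; ring).
  assert (N : s + w <> 0).
  { apply pos_Re_neq0; rewrite Re_plus; lra. }
  replace s with ((s - w) * (s + w) / (s + w) + w) by (field; exact N).
  rewrite F; field; exact N.
Qed.

Lemma Csqrt_real (t : R) : (0 < t)%R -> Csqrt (RtoC t) = RtoC (sqrt t).
Proof.
  intros Ht; rewrite <- (sqrt_sqrt t) at 1 by lra; rewrite RtoC_mult.
  apply Csqrt_unique; simpl; apply sqrt_lt_R0, Ht.
Qed.

Lemma Csqrt_Cmod (z : C) : offneg z -> (Cmod (Csqrt z) * Cmod (Csqrt z) = Cmod z)%R.
Proof. intros H; rewrite <- Cmod_mult; f_equal; apply Csqrt_spec, H. Qed.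

(** In [w - z = (Csqrt w - Csqrt z) (Csqrt w + Csqrt z)] the second factor has real part at least
    [Re (Csqrt z)]. *)
Lemma Csqrt_cont (z : C) : offneg z -> ccont Csqrt z.
Proof.
  intros H e He; destruct (Csqrt_spec z H) as [E P].
  destruct (cnear_offneg z H) as [d [Hd K]].
  exists (Rmin d (e * Re (Csqrt z))); split.
  - apply Rmin_pos; [exact Hd | apply Rmult_lt_0_compat; assumption].
  - intros w Hw.
    destruct (Csqrt_spec w (K w (Rlt_le_trans _ _ _ Hw (Rmin_l _ _)))) as [E' P'].
    assert (L := Rlt_le_trans _ _ _ Hw (Rmin_r _ _)).
    assert (F : Cmod (w - z) = (Cmod (Csqrt w - Csqrt z) * Cmod (Csqrt w + Csqrt z))%R).
    { rewrite <- Cmod_mult; f_equal.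
      replace ((Csqrt w - Csqrt z) * (Csqrt w + Csqrt z))
        with (Csqrt w * Csqrt w - Csqrt z * Csqrt z) by ring; rewrite E, E'; reflexivity. }
    assert (G : (Re (Csqrt z) <= Cmod (Csqrt w + Csqrt z))%R).
    { eapply Rle_trans; [| apply re_le_Cmod].
      eapply Rle_trans; [| apply Rle_abs]; rewrite Re_plus; lra. }
    apply (Rmult_lt_reg_r (Cmod (Csqrt w + Csqrt z))); [lra |]; rewrite <- F.
    eapply Rlt_le_trans; [exact L |]; apply Rmult_le_compat_l; lra.
Qed.

Lemma Csqrt_neq0 (z : C) : offneg z -> Csqrt z <> 0.
Proof. intros H; apply pos_Re_neq0, Csqrt_spec, H. Qed.

Lemma holo_Csqrt (z : C) : offneg z -> holo Csqrt z.
Proof.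
  intros H; exists (/ (Csqrt z + Csqrt z)); apply cderiv_slope.
  destruct (Csqrt_spec z H) as [E P].
  assert (N : forall w, offneg w -> Csqrt w + Csqrt z <> 0).
  { intros w Hw; destruct (Csqrt_spec w Hw) as [_ P'].
    apply pos_Re_neq0; rewrite Re_plus; lra. }
  exists (fun w => / (Csqrt w + Csqrt z)); split; [| split; [reflexivity |]].
  - apply ccont_inv; [| apply N, H].
    apply ccont_plus; [apply Csqrt_cont, H | apply ccont_const].
  - apply (cnear_impl z offneg); [| apply cnear_offneg, H]; intros w Hw.
    destruct (Csqrt_spec w Hw) as [E' _]; specialize (N w Hw).
    replace (/ (Csqrt w + Csqrt z) * (w - z))
      with (/ (Csqrt w + Csqrt z) * (Csqrt w * Csqrt w - Csqrt z * Csqrt z))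
      by (rewrite E, E'; reflexivity).
    field; exact N.
Qed.

(** * Explicit continuations to the slit plane *)

Definition Fc (a : R) (z : C) : C := gps (hc a) (fun n => n) z.

Lemma hc_ok (a : R) : (0 <= a <= 1)%R -> gps_ok (hc a) (fun n => n).
Proof.
  intros Ha; split; [| intros; apply le_n].
  intros n; rewrite Rabs_pos_eq; apply hc_bounds, Ha.
Qed.

Lemma Fc_real (a x : R) : Fc a (RtoC x) = RtoC (Fr a x).
Proof. exact (gps_real (hc a) (fun n => n) x). Qed.

Lemma holo_Fc (a : R) (z : C) : (0 <= a <= 1)%R -> (Cmod z < 1)%R -> holo (Fc a) z.
Proof. intros Ha Hz; exact (holo_gps (hc a) (fun n => n) z (hc_ok a Ha) Hz). Qed.

(** The solution of [z = 4 k / (1 + k)^2] in the unit disc: there [1 - z] is the square of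
    [(1 - k) / (1 + k)], and the Cayley map takes the right half-plane to the disc. *)
Definition kmap (z : C) : C := (1 - Csqrt (1 - z)) / (1 + Csqrt (1 - z)).

(* Landen's transformation continues the series beyond the unit disc, because
   [k |-> 4k/(1+k)^2] maps the disc onto the whole slit plane. *)
Definition Fext (z : C) : C := (1 + kmap z) * Fc (1 / 2) (kmap z * kmap z).

Lemma one_plus_neq0 (s : C) : (0 < Re s)%R -> 1 + s <> 0.
Proof. intros H; apply pos_Re_neq0; rewrite Re_plus; change (0 < 1 + Re s)%R; lra. Qed.

Lemma Cayley_lt1 (s : C) : (0 < Re s)%R -> (Cmod ((1 - s) / (1 + s)) < 1)%R.
Proof.
  intros H; rewrite Cmod_div by (apply one_plus_neq0, H).
  assert (P := proj1 (Cmod_gt_0 _) (one_plus_neq0 s H)).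
  apply (Rmult_lt_reg_r (Cmod (1 + s))); [exact P |].
  unfold Rdiv; rewrite Rmult_assoc, Rinv_l, Rmult_1_r, Rmult_1_l by lra.
  assert (A := Cmod2_alt (1 - s)); assert (B := Cmod2_alt (1 + s)).
  assert (C1 := Cmod_ge_0 (1 - s)).
  unfold Re, Im in *; simpl in A, B, H; nra.
Qed.

Lemma kmap_lt1 (z : C) : slit z -> (Cmod (kmap z) < 1)%R.
Proof. intros H; apply Cayley_lt1, Csqrt_spec, slit_offneg, H. Qed.

Lemma Cmod_sqr_lt1 (z : C) : (Cmod z < 1)%R -> (Cmod (z * z) < 1)%R.
Proof. intros H; rewrite Cmod_mult; assert (P := Cmod_ge_0 z); nra. Qed.

Lemma holo_sqrt_one_minus (z : C) : slit z -> holo (fun w => Csqrt (1 - w)) z.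
Proof.
  intros H; apply (holo_comp (fun w => 1 - w) Csqrt).
  - apply holo_minus; [apply holo_const | apply holo_id].
  - apply holo_Csqrt, slit_offneg, H.
Qed.

Lemma holo_Fext (z : C) : slit z -> holo Fext z.
Proof.
  intros H.
  assert (K : holo kmap z).
  { apply holo_div; [apply holo_minus | apply holo_plus |];
      try apply holo_const; try apply holo_sqrt_one_minus, H.
    apply one_plus_neq0, Csqrt_spec, slit_offneg, H. }
  apply holo_mult; [apply holo_plus; [apply holo_const | exact K] |].
  apply (holo_comp (fun w => kmap w * kmap w) (Fc (1 / 2))); [apply holo_mult; exact K |].
  apply holo_Fc; [lra | apply Cmod_sqr_lt1, kmap_lt1, H].
Qed.

Lemma Fext_real (x : R) : (0 <= x < 1)%R -> Fext (RtoC x) = RtoC (Fr (1 / 2) x).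
Proof.
  intros Hx; unfold Fext, kmap.
  rewrite <- RtoC_minus, Csqrt_real by lra.
  set (s := sqrt (1 - x)).
  assert (Hs : (0 < s)%R) by (apply sqrt_lt_R0; lra).
  assert (Hss : (s * s = 1 - x)%R) by (apply sqrt_sqrt; lra).
  assert (Hs1 : (s <= 1)%R) by nra.
  rewrite <- RtoC_minus, <- RtoC_plus, <- RtoC_div by lra.
  set (k := ((1 - s) / (1 + s))%R).
  assert (Hk : (0 <= k < 1)%R).
  { unfold k; split; [apply Rmult_le_pos; [lra | left; apply Rinv_0_lt_compat; lra] |].
    apply (Rmult_lt_reg_r (1 + s)); [lra |]; unfold Rdiv; rewrite Rmult_assoc, Rinv_l; lra. }
  rewrite <- RtoC_plus, <- RtoC_mult, Fc_real, <- RtoC_mult; f_equal.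
  replace (k * k)%R with (k ^ 2)%R by ring; rewrite <- Fr_Landen by exact Hk; f_equal.
  unfold k; replace x with (1 - s * s)%R by lra; field; lra.
Qed.

Lemma slit_Re (z : C) : (Re z < 1)%R -> slit z.
Proof. intros H [K _]; lra. Qed.

Lemma slit_Im (z : C) : Im z <> 0%R -> slit z.
Proof. intros H [_ K]; contradiction. Qed.

(** The root of [z = 4 l (1 - l)] with [Re l < 1/2]. *)
Definition lambda_of (z : C) : C := (1 - Csqrt (1 - z)) / 2.
Definition G14 (z : C) : C := Fext (lambda_of z).
Definition G34 (z : C) : C := G14 z / Csqrt (1 - z).

Lemma C2_neq0 : RtoC 2 <> 0.
Proof. intros E; apply RtoC_inj in E; lra. Qed.

Lemma Re_half (z : C) : Re (z / 2) = (Re z / 2)%R.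
Proof. unfold Cdiv; rewrite <- RtoC_inv by lra; unfold Re; simpl; field. Qed.

Lemma slit_lambda_of (z : C) : slit z -> slit (lambda_of z).
Proof.
  intros H; apply slit_Re; unfold lambda_of; rewrite Re_half.
  destruct (Csqrt_spec (1 - z)) as [_ P]; [apply slit_offneg, H |].
  change (Re (1 - Csqrt (1 - z))) with (1 + - Re (Csqrt (1 - z)))%R; lra.
Qed.

Lemma holo_G14 (z : C) : slit z -> holo G14 z.
Proof.
  intros H; apply (holo_comp lambda_of Fext); [| apply holo_Fext, slit_lambda_of, H].
  apply holo_div; [apply holo_minus; [apply holo_const | apply holo_sqrt_one_minus, H] | |];
    [apply holo_const | apply C2_neq0].
Qed.

Lemma holo_G34 (z : C) : slit z -> holo G34 z.
Proof.
  intros H; apply holo_div; [apply holo_G14, H | apply holo_sqrt_one_minus, H |].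
  apply Csqrt_neq0, slit_offneg, H.
Qed.

Lemma G_real (y : R) : (0 <= y < 1)%R ->
  G14 (RtoC y) = RtoC (Fr (1 / 4) y) /\ G34 (RtoC y) = RtoC (Fr (3 / 4) y).
Proof.
  intros Hy.
  set (s := sqrt (1 - y)).
  assert (Hs : (0 < s)%R) by (apply sqrt_lt_R0; lra).
  assert (Hss : (s * s = 1 - y)%R) by (apply sqrt_sqrt; lra).
  assert (Hs1 : (s <= 1)%R) by nra.
  set (x := ((1 - s) / 2)%R).
  assert (Hx : (0 <= x < 1 / 2)%R) by (unfold x; lra).
  assert (Ey : y = (4 * x * (1 - x))%R) by (unfold x; nra).
  assert (E : G14 (RtoC y) = RtoC (Fr (1 / 2) x)).
  { unfold G14, lambda_of; rewrite <- RtoC_minus, Csqrt_real, <- RtoC_minus, <- RtoC_div by lra.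
    apply Fext_real; fold s; fold x; lra. }
  split.
  - rewrite E, Ey, Fr_quadratic by exact Hx; reflexivity.
  - unfold G34; rewrite E, <- RtoC_minus, Csqrt_real, <- RtoC_div by (try fold s; lra); fold s.
    f_equal; rewrite <- Fr_quadratic_34, <- Ey by exact Hx.
    unfold x; field; lra.
Qed.

Lemma disc_slit (z : C) : (Cmod z < 1)%R -> slit z.
Proof.
  intros H; apply slit_Re; eapply Rle_lt_trans; [apply Rle_abs |].
  eapply Rle_lt_trans; [apply re_le_Cmod | exact H].
Qed.

Lemma Fc_eq_of_real (a : R) (f : C -> C) : (0 <= a <= 1)%R ->
  (forall z, slit z -> holo f z) ->
  (forall y, (0 <= y < 1)%R -> f (RtoC y) = RtoC (Fr a y)) ->
  forall z, (Cmod z < 1)%R -> f z = Fc a z.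
Proof.
  intros Ha Hf Hr z Hz.
  assert (E : f z - Fc a z = 0).
  { apply (disc_zero (fun w => f w - Fc a w) 0 1).
    - intros w Hw; replace (w - 0) with w in Hw by ring.
      apply holo_minus; [apply Hf, disc_slit, Hw | apply holo_Fc; assumption].
    - intros d Hd.
      assert (P : (0 < Rmin d 1)%R) by (apply Rmin_pos; lra).
      assert (A := Rmin_l d 1); assert (B := Rmin_r d 1).
      exists (RtoC (Rmin d 1 / 2)); split.
      + replace (RtoC (Rmin d 1 / 2) - 0) with (RtoC (Rmin d 1 / 2)) by ring.
        rewrite Cmod_R, Rabs_pos_eq; lra.
      + rewrite Hr, Fc_real by lra; ring.
    - replace (z - 0) with z by ring; exact Hz. }
  rewrite <- (Cplus_0_l (Fc a z)), <- E; ring.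
Qed.

(** * Comparison with the continuation of the statement *)

Lemma poch_1_neq0 (n : nat) : poch 1 n <> 0.
Proof.
  induction n as [| n IH]; simpl; [intros E; apply RtoC_inj in E; lra |].
  apply Cmult_neq_0; [exact IH |]; rewrite <- RtoC_plus; intros E; apply RtoC_inj in E.
  assert (P := pos_INR n); lra.
Qed.

Lemma hyper_coeff_hc (a : R) (n : nat) :
  hyper_coeff (RtoC a) (RtoC a) 1 n = RtoC (hc a n).
Proof.
  unfold hyper_coeff; induction n as [| n IH]; [simpl; field; apply (poch_1_neq0 0) |].
  change (hc a (S n)) with (hc a n * ((a + INR n) / INR (S n)) ^ 2)%R.
  rewrite RtoC_mult, <- IH; cbn [poch].
  assert (P := pos_INR n); assert (N := poch_1_neq0 n).
  assert (N' : 1 + RtoC (INR n) <> 0).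
  { rewrite <- RtoC_plus; intros E; apply RtoC_inj in E; lra. }
  rewrite S_INR, RtoC_pow, RtoC_div by lra.
  rewrite !RtoC_plus; simpl.
  field; repeat split; try assumption.
  rewrite Cplus_comm; exact N'.
Qed.

Lemma pow_n_Cpow (z : C) (n : nat) : pow_n (K := C_Ring) z n = z ^ n.
Proof. induction n as [| n IH]; [reflexivity | simpl; rewrite IH; reflexivity]. Qed.

Lemma is_pseries_hyper (a : R) (z l : C) :
  is_pseries (K := C_AbsRing) (V := C_NormedModule) (hyper_coeff (RtoC a) (RtoC a) 1) z l <->
  csum_to (fun n => RtoC (hc a n) * z ^ n) l.
Proof.
  assert (E : forall n, scal (K := C_Ring) (V := C_ModuleSpace) (pow_n (K := C_Ring) z n)
      (hyper_coeff (RtoC a) (RtoC a) 1 n) = RtoC (hc a n) * z ^ n).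
  { intros n; rewrite pow_n_Cpow, hyper_coeff_hc; apply Cmult_comm. }
  unfold is_pseries; rewrite is_series_csum_to; split; apply csum_to_ext; intros n;
    [exact (E n) | symmetry; exact (E n)].
Qed.

(** The explicit [f] shows that a continuation exists, so [epsilon] returns one. It has the same
    power series as [f] near 0, and agreement spreads along segments from 0, about which the slit
    plane is star-shaped. *)
Lemma hyper_continuation_eq (a : R) (f : C -> C) : (0 <= a <= 1)%R ->
  (forall z, slit z -> holo f z) ->
  (forall y, (0 <= y < 1)%R -> f (RtoC y) = RtoC (Fr a y)) ->
  forall z, slit z -> hyper_continuation (RtoC a) (RtoC a) 1 z = f z.
Proof.
  intros Ha Hf Hr.
  assert (Hser : forall z, (Cmod z < 1)%R -> csum_to (fun n => RtoC (hc a n) * z ^ n) (f z)).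
  { intros z Hz; rewrite (Fc_eq_of_real a f) by assumption.
    apply gps_correct; [apply hc_ok, Ha | exact Hz]. }
  assert (Hc : is_hyper_continuation (RtoC a) (RtoC a) 1 f).
  { split.
    - intros z Hz; apply ex_derive_holo, Hf, Hz.
    - intros z Hz; apply is_pseries_hyper, Hser, Hz. }
  assert (Hg : is_hyper_continuation (RtoC a) (RtoC a) 1 (hyper_continuation (RtoC a) (RtoC a) 1)).
  { unfold hyper_continuation; apply epsilon_spec; exists f; exact Hc. }
  set (g := hyper_continuation (RtoC a) (RtoC a) 1) in *.
  destruct Hg as [Hg1 Hg2]; intros z Hz.
  assert (E : cnear z (fun w => g w - f w = 0)).
  { apply (identity_segment (fun w => g w - f w) 0 z).
    - intros t Ht; apply (cnear_impl _ slit).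
      + intros w Hw; apply holo_minus; [apply ex_derive_holo, Hg1, Hw | apply Hf, Hw].
      + apply cnear_slit; intros [K1 K2].
        replace (0 + RtoC t * (z - 0)) with (RtoC t * z) in * by ring.
        unfold Re, Im in *; simpl in K1, K2; apply Hz; unfold Re, Im.
        assert (T : (t <> 0)%R) by (intros E; rewrite E in K1; lra).
        assert (S : (t * snd z = 0)%R) by lra.
        apply Rmult_integral in S; destruct S as [S | S]; [lra |]; split; [| exact S].
        rewrite S in K1; destruct (Rle_dec 1 (fst z)) as [L | L]; [exact L | nra].
    - apply cnear_zeros_cluster; exists 1%R; split; [lra |]; intros w Hw.
      replace (w - 0) with w in Hw by ring.
      rewrite (csum_to_unique _ _ _ (proj1 (is_pseries_hyper a w _) (Hg2 w Hw)) (Hser w Hw)).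
      ring. }
  apply cnear_self in E; rewrite <- (Cplus_0_l (f z)), <- E; ring.
Qed.

Lemma hyper_14 (z : C) : slit z -> hyper_continuation (1 / 4) (1 / 4) 1 z = G14 z.
Proof.
  rewrite <- RtoC_div by lra; apply hyper_continuation_eq; [lra | apply holo_G14 |].
  intros y Hy; apply G_real, Hy.
Qed.

Lemma hyper_34 (z : C) : slit z -> hyper_continuation (3 / 4) (3 / 4) 1 z = G34 z.
Proof.
  rewrite <- RtoC_div by lra; apply hyper_continuation_eq; [lra | apply holo_G34 |].
  intros y Hy; apply G_real, Hy.
Qed.

(** * Duplication formulas for theta constants *)

(** [tA0] and [tA1] are the parts [n >= 0] and [n < 0] of the sum of [q^(n^2)] over the integers.
    From theta10 the factor [2 q^(1/4)] is removed, so that [tpsi] is a power series in [q]. *)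
Definition tA0 (q : C) : C := gps (fun _ => 1%R) (fun n => (n * n)%nat) q.
Definition tA1 (q : C) : C := gps (fun _ => 1%R) (fun n => (S n * S n)%nat) q.
Definition tA (q : C) : C := tA0 q + tA1 q.
Definition tpsi (q : C) : C := gps (fun _ => 1%R) (fun n => (n * n + n)%nat) q.

Lemma ok_sq : gps_ok (fun _ => 1%R) (fun n => (n * n)%nat).
Proof. split; intros n; [rewrite Rabs_R1; lra | nia]. Qed.

Lemma ok_Ssq : gps_ok (fun _ => 1%R) (fun n => (S n * S n)%nat).
Proof. split; intros n; [rewrite Rabs_R1; lra | nia]. Qed.

Lemma ok_pronic : gps_ok (fun _ => 1%R) (fun n => (n * n + n)%nat).
Proof. split; intros n; [rewrite Rabs_R1; lra | nia]. Qed.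

Lemma holo_tA (q : C) : (Cmod q < 1)%R -> holo tA q.
Proof.
  intros H; apply holo_plus; [exact (holo_gps _ _ q ok_sq H) | exact (holo_gps _ _ q ok_Ssq H)].
Qed.

Lemma holo_tpsi (q : C) : (Cmod q < 1)%R -> holo tpsi q.
Proof. intros H; exact (holo_gps _ _ q ok_pronic H). Qed.

Lemma tA_conj (q : C) : tA (Cconj q) = Cconj (tA q).
Proof.
  unfold tA; rewrite Cplus_conj; f_equal.
  - exact (gps_conj (fun _ => 1%R) (fun n => (n * n)%nat) q).
  - exact (gps_conj (fun _ => 1%R) (fun n => (S n * S n)%nat) q).
Qed.

Lemma tpsi_conj (q : C) : tpsi (Cconj q) = Cconj (tpsi q).
Proof. exact (gps_conj (fun _ => 1%R) (fun n => (n * n + n)%nat) q). Qed.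

Lemma Cpow_0_l (n : nat) : (0 < n)%nat -> (RtoC 0) ^ n = 0.
Proof. intros H; destruct n as [| n]; [lia | simpl; ring]. Qed.

Lemma csum_to_eventually (a : nat -> C) (l : C) (N : nat) :
  (forall n, (N <= n)%nat -> csumn a n = l) -> csum_to a l.
Proof.
  intros H e He; exists N; intros n Hn; rewrite H, Cmod_self by exact Hn; exact He.
Qed.

Lemma gps_0 (c : nat -> R) (e : nat -> nat) : gps_ok c e ->
  (forall n, (0 < n)%nat -> (0 < e n)%nat) ->
  gps c e 0 = RtoC (c 0%nat) * 0 ^ e 0%nat.
Proof.
  intros Hok He.
  apply (csum_to_unique (fun n => RtoC (c n) * 0 ^ e n)).
  - apply gps_correct; [exact Hok | rewrite Cmod_0; lra].
  - apply (csum_to_eventually _ _ 1); intros n Hn; induction Hn as [| n Hn IH].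
    + simpl; ring.
    + cbn [csumn]; rewrite IH, (Cpow_0_l (e n)) by (apply He; lia); ring.
Qed.

Lemma tA_0 : tA 0 = 1.
Proof.
  unfold tA, tA0, tA1; rewrite (gps_0 _ _ ok_sq), (gps_0 _ _ ok_Ssq) by (intros; nia).
  simpl; ring.
Qed.

Lemma tpsi_0 : tpsi 0 = 1.
Proof.
  unfold tpsi; rewrite (gps_0 _ _ ok_pronic) by (intros; nia); simpl; ring.
Qed.

Lemma tpsi_opp (q : C) : (Cmod q < 1)%R -> tpsi (- q) = tpsi q.
Proof.
  intros H; apply (csum_to_unique (fun n => RtoC 1 * (- q) ^ (n * n + n))).
  - apply (gps_correct (fun _ => 1%R) (fun n => (n * n + n)%nat) (- q) ok_pronic).
    rewrite Cmod_opp; exact H.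
  - apply (csum_to_ext (fun n => RtoC 1 * q ^ (n * n + n))).
    + intros n; f_equal.
      assert (E : exists m, (n * n + n = 2 * m)%nat).
      { induction n as [| n [m IH]]; [exists 0%nat; lia | exists (m + S n)%nat; lia]. }
      destruct E as [m ->]; rewrite !Cpow_mult_r; f_equal; simpl; ring.
    + exact (gps_correct (fun _ => 1%R) (fun n => (n * n + n)%nat) q ok_pronic H).
Qed.

(** * Lattice sums over integer pairs *)

Fixpoint zbox (N : nat) : list Z :=
  match N with
  | O => (0 :: nil)%Z
  | S n => (Z.of_nat (S n) :: - Z.of_nat (S n) :: zbox n)%Z
  end.

Lemma in_zbox (N : nat) (k : Z) : In k (zbox N) <-> (Z.abs k <= Z.of_nat N)%Z.
Proof.
  induction N as [| N IH]; cbn [zbox In]; [lia |].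
  rewrite IH; lia.
Qed.

Lemma NoDup_zbox (N : nat) : NoDup (zbox N).
Proof.
  induction N as [| N IH]; cbn [zbox]; [repeat constructor; intros [] |].
  constructor; [| constructor; [| exact IH]].
  - cbn [In]; rewrite in_zbox; lia.
  - rewrite in_zbox; lia.
Qed.

Definition lsum {T : Type} (f : T -> R) (l : list T) : R := fold_right (fun t s => (f t + s)%R) 0%R l.

Lemma lsum_app {T : Type} (f : T -> R) (l m : list T) : (lsum f (l ++ m) = lsum f l + lsum f m)%R.
Proof. induction l as [| t l IH]; simpl; [ring | unfold lsum in *; simpl; rewrite IH; ring]. Qed.

Lemma lsum_map {T U : Type} (f : U -> R) (g : T -> U) (l : list T) :
  lsum f (map g l) = lsum (fun t => f (g t)) l.
Proof. induction l as [| t l IH]; simpl; [reflexivity | unfold lsum in *; simpl; rewrite IH; reflexivity]. Qed.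

Lemma lsum_ext {T : Type} (f g : T -> R) (l : list T) : (forall t, f t = g t) -> lsum f l = lsum g l.
Proof. intros H; induction l as [| t l IH]; simpl; [reflexivity | unfold lsum in *; simpl; rewrite IH, H; reflexivity]. Qed.

Lemma lsum_scal {T : Type} (c : R) (f : T -> R) (l : list T) :
  (lsum (fun t => c * f t) l = c * lsum f l)%R.
Proof. induction l as [| t l IH]; unfold lsum in *; simpl; [ring | rewrite IH; ring]. Qed.

Lemma lsum_prod {T U : Type} (f : T -> R) (g : U -> R) (l : list T) (m : list U) :
  (lsum (fun p => f (fst p) * g (snd p)) (list_prod l m) = lsum f l * lsum g m)%R.
Proof.
  induction l as [| t l IH]; [unfold lsum; simpl; ring |].
  cbn [list_prod]; rewrite lsum_app, lsum_map, IH; simpl fst; simpl snd.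
  rewrite lsum_scal; unfold lsum; simpl; ring.
Qed.

Lemma lsum_incl {T : Type} (f : T -> R) (l m : list T) :
  (forall t, (0 <= f t)%R) -> NoDup l -> incl l m -> (lsum f l <= lsum f m)%R.
Proof.
  intros Hf; revert m; induction l as [| t l IH]; intros m Hl Hm.
  - unfold lsum at 1; simpl; clear Hm; induction m as [| u m IHm]; unfold lsum in *; simpl; [lra |].
    specialize (Hf u); lra.
  - inversion Hl as [| ? ? Nt Hl']; subst.
    destruct (in_split t m (Hm t (or_introl eq_refl))) as [m1 [m2 ->]].
    assert (A : (lsum f l <= lsum f (m1 ++ m2))%R).
    { apply IH; [exact Hl' |]; intros u Hu.
      assert (K := Hm u (or_intror Hu)); rewrite !in_app_iff in *; cbn [In] in K.
      destruct K as [K | [K | K]]; [tauto | subst; contradiction | tauto]. }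
    rewrite lsum_app in *; change (lsum f (t :: l)) with (f t + lsum f l)%R.
    change (lsum f (t :: m2)) with (f t + lsum f m2)%R; lra.
Qed.

Lemma NoDup_list_prod {T U : Type} (l : list T) (m : list U) :
  NoDup l -> NoDup m -> NoDup (list_prod l m).
Proof.
  intros Hl Hm; induction Hl as [| t l Nt Hl IH]; cbn [list_prod]; [constructor |].
  apply NoDup_app; [| exact IH |].
  - apply Injective_map_NoDup; [| exact Hm]; intros u v E; injection E; auto.
  - intros [a b] H K; apply in_map_iff in H; destruct H as [u [E _]]; injection E; intros; subst.
    apply in_prod_iff in K; tauto.
Qed.

(* Used with the pairs of even and of odd sum: boxes are interlaced with the images of boxes,
   so that, all terms being nonnegative, the two limits agree. *)
Lemma lattice_split (f : Z * Z -> R) (g h : Z * Z -> Z * Z) (l1 l2 : R) :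
  (forall p, (0 <= f p)%R) ->
  (forall p q, g p = g q -> p = q) -> (forall p q, h p = h q -> p = q) ->
  (forall p q, g p <> h q) ->
  (forall N p, In p (list_prod (zbox N) (zbox N)) ->
     In (g p) (list_prod (zbox (2 * N + 1)) (zbox (2 * N + 1))) /\
     In (h p) (list_prod (zbox (2 * N + 1)) (zbox (2 * N + 1)))) ->
  (forall N p, In p (list_prod (zbox N) (zbox N)) ->
     exists q, In q (list_prod (zbox N) (zbox N)) /\ (p = g q \/ p = h q)) ->
  is_lim_seq (fun N => lsum f (list_prod (zbox N) (zbox N))) l1 ->
  is_lim_seq (fun N => (lsum (fun p => f (g p)) (list_prod (zbox N) (zbox N)) +
                        lsum (fun p => f (h p)) (list_prod (zbox N) (zbox N)))%R) l2 ->
  l1 = l2.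
Proof.
  intros Hf Hg Hh Hgh Hin Hcov L1 L2.
  set (B := fun N => list_prod (zbox N) (zbox N)).
  assert (ND : forall N, NoDup (B N)) by (intros N; apply NoDup_list_prod; apply NoDup_zbox).
  assert (E : forall N, (lsum (fun p => f (g p)) (B N) + lsum (fun p => f (h p)) (B N))%R
    = lsum f (map g (B N) ++ map h (B N))).
  { intros N; rewrite lsum_app, !lsum_map; reflexivity. }
  assert (U1 : Rbar_le l1 l2).
  { eapply is_lim_seq_le; [| exact L1 | exact L2]; intros N.
    change (lsum f (B N) <= lsum (fun p => f (g p)) (B N) + lsum (fun p => f (h p)) (B N))%R; rewrite E.
    apply lsum_incl; [exact Hf | apply ND |]; intros p Hp.
    destruct (Hcov N p Hp) as [q [Hq [-> | ->]]]; apply in_app_iff; [left | right];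
      apply in_map; exact Hq. }
  assert (U2 : Rbar_le l2 l1).
  { eapply (is_lim_seq_le _ (fun N => lsum f (B (2 * N + 1)%nat))); [| exact L2 |].
    - intros N.
      change (lsum (fun p => f (g p)) (B N) + lsum (fun p => f (h p)) (B N)
        <= lsum f (B (2 * N + 1)%nat))%R.
      rewrite E; apply lsum_incl; [exact Hf | |].
      + apply NoDup_app; try (apply Injective_map_NoDup; [| apply ND]);
          [exact Hg | exact Hh |].
        intros p Hp Hp'; apply in_map_iff in Hp, Hp'.
        destruct Hp as [u [<- _]], Hp' as [v [K _]]; apply (Hgh u v); auto.
      + intros p Hp; apply in_app_iff in Hp; destruct Hp as [Hp | Hp];
          apply in_map_iff in Hp; destruct Hp as [u [<- Hu]]; apply (Hin N u Hu).
    - apply (is_lim_seq_subseq (fun N => lsum f (B N)) l1 (fun N => (2 * N + 1)%nat)); [| exact L1].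
      intros P [M HM]; exists M; intros n Hn; apply HM; lia. }
  simpl in U1, U2; lra.
Qed.

(** Here and in [wpr] the exponent is nonnegative for every integer [k], so [Z.to_nat] loses
    nothing. *)
Definition wsq (x : R) (k : Z) : R := (x ^ Z.to_nat (k * k))%R.
Definition wpr (x : R) (k : Z) : R := (x ^ Z.to_nat (k * k + k))%R.

Lemma is_series_pow_gap (x : R) (e : nat -> nat) : (0 <= x < 1)%R -> (forall n, (n <= e n)%nat) ->
  is_lim_seq (sum_n (fun n => (1 * x ^ e n)%R)) (Series (fun n => (1 * x ^ e n)%R)).
Proof.
  intros Hx He; apply Series_correct.
  apply (ex_series_le (V := R_CompleteNormedModule) _ (fun n => (x ^ n)%R)).
  - intros n; unfold norm; simpl; unfold abs; simpl.
    rewrite Rmult_1_l, Rabs_pos_eq by (apply pow_le; lra); apply pow_anti; [lra | apply He].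
  - apply ex_series_pow, Hx.
Qed.

Definition rA (x : R) : R := Re (tA (RtoC x)).
Definition rpsi (x : R) : R := Re (tpsi (RtoC x)).

Lemma tA_real (x : R) : tA (RtoC x) = RtoC (rA x).
Proof.
  unfold rA, tA, tA0, tA1; rewrite !gps_real, <- RtoC_plus; reflexivity.
Qed.

Lemma tpsi_real (x : R) : tpsi (RtoC x) = RtoC (rpsi x).
Proof. unfold rpsi, tpsi; rewrite gps_real; reflexivity. Qed.

Lemma lim_wsq (x : R) : (0 <= x < 1)%R -> is_lim_seq (fun N => lsum (wsq x) (zbox N)) (rA x).
Proof.
  intros Hx.
  assert (E0 : rA x = (Series (fun n => (1 * x ^ (n * n))%R) +
    Series (fun n => (1 * x ^ (S n * S n))%R))%R).
  { unfold rA, tA, tA0, tA1; rewrite !gps_real; reflexivity. }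
  rewrite E0.
  assert (L := is_series_pow_gap x (fun n => (n * n)%nat) Hx (proj2 ok_sq)).
  assert (L' := is_series_pow_gap x (fun n => (S n * S n)%nat) Hx (proj2 ok_Ssq)).
  apply is_lim_seq_incr_1 in L.
  assert (P := is_lim_seq_plus' _ _ _ _ L L').
  apply is_lim_seq_incr_1; revert P; apply is_lim_seq_ext; intros N.
  induction N as [| N IH].
  - rewrite !sum_Sn, !sum_O; unfold plus; simpl; unfold wsq; simpl; ring.
  - change (zbox (S (S N))) with (Z.of_nat (S (S N)) :: (- Z.of_nat (S (S N)))%Z :: zbox (S N)).
    change (lsum (wsq x) (Z.of_nat (S (S N)) :: (- Z.of_nat (S (S N)))%Z :: zbox (S N))) with
      (wsq x (Z.of_nat (S (S N))) + (wsq x (- Z.of_nat (S (S N))) + lsum (wsq x) (zbox (S N))))%R.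
    rewrite <- IH; unfold wsq.
    replace (Z.to_nat (Z.of_nat (S (S N)) * Z.of_nat (S (S N)))) with (S (S N) * S (S N))%nat by lia.
    replace (Z.to_nat (- Z.of_nat (S (S N)) * - Z.of_nat (S (S N)))) with (S (S N) * S (S N))%nat by lia.
    rewrite !sum_Sn; unfold plus; cbn -[pow Nat.mul Nat.add sum_n]; ring.
Qed.

(** [k] and [- k - 1] have the same exponent, whence the factor 2. In a symmetric box the negative
    half lags one index behind, so a partial sum is added to the next one. *)
Lemma lim_wpr (x : R) : (0 <= x < 1)%R -> is_lim_seq (fun N => lsum (wpr x) (zbox N)) (2 * rpsi x)%R.
Proof.
  intros Hx.
  assert (E0 : rpsi x = Series (fun n => (1 * x ^ (n * n + n))%R)).
  { unfold rpsi, tpsi; rewrite gps_real; reflexivity. }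
  rewrite E0.
  assert (L := is_series_pow_gap x (fun n => (n * n + n)%nat) Hx (proj2 ok_pronic)).
  assert (L' := L); apply is_lim_seq_incr_1 in L.
  assert (P := is_lim_seq_plus' _ _ _ _ L L').
  replace (2 * Series (fun n => (1 * x ^ (n * n + n))%R))%R with
    (Series (fun n => (1 * x ^ (n * n + n))%R) + Series (fun n => (1 * x ^ (n * n + n))%R))%R by ring.
  apply is_lim_seq_incr_1; revert P; apply is_lim_seq_ext; intros N.
  induction N as [| N IH].
  - rewrite !sum_Sn, !sum_O; unfold plus; simpl; unfold wpr; simpl; ring.
  - change (zbox (S (S N))) with (Z.of_nat (S (S N)) :: (- Z.of_nat (S (S N)))%Z :: zbox (S N)).
    change (lsum (wpr x) (Z.of_nat (S (S N)) :: (- Z.of_nat (S (S N)))%Z :: zbox (S N))) with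
      (wpr x (Z.of_nat (S (S N))) + (wpr x (- Z.of_nat (S (S N))) + lsum (wpr x) (zbox (S N))))%R.
    rewrite <- IH; unfold wpr.
    replace (Z.to_nat (Z.of_nat (S (S N)) * Z.of_nat (S (S N)) + Z.of_nat (S (S N))))
      with (S (S N) * S (S N) + S (S N))%nat by lia.
    replace (Z.to_nat (- Z.of_nat (S (S N)) * - Z.of_nat (S (S N)) + - Z.of_nat (S (S N))))
      with (S N * S N + S N)%nat by lia.
    rewrite !sum_Sn; unfold plus; cbn -[pow Nat.mul Nat.add sum_n]; ring.
Qed.

Lemma pronic_nonneg (k : Z) : (0 <= k * k + k)%Z.
Proof. nia. Qed.

Lemma pow_mult_eq (x : R) (a b c d : Z) (e : nat) :
  (0 <= a)%Z -> (0 <= b)%Z -> (0 <= c)%Z -> (0 <= d)%Z ->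
  (a + b = Z.of_nat e + 2 * c + 2 * d)%Z ->
  (x ^ Z.to_nat a * x ^ Z.to_nat b = x ^ e * ((x ^ 2) ^ Z.to_nat c * (x ^ 2) ^ Z.to_nat d))%R.
Proof.
  intros; rewrite <- !pow_mult, <- !pow_add; f_equal; lia.
Qed.

(** The square is a sum over pairs, split by the parity of their sum: [(u + v, u - v)] has exponent
    [2 u^2 + 2 v^2], and [(u + v + 1, u - v)] has exponent [1 + 2 (u^2 + u) + 2 (v^2 + v)]. *)
Lemma rA_double (x : R) : (0 <= x < 1)%R ->
  (rA x ^ 2 = rA (x ^ 2) ^ 2 + 4 * x * rpsi (x ^ 2) ^ 2)%R.
Proof.
  intros Hx.
  assert (Hx2 : (0 <= x ^ 2 < 1)%R) by nra.
  apply (lattice_split (fun p => (wsq x (fst p) * wsq x (snd p))%R)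
    (fun p => (fst p + snd p, fst p - snd p)%Z) (fun p => (fst p + snd p + 1, fst p - snd p)%Z)).
  - intros p; apply Rmult_le_pos; apply pow_le; lra.
  - intros [u v] [u' v'] E; injection E; simpl; intros; f_equal; lia.
  - intros [u v] [u' v'] E; injection E; simpl; intros; f_equal; lia.
  - intros [u v] [u' v'] E; injection E; simpl; intros; lia.
  - intros N [u v] H; rewrite !in_prod_iff, !in_zbox in *; simpl; lia.
  - intros N [m n] H; rewrite in_prod_iff, !in_zbox in H.
    destruct (Z.Even_or_Odd (m + n)) as [[u Hu] | [u Hu]].
    + exists (u, m - u)%Z; rewrite in_prod_iff, !in_zbox; split; [lia | left; simpl; f_equal; lia].
    + exists (u, m - u - 1)%Z; rewrite in_prod_iff, !in_zbox; split; [lia | right; simpl; f_equal; lia].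
  - apply (is_lim_seq_ext (fun N => (lsum (wsq x) (zbox N) * lsum (wsq x) (zbox N))%R));
      [intros N; symmetry; apply lsum_prod |].
    replace (rA x ^ 2)%R with (rA x * rA x)%R by ring.
    apply is_lim_seq_mult'; apply lim_wsq, Hx.
  - apply (is_lim_seq_ext (fun N => (lsum (wsq (x ^ 2)) (zbox N) * lsum (wsq (x ^ 2)) (zbox N) +
      x * (lsum (wpr (x ^ 2)) (zbox N) * lsum (wpr (x ^ 2)) (zbox N)))%R)).
    + intros N; rewrite <- !lsum_prod, <- lsum_scal; f_equal; apply lsum_ext; intros [u v]; simpl fst;
        simpl snd; symmetry; unfold wsq, wpr.
      * rewrite (pow_mult_eq x _ _ (u * u) (v * v) 0) by first [apply Z.square_nonneg | apply pronic_nonneg | lia]; simpl; ring.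
      * rewrite (pow_mult_eq x _ _ (u * u + u) (v * v + v) 1) by first [apply Z.square_nonneg | apply pronic_nonneg | lia]; simpl; ring.
    + replace (rA (x ^ 2) ^ 2 + 4 * x * rpsi (x ^ 2) ^ 2)%R with
        (rA (x ^ 2) * rA (x ^ 2) + x * ((2 * rpsi (x ^ 2)) * (2 * rpsi (x ^ 2))))%R by ring.
      apply is_lim_seq_plus'; [| apply is_lim_seq_mult'; [apply is_lim_seq_const |]].
      * apply is_lim_seq_mult'; apply lim_wsq, Hx2.
      * apply is_lim_seq_mult'; apply lim_wpr, Hx2.
Qed.

(** The same splitting; the odd pairs are parametrised so that, by the symmetry [k -> - k - 1], both
    parities have the exponent [2 (u^2 + u) + 2 v^2]. *)
Lemma rpsi_double (x : R) : (0 <= x < 1)%R -> (rpsi x ^ 2 = rA (x ^ 2) * rpsi (x ^ 2))%R.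
Proof.
  intros Hx.
  assert (Hx2 : (0 <= x ^ 2 < 1)%R) by nra.
  assert (E : ((2 * rpsi x) * (2 * rpsi x) =
    (2 * rpsi (x ^ 2)) * rA (x ^ 2) + (2 * rpsi (x ^ 2)) * rA (x ^ 2))%R); [| lra].
  apply (lattice_split (fun p => (wpr x (fst p) * wpr x (snd p))%R)
    (fun p => (fst p + snd p, fst p - snd p)%Z) (fun p => (fst p + snd p, snd p - fst p - 1)%Z)).
  - intros p; apply Rmult_le_pos; apply pow_le; lra.
  - intros [u v] [u' v'] E; injection E; simpl; intros; f_equal; lia.
  - intros [u v] [u' v'] E; injection E; simpl; intros; f_equal; lia.
  - intros [u v] [u' v'] E; injection E; simpl; intros; lia.
  - intros N [u v] H; rewrite !in_prod_iff, !in_zbox in *; simpl; lia.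
  - intros N [m n] H; rewrite in_prod_iff, !in_zbox in H.
    destruct (Z.Even_or_Odd (m + n)) as [[u Hu] | [u Hu]].
    + exists (u, m - u)%Z; rewrite in_prod_iff, !in_zbox; split; [lia | left; simpl; f_equal; lia].
    + exists (m - u - 1, u + 1)%Z; rewrite in_prod_iff, !in_zbox.
      split; [lia | right; simpl; f_equal; lia].
  - apply (is_lim_seq_ext (fun N => (lsum (wpr x) (zbox N) * lsum (wpr x) (zbox N))%R));
      [intros N; symmetry; apply lsum_prod |].
    apply is_lim_seq_mult'; apply lim_wpr, Hx.
  - apply (is_lim_seq_ext (fun N => (lsum (wpr (x ^ 2)) (zbox N) * lsum (wsq (x ^ 2)) (zbox N) +
      lsum (wpr (x ^ 2)) (zbox N) * lsum (wsq (x ^ 2)) (zbox N))%R)).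
    + intros N; rewrite <- !lsum_prod; f_equal; apply lsum_ext; intros [u v]; simpl fst;
        simpl snd; symmetry; unfold wsq, wpr;
        rewrite (pow_mult_eq x _ _ (u * u + u) (v * v) 0) by first [apply Z.square_nonneg | apply pronic_nonneg | lia]; simpl; ring.
    + assert (L := is_lim_seq_mult' _ _ _ _ (lim_wpr (x ^ 2) Hx2) (lim_wsq (x ^ 2) Hx2)).
      apply is_lim_seq_plus'; exact L.
Qed.

(** * Duplication formulas on the complex disc *)

Lemma disc_identity (f g : C -> C) :
  (forall q, (Cmod q < 1)%R -> holo f q) -> (forall q, (Cmod q < 1)%R -> holo g q) ->
  (forall x, (0 <= x < 1)%R -> f (RtoC x) = g (RtoC x)) ->
  forall q, (Cmod q < 1)%R -> f q = g q.
Proof.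
  intros Hf Hg H q Hq.
  assert (E : f q - g q = 0).
  { apply (disc_zero (fun w => f w - g w) 0 1).
    - intros w Hw; replace (w - 0) with w in Hw by ring; apply holo_minus; auto.
    - intros d Hd.
      assert (P : (0 < Rmin d 1)%R) by (apply Rmin_pos; lra).
      assert (A := Rmin_l d 1); assert (B := Rmin_r d 1).
      exists (RtoC (Rmin d 1 / 2)); split.
      + replace (RtoC (Rmin d 1 / 2) - 0) with (RtoC (Rmin d 1 / 2)) by ring.
        rewrite Cmod_R, Rabs_pos_eq; lra.
      + rewrite H by lra; ring.
    - replace (q - 0) with q by ring; exact Hq. }
  rewrite <- (Cplus_0_l (g q)), <- E; ring.
Qed.

Lemma holo_sqr_arg (f : C -> C) (q : C) : (Cmod q < 1)%R ->
  (forall w, (Cmod w < 1)%R -> holo f w) -> holo (fun q => f (q * q)) q.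
Proof.
  intros Hq Hf; apply (holo_comp (fun q => q * q) f); [apply holo_mult; apply holo_id |].
  apply Hf, Cmod_sqr_lt1, Hq.
Qed.

Lemma tA_double (q : C) : (Cmod q < 1)%R ->
  tA q * tA q = tA (q * q) * tA (q * q) + 4 * q * (tpsi (q * q) * tpsi (q * q)).
Proof.
  revert q; apply disc_identity.
  - intros q Hq; apply holo_mult; apply holo_tA, Hq.
  - intros q Hq; apply holo_plus.
    + apply holo_mult; apply (holo_sqr_arg tA q Hq holo_tA).
    + apply holo_mult; [apply holo_mult; [apply holo_const | apply holo_id] |].
      apply holo_mult; apply (holo_sqr_arg tpsi q Hq holo_tpsi).
  - intros x Hx; assert (E := rA_double x Hx).
    rewrite <- RtoC_mult, !tA_real, !tpsi_real, <- !RtoC_mult, <- RtoC_plus; f_equal.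
    replace (x * x)%R with (x ^ 2)%R by ring; lra.
Qed.

Lemma tpsi_double (q : C) : (Cmod q < 1)%R -> tpsi q * tpsi q = tA (q * q) * tpsi (q * q).
Proof.
  revert q; apply disc_identity.
  - intros q Hq; apply holo_mult; apply holo_tpsi, Hq.
  - intros q Hq; apply holo_mult;
      [apply (holo_sqr_arg tA q Hq holo_tA) | apply (holo_sqr_arg tpsi q Hq holo_tpsi)].
  - intros x Hx; assert (E := rpsi_double x Hx).
    rewrite <- RtoC_mult, !tA_real, !tpsi_real, <- !RtoC_mult; f_equal.
    replace (x * x)%R with (x ^ 2)%R by ring; lra.
Qed.

Lemma tA_double_opp (q : C) : (Cmod q < 1)%R ->
  tA (- q) * tA (- q) = tA (q * q) * tA (q * q) - 4 * q * (tpsi (q * q) * tpsi (q * q)).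
Proof.
  intros Hq; rewrite tA_double by (rewrite Cmod_opp; exact Hq).
  replace (- q * - q) with (q * q) by ring; ring.
Qed.

(** With [a = tA(q^2)^2] and [b = 4 q tpsi(q^2)^2] the duplication formulas at [q] and [- q] give
    [(a + b)^2 - (a - b)^2 = 4 a b], which is [16 q tpsi(q)^4] by [tpsi_double]. *)
Lemma Jacobi_quartic (q : C) : (Cmod q < 1)%R ->
  tA q ^ 4 = tA (- q) ^ 4 + 16 * q * tpsi q ^ 4.
Proof.
  intros Hq.
  replace (tA q ^ 4) with ((tA q * tA q) * (tA q * tA q)) by ring.
  replace (tA (- q) ^ 4) with ((tA (- q) * tA (- q)) * (tA (- q) * tA (- q))) by ring.
  replace (tpsi q ^ 4) with ((tpsi q * tpsi q) * (tpsi q * tpsi q)) by ring.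
  rewrite (tA_double q), (tA_double_opp q), (tpsi_double q) by exact Hq; ring.
Qed.

(** This is [(a + b) (a - b)] for the same [a] and [b], simplified by [Jacobi_quartic] at [q * q].
    It involves [tA] alone and so transports its zeros. *)
Lemma tA_product (q : C) : (Cmod q < 1)%R ->
  (tA q * tA q) * (tA (- q) * tA (- q)) = tA (- (q * q)) ^ 4.
Proof.
  intros Hq; assert (J := Jacobi_quartic (q * q) (Cmod_sqr_lt1 q Hq)).
  replace (tA (- (q * q)) ^ 4) with (tA (q * q) ^ 4 - 16 * (q * q) * tpsi (q * q) ^ 4)
    by (rewrite J; ring).
  rewrite (tA_double q), (tA_double_opp q) by exact Hq; ring.
Qed.

(** * Nonvanishing by iterated squaring, and the lambda function *)

Fixpoint sqrn (n : nat) (q : C) : C :=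
  match n with O => q | S m => sqrn m q * sqrn m q end.

Lemma Cmod_sqrn_lt1 (n : nat) (q : C) : (Cmod q < 1)%R -> (Cmod (sqrn n q) < 1)%R.
Proof. intros H; induction n as [| n IH]; simpl; [exact H | apply Cmod_sqr_lt1, IH]. Qed.

Lemma Cmod_sqrn_le (n : nat) (q : C) : (Cmod q < 1)%R -> (Cmod (sqrn n q) <= Cmod q ^ S n)%R.
Proof.
  intros H; assert (P := Cmod_ge_0 q); induction n as [| n IH]; simpl; [lra |].
  rewrite Cmod_mult; assert (Q := Cmod_ge_0 (sqrn n q)).
  assert (R : (Cmod (sqrn n q) <= Cmod q)%R).
  { clear IH; induction n as [| n IH]; simpl; [lra |].
    rewrite Cmod_mult; assert (T := Cmod_sqrn_lt1 n q H); assert (T' := Cmod_ge_0 (sqrn n q)).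
    specialize (IH T'); nra. }
  simpl in IH; assert (0 <= Cmod q ^ n)%R by (apply pow_le; lra).
  apply Rmult_le_compat; assumption.
Qed.

Lemma sqrn_small (q : C) (e : R) : (Cmod q < 1)%R -> (0 < e)%R ->
  exists N, forall n, (N <= n)%nat -> (Cmod (sqrn n q) < e)%R.
Proof.
  intros Hq He; destruct (pow_lt_eps (Cmod q) e (conj (Cmod_ge_0 q) Hq) He) as [N HN].
  exists N; intros n Hn; eapply Rle_lt_trans; [apply Cmod_sqrn_le, Hq | apply HN; lia].
Qed.

Lemma Cmult_integral_l (a b : C) : a * b = 0 -> a <> 0 -> b = 0.
Proof.
  intros H N; apply NNPP; intros K; exact (Cmult_neq_0 a b N K H).
Qed.

Lemma Cinv_neq0 (a : C) : a <> 0 -> / a <> 0.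
Proof.
  intros N K; assert (E := Cinv_r a N); rewrite K, Cmult_0_r in E.
  apply RtoC_inj in E; lra.
Qed.

Lemma Cpow4_eq_0 (a : C) : a ^ 4 = 0 -> a = 0.
Proof. intros H; apply NNPP; intros N; exact (Cpow_nz a 4 N H). Qed.

(** By [tA_product] a zero at [q] yields zeros at [- q^2], [- q^4], [- q^8], and so on; these tend
    to 0, where [tA] is 1. *)
Lemma tA_neq0 (q : C) : (Cmod q < 1)%R -> tA q <> 0.
Proof.
  intros Hq H.
  assert (Z : forall n, tA (- sqrn (S n) q) = 0).
  { induction n as [| n IH].
    - apply Cpow4_eq_0; simpl sqrn; rewrite <- tA_product, H by exact Hq; ring.
    - apply Cpow4_eq_0; change (sqrn (S (S n)) q) with (sqrn (S n) q * sqrn (S n) q).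
      rewrite <- tA_product, IH by (apply Cmod_sqrn_lt1, Hq); ring. }
  assert (H0 : (Cmod 0 < 1)%R) by (rewrite Cmod_0; lra).
  destruct (ccont_neq0 tA 0 (holo_cont _ _ (holo_tA 0 H0))) as [d [Hd K]].
  { rewrite tA_0; intros E; apply RtoC_inj in E; lra. }
  destruct (sqrn_small q d Hq Hd) as [N HN].
  apply (K (- sqrn (S N) q)); [| apply Z].
  replace (- sqrn (S N) q - 0) with (- sqrn (S N) q) by ring; rewrite Cmod_opp; apply HN; lia.
Qed.

(** Now [tpsi_double] transports zeros, its other factor being nonzero by [tA_neq0]. *)
Lemma tpsi_neq0 (q : C) : (Cmod q < 1)%R -> tpsi q <> 0.
Proof.
  intros Hq H.
  assert (Z : forall n, tpsi (sqrn n q) = 0).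
  { induction n as [| n IH]; [exact H |].
    assert (L := Cmod_sqrn_lt1 n q Hq).
    assert (E := tpsi_double _ L); rewrite IH in E.
    apply (Cmult_integral_l (tA (sqrn n q * sqrn n q)));
      [change (sqrn (S n) q) with (sqrn n q * sqrn n q); rewrite <- E; ring |].
    apply tA_neq0, Cmod_sqr_lt1, L. }
  assert (H0 : (Cmod 0 < 1)%R) by (rewrite Cmod_0; lra).
  destruct (ccont_neq0 tpsi 0 (holo_cont _ _ (holo_tpsi 0 H0))) as [d [Hd K]].
  { rewrite tpsi_0; intros E; apply RtoC_inj in E; lra. }
  destruct (sqrn_small q d Hq Hd) as [N HN].
  apply (K (sqrn N q)); [| apply Z].
  replace (sqrn N q - 0) with (sqrn N q) by ring; apply HN; lia.
Qed.

(** The modular lambda function in the variable [q]: the fourth power has removed the root [q^(1/4)]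
    of theta10. *)
Definition lam (q : C) : C := 16 * q * tpsi q ^ 4 / tA q ^ 4.

Lemma Cmod_opp_lt1 (q : C) : (Cmod q < 1)%R -> (Cmod (- q) < 1)%R.
Proof. rewrite Cmod_opp; auto. Qed.

Lemma one_minus_lam (q : C) : (Cmod q < 1)%R -> 1 - lam q = tA (- q) ^ 4 / tA q ^ 4.
Proof.
  intros Hq; assert (N := Cpow_nz _ 4 (tA_neq0 q Hq)).
  assert (J := Jacobi_quartic q Hq); unfold lam.
  replace (tA (- q) ^ 4) with (tA q ^ 4 - 16 * q * tpsi q ^ 4) by (rewrite J; ring).
  field; exact (tA_neq0 q Hq).
Qed.

Lemma one_minus_lam_neq0 (q : C) : (Cmod q < 1)%R -> 1 - lam q <> 0.
Proof.
  intros Hq; rewrite one_minus_lam by exact Hq.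
  apply Cmult_neq_0; [apply Cpow_nz, tA_neq0, Cmod_opp_lt1, Hq |].
  apply Cinv_neq0, Cpow_nz, tA_neq0, Hq.
Qed.

(** In terms of [tau] this is the behaviour of lambda under [tau -> tau + 1], which changes the sign
    of the nome. *)
Lemma lam_opp (q : C) : (Cmod q < 1)%R -> lam (- q) = - (lam q / (1 - lam q)).
Proof.
  intros Hq; assert (N := tA_neq0 q Hq).
  assert (N' := tA_neq0 (- q) (Cmod_opp_lt1 q Hq)).
  rewrite one_minus_lam by exact Hq; unfold lam; rewrite tpsi_opp by exact Hq.
  field; auto.
Qed.

Lemma holo_lam (q : C) : (Cmod q < 1)%R -> holo lam q.
Proof.
  intros Hq; apply holo_div; [| apply holo_pow, holo_tA, Hq | apply Cpow_nz, tA_neq0, Hq].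
  apply holo_mult; [apply holo_mult; [apply holo_const | apply holo_id] |].
  apply holo_pow, holo_tpsi, Hq.
Qed.

Lemma lam_conj (q : C) : (Cmod q < 1)%R -> lam (Cconj q) = Cconj (lam q).
Proof.
  intros Hq; unfold lam; rewrite tA_conj, tpsi_conj.
  rewrite Cdiv_conj by (apply Cpow_nz, tA_neq0, Hq).
  rewrite !Cmult_conj, !Cconj_pow; repeat f_equal.
  apply injective_projections; simpl; ring.
Qed.

Lemma lam_0 : lam 0 = 0.
Proof. unfold lam; rewrite tA_0; field. Qed.

(** * The nome *)

Lemma Cexp_plus (z w : C) : Cexp (z + w) = Cexp z * Cexp w.
Proof.
  unfold Cexp, Re, Im; simpl; rewrite exp_plus, cos_plus, sin_plus.
  apply injective_projections; simpl; ring.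
Qed.

Lemma Cexp_0 : Cexp 0 = 1.
Proof.
  unfold Cexp, Re, Im; simpl; rewrite exp_0, cos_0, sin_0.
  apply injective_projections; simpl; ring.
Qed.

Lemma Cexp_pow (n : nat) (z : C) : Cexp (RtoC (INR n) * z) = Cexp z ^ n.
Proof.
  induction n as [| n IH]; [rewrite Cmult_0_l; apply Cexp_0 |].
  rewrite S_INR, RtoC_plus; simpl; rewrite <- IH, <- Cexp_plus; f_equal; ring.
Qed.

Lemma Cexp_2PI (n : nat) (z : C) : Cexp (z + RtoC (INR n) * (2 * PI * Ci)) = Cexp z.
Proof.
  rewrite Cexp_plus, Cexp_pow.
  replace (Cexp (2 * PI * Ci)) with (RtoC 1).
  - rewrite <- RtoC_pow, pow1; ring.
  - replace (2 * PI * Ci) with ((0, 2 * PI)%R : C) by (apply injective_projections; simpl; ring).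
    unfold Cexp; simpl; rewrite exp_0, cos_2PI, sin_2PI; apply injective_projections; simpl; ring.
Qed.

Lemma Cmod_Cexp (z : C) : Cmod (Cexp z) = exp (Re z).
Proof.
  unfold Cexp; rewrite Cmod_mult, Cmod_R, Rabs_pos_eq by (left; apply exp_pos).
  replace (cos (Im z), sin (Im z)) with (cis 1 (Im z))
    by (unfold cis; rewrite !Rmult_1_l; reflexivity).
  rewrite Cmod_cis by lra; ring.
Qed.

Lemma derivable_pt_lim_o (f : R -> R) (l e : R) : derivable_pt_lim f 0 l -> (0 < e)%R ->
  exists d, (0 < d)%R /\ forall x, (Rabs x < d)%R -> (Rabs (f x - f 0 - l * x) <= e * Rabs x)%R.
Proof.
  intros H He; destruct (H e He) as [d Hd]; exists (pos d); split; [apply cond_pos |]; intros x Hx.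
  destruct (Req_dec x 0) as [-> | N].
  - replace (f 0 - f 0 - l * 0)%R with 0%R by ring; rewrite Rabs_R0; lra.
  - specialize (Hd x N Hx); rewrite Rplus_0_l in Hd.
    replace (f x - f 0 - l * x)%R with (((f x - f 0) / x - l) * x)%R by (field; exact N).
    rewrite Rabs_mult; apply Rmult_le_compat_r; [apply Rabs_pos | lra].
Qed.

(** The functional equation reduces the claim to the derivative at 0, where [exp], [cos] and [sin]
    are expanded to first order. *)
Lemma holo_Cexp (z : C) : holo Cexp z.
Proof.
  assert (D0 : cderiv Cexp 0 1).
  { intros e He.
    (* The contributions below add up to at most [6 * e' * Cmod w]. *)
    set (e' := Rmin 1 (e / 7)).
    assert (He' : (0 < e')%R) by (apply Rmin_pos; lra).
    assert (L1 : (e' <= 1)%R) by apply Rmin_l; assert (L2 : (e' <= e / 7)%R) by apply Rmin_r.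
    destruct (derivable_pt_lim_o exp 1 e' derivable_pt_lim_exp_0 He') as [d1 [Hd1 K1]].
    assert (Dc : derivable_pt_lim cos 0 0).
    { replace 0%R with (- sin 0)%R at 2 by (rewrite sin_0; ring); apply derivable_pt_lim_cos. }
    assert (Ds : derivable_pt_lim sin 0 1).
    { replace 1%R with (cos 0)%R by apply cos_0; apply derivable_pt_lim_sin. }
    destruct (derivable_pt_lim_o cos 0 e' Dc He') as [d2 [Hd2 K2]].
    destruct (derivable_pt_lim_o sin 1 e' Ds He') as [d3 [Hd3 K3]].
    exists (Rmin (Rmin d1 e') (Rmin d2 d3)); split; [apply Rmin_pos; apply Rmin_pos; assumption |].
    intros w Hw; replace (w - 0) with w in * by ring; rewrite Cexp_0.
    assert (M1 := Rlt_le_trans _ _ _ Hw (Rmin_l _ _)).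
    assert (M2 := Rlt_le_trans _ _ _ Hw (Rmin_r _ _)).
    assert (M3 := Rlt_le_trans _ _ _ M1 (Rmin_l _ _)).
    assert (M4 := Rlt_le_trans _ _ _ M1 (Rmin_r _ _)).
    assert (M5 := Rlt_le_trans _ _ _ M2 (Rmin_l _ _)).
    assert (M6 := Rlt_le_trans _ _ _ M2 (Rmin_r _ _)).
    assert (Hx := re_le_Cmod w); assert (Hy := im_le_Cmod w).
    set (x := Re w) in *; set (y := Im w) in *; set (r := Cmod w) in *.
    specialize (K1 x ltac:(lra)); specialize (K2 y ltac:(lra)); specialize (K3 y ltac:(lra)).
    rewrite exp_0 in K1; rewrite cos_0 in K2; rewrite sin_0 in K3.
    assert (Px := Rabs_pos x); assert (Py := Rabs_pos y).
    set (c := (cos y, sin y) : C).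
    assert (Ec : Cmod c = 1%R).
    { replace c with (cis 1 y) by (unfold c, cis; rewrite !Rmult_1_l; reflexivity).
      apply Cmod_cis; lra. }
    replace (Cexp w - 1 - 1 * w) with (RtoC (exp x - 1 - 1 * x) * c +
      (RtoC (1 + x) * ((cos y - 1 - 0 * y)%R, (sin y - 0 - 1 * y)%R) + RtoC x * (Ci * RtoC y))).
    2: { unfold Cexp, c; fold x; fold y; rewrite (surjective_pairing w).
      change (fst w) with x; change (snd w) with y.
      apply injective_projections; simpl; ring. }
    eapply Rle_trans; [apply Cmod_triangle |].
    eapply Rle_trans; [apply Rplus_le_compat_l, Cmod_triangle |].
    rewrite !Cmod_mult, !Cmod_R, Cmod_Ci, Ec.
    assert (A2 : (Cmod ((cos y - 1 - 0 * y)%R, (sin y - 0 - 1 * y)%R) <= 2 * e' * r)%R).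
    { eapply Rle_trans; [apply Cmod_le_Re_Im |]; simpl; nra. }
    assert (A1 : (Rabs (1 + x) <= 2)%R).
    { eapply Rle_trans; [apply Rabs_triang |]; rewrite Rabs_R1; lra. }
    assert (A3 : (Rabs x * (1 * Rabs y) <= e' * r)%R) by nra.
    assert (A4 : (Rabs (exp x - 1 - 1 * x) * 1 <= e' * r)%R) by nra.
    assert (A5 := Cmod_ge_0 ((cos y - 1 - 0 * y)%R, (sin y - 0 - 1 * y)%R)).
    assert (A6 := Rabs_pos (1 + x)).
    assert (A7 : (Rabs (1 + x) * Cmod ((cos y - 1 - 0 * y)%R, (sin y - 0 - 1 * y)%R)
      <= 2 * (2 * e' * r))%R) by (apply Rmult_le_compat; assumption).
    assert (0 <= r)%R by lra.
    apply (Rle_trans _ (6 * e' * r)%R); nra. }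
  apply (holo_ext_near (fun w => Cexp z * Cexp (w - z))).
  - exists 1%R; split; [lra |]; intros w _; rewrite <- Cexp_plus; f_equal; ring.
  - apply holo_mult; [apply holo_const |].
    apply (holo_comp (fun w => w - z) Cexp); [apply holo_minus; [apply holo_id | apply holo_const] |].
    replace (z - z) with (RtoC 0) by ring; exists 1; exact D0.
Qed.

Definition nome (tau : C) : C := Cexp (PI * Ci * tau).

Lemma Cmod_nome (tau : C) : Cmod (nome tau) = exp (- (PI * Im tau)).
Proof.
  unfold nome; rewrite Cmod_Cexp; f_equal; unfold Re, Im; simpl; ring.
Qed.

Lemma nome_lt1 (tau : C) : (0 < Im tau)%R -> (Cmod (nome tau) < 1)%R.
Proof.
  intros H; rewrite Cmod_nome, <- exp_0; apply exp_increasing.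
  assert (P := PI_RGT_0); nra.
Qed.

Lemma holo_nome (tau : C) : holo nome tau.
Proof.
  apply (holo_comp (fun t => PI * Ci * t) Cexp); [| apply holo_Cexp].
  apply holo_mult; [apply holo_const | apply holo_id].
Qed.

Lemma nome_neq0 (tau : C) : nome tau <> 0.
Proof. apply Cmod_gt_0; rewrite Cmod_nome; apply exp_pos. Qed.

Lemma Cexp_PI_Ci : Cexp (PI * Ci) = - (1).
Proof.
  replace (PI * Ci) with ((0, PI)%R : C) by (apply injective_projections; simpl; ring).
  unfold Cexp; simpl; rewrite exp_0, cos_PI, sin_PI; apply injective_projections; simpl; ring.
Qed.

Lemma nome_plus1 (tau : C) : nome (tau + 1) = - nome tau.
Proof.
  unfold nome; replace (PI * Ci * (tau + 1)) with (PI * Ci * tau + PI * Ci) by ring.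
  rewrite Cexp_plus, Cexp_PI_Ci; ring.
Qed.

Lemma nome_conj (tau : C) : nome (- Cconj tau) = Cconj (nome tau).
Proof.
  assert (E : forall x y : R, Cexp (PI * Ci * ((x, y) : C)) = RtoC (exp (- (PI * y))) * cis 1 (PI * x)).
  { intros x y; replace (PI * Ci * ((x, y) : C)) with ((- (PI * y), PI * x)%R : C)
      by (apply injective_projections; simpl; ring).
    unfold Cexp, cis; simpl; rewrite !Rmult_1_l; reflexivity. }
  unfold nome; destruct tau as [x y].
  replace (- Cconj (x, y)) with ((- x, y)%R : C) by (apply injective_projections; simpl; ring).
  rewrite !E; unfold cis; rewrite Ropp_mult_distr_r_reverse, cos_neg, sin_neg.
  apply injective_projections; simpl; ring.
Qed.

Lemma nome_imag (y : R) : nome (RtoC y * Ci) = RtoC (exp (- (PI * y))).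
Proof.
  unfold nome; replace (PI * Ci * (RtoC y * Ci)) with (RtoC (- (PI * y))).
  - unfold Cexp; simpl; rewrite cos_0, sin_0; apply injective_projections; simpl; ring.
  - rewrite RtoC_opp, RtoC_mult; apply injective_projections; simpl; ring.
Qed.

(** * Theta constants as power series in the nome *)

Lemma Csum_eq (a : nat -> C) (l : C) : csum_to a l -> Csum a = l.
Proof.
  intros H; apply is_series_csum_to in H.
  apply (iota_filterlim_locally (K := C_AbsRing) (V := C_CompleteNormedModule)
    (sum_n (G := AbelianGroup.AbelianMonoid C_AbelianGroup) a) l H).
Qed.

Lemma CsumZ_gps (a : Z -> C) (c q : C) (e1 e2 : nat -> nat) : (Cmod q < 1)%R ->
  gps_ok (fun _ => 1%R) e1 -> gps_ok (fun _ => 1%R) e2 ->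
  (forall n, a (Z.of_nat n) = c * q ^ e1 n) ->
  (forall n, a (- Z.of_nat (S n))%Z = c * q ^ e2 n) ->
  CsumZ a = c * (gps (fun _ => 1%R) e1 q + gps (fun _ => 1%R) e2 q).
Proof.
  intros Hq O1 O2 H1 H2; unfold CsumZ.
  rewrite (Csum_eq _ (c * gps (fun _ => 1%R) e1 q)), (Csum_eq _ (c * gps (fun _ => 1%R) e2 q));
    [ring | |].
  - apply (csum_to_ext (fun n => c * (RtoC 1 * q ^ e2 n))); [intros n; rewrite H2; ring |].
    apply csum_to_scal; exact (gps_correct (fun _ => 1%R) e2 q O2 Hq).
  - apply (csum_to_ext (fun n => c * (RtoC 1 * q ^ e1 n))); [intros n; rewrite H1; ring |].
    apply csum_to_scal; exact (gps_correct (fun _ => 1%R) e1 q O1 Hq).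
Qed.

Lemma IZR_opp_S (n : nat) : IZR (- Z.of_nat (S n)) = (- (INR n + 1))%R.
Proof. rewrite opp_IZR, <- INR_IZR_INZ, S_INR; reflexivity. Qed.

Lemma theta00_eq (tau : C) : (0 < Im tau)%R -> theta 0 0 tau = tA (nome tau).
Proof.
  intros H; unfold theta.
  rewrite (CsumZ_gps _ 1 (nome tau) (fun n => (n * n)%nat) (fun n => (S n * S n)%nat)
    (nome_lt1 tau H) ok_sq ok_Ssq); [unfold tA, tA0, tA1; ring | |].
  - intros n; unfold nome; rewrite <- INR_IZR_INZ, <- Cexp_pow, mult_INR, Cmult_1_l; f_equal.
    simpl INR; unfold Rdiv; rewrite Rmult_0_l, Rplus_0_r, RtoC_mult; simpl; ring.
  - intros n; unfold nome; rewrite IZR_opp_S, <- Cexp_pow, mult_INR, S_INR, Cmult_1_l; f_equal.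
    change (INR 0) with 0%R; unfold Rdiv.
    rewrite Rmult_0_l, Rplus_0_r, RtoC_mult, RtoC_opp, RtoC_plus; simpl; ring.
Qed.

Lemma theta01_eq (tau : C) : (0 < Im tau)%R -> theta 0 1 tau = tA (- nome tau).
Proof.
  intros H; unfold theta.
  rewrite (CsumZ_gps _ 1 (- nome tau) (fun n => (n * n)%nat) (fun n => (S n * S n)%nat)
    (Cmod_opp_lt1 _ (nome_lt1 tau H)) ok_sq ok_Ssq); [unfold tA, tA0, tA1; ring | |].
  - intros n; rewrite <- nome_plus1; unfold nome.
    rewrite <- INR_IZR_INZ, <- Cexp_pow, mult_INR, Cmult_1_l.
    (* [n * n] and [n] have the same parity, so the sign [(-1)^n] of the definition is the one of
       [(- q) ^ (n * n)]. *)
    assert (E : exists m, (n * n = n + 2 * m)%nat).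
    { induction n as [| n [m IH]]; [exists 0%nat; lia | exists (m + n)%nat; lia]. }
    destruct E as [m E]; apply (f_equal INR) in E; rewrite mult_INR, plus_INR, mult_INR in E.
    rewrite <- (Cexp_2PI m); f_equal.
    assert (E' : RtoC (INR n * INR n) = RtoC (INR n) + 2 * RtoC (INR m)).
    { rewrite E, RtoC_plus, RtoC_mult; reflexivity. }
    replace (RtoC (INR n * INR n) * (PI * Ci * (tau + 1)))
      with (RtoC (INR n * INR n) * (PI * Ci * tau) + RtoC (INR n * INR n) * (PI * Ci)) by ring.
    rewrite E' at 2; rewrite RtoC_mult.
    change (INR 0) with 0%R; change (INR 1) with 1%R; unfold Rdiv.
    rewrite Rmult_0_l, Rplus_0_r, Rmult_1_l, RtoC_inv by lra; simpl; field; apply C2_neq0.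
  - intros n; rewrite <- nome_plus1; unfold nome.
    rewrite IZR_opp_S, <- Cexp_pow, mult_INR, Cmult_1_l.
    assert (E : exists m, (S n * S n + S n = 2 * m)%nat).
    { induction n as [| n [m IH]]; [exists 1%nat; lia | exists (m + S (S n))%nat; lia]. }
    destruct E as [m E]; apply (f_equal INR) in E; rewrite plus_INR, !mult_INR, S_INR in E.
    rewrite <- (Cexp_2PI m); f_equal.
    assert (E' : RtoC (INR n + 1) * RtoC (INR n + 1) = 2 * RtoC (INR m) - RtoC (INR n + 1)).
    { rewrite <- !RtoC_mult, <- RtoC_minus; f_equal; change (INR 2) with 2%R in E; lra. }
    replace (RtoC (INR (S n) * INR (S n))) with (RtoC (INR n + 1) * RtoC (INR n + 1))
      by (rewrite S_INR, RtoC_mult; reflexivity).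
    replace (RtoC (INR n + 1) * RtoC (INR n + 1) * (PI * Ci * (tau + 1)))
      with (RtoC (INR n + 1) * RtoC (INR n + 1) * (PI * Ci * tau) +
        RtoC (INR n + 1) * RtoC (INR n + 1) * (PI * Ci)) by ring.
    rewrite E' at 2.
    change (INR 0) with 0%R; change (INR 1) with 1%R; unfold Rdiv.
    rewrite Rmult_0_l, Rplus_0_r, Rmult_1_l, RtoC_inv, RtoC_opp by lra; simpl; field; apply C2_neq0.
Qed.

(** [(n + 1/2)^2 = n^2 + n + 1/4], and the indices [n] and [- n - 1] give equal terms, whence the
    factor 2. *)
Lemma theta10_eq (tau : C) : (0 < Im tau)%R ->
  theta 1 0 tau = Cexp (PI * Ci * tau / 4) * (2 * tpsi (nome tau)).
Proof.
  intros H; unfold theta.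
  assert (N4 : RtoC 4 <> 0) by (intros E; apply RtoC_inj in E; lra).
  assert (N2 := C2_neq0).
  rewrite (CsumZ_gps _ (Cexp (PI * Ci * tau / 4)) (nome tau) (fun n => (n * n + n)%nat)
    (fun n => (n * n + n)%nat) (nome_lt1 tau H) ok_pronic ok_pronic); [unfold tpsi; ring | |].
  - intros n; unfold nome; rewrite <- INR_IZR_INZ, <- Cexp_pow, plus_INR, mult_INR, <- Cexp_plus; f_equal.
    change (INR 0) with 0%R; change (INR 1) with 1%R; unfold Rdiv.
    rewrite Rmult_0_l, Rmult_1_l, !RtoC_plus, RtoC_mult, RtoC_inv by lra; simpl.
    replace (RtoC 4) with (RtoC 2 * RtoC 2) by (rewrite <- RtoC_mult; f_equal; ring).
    field; auto.
  - intros n; unfold nome; rewrite IZR_opp_S, <- Cexp_pow, plus_INR, mult_INR, <- Cexp_plus; f_equal.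
    change (INR 0) with 0%R; change (INR 1) with 1%R; unfold Rdiv.
    rewrite Rmult_0_l, Rmult_1_l, !RtoC_plus, RtoC_opp, RtoC_mult, RtoC_inv, RtoC_plus by lra; simpl.
    replace (RtoC 4) with (RtoC 2 * RtoC 2) by (rewrite <- RtoC_mult; f_equal; ring).
    field; auto.
Qed.

Lemma theta10_pow4 (tau : C) : (0 < Im tau)%R ->
  theta 1 0 tau ^ 4 = 16 * nome tau * tpsi (nome tau) ^ 4.
Proof.
  intros H; rewrite theta10_eq by exact H.
  rewrite !Cpow_mult_l, <- Cexp_pow.
  replace (RtoC (INR 4) * (PI * Ci * tau / 4)) with (PI * Ci * tau).
  - fold (nome tau); rewrite <- RtoC_pow; replace (2 ^ 4)%R with 16%R by ring; ring.
  - replace (INR 4) with 4%R by (simpl; ring); field; intros E; apply RtoC_inj in E; lra.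
Qed.

(** * The inversion of tau *)

Open Scope R_scope.

(** * Wallis integrals and the logarithmic singularity *)

Definition Wallis (n : nat) : R := RInt (fun t => sin t ^ n) 0 (PI / 2).

Lemma continuous_sin_pow (n : nat) (t : R) : continuous (fun t => sin t ^ n) t.
Proof.
  apply (ex_derive_continuous (K := R_AbsRing) (V := R_NormedModule)); auto_derive; auto.
Qed.

Lemma ex_RInt_sin_pow (n : nat) : ex_RInt (fun t => sin t ^ n) 0 (PI / 2).
Proof.
  apply (ex_RInt_continuous (V := R_CompleteNormedModule)); intros t _; apply continuous_sin_pow.
Qed.

(** Integrates the derivative of [- cos t * sin t ^ S n], a function that vanishes at both ends. *)
Lemma Wallis_rec (n : nat) : (INR n + 2) * Wallis (S (S n)) = (INR n + 1) * Wallis n.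
Proof.
  assert (P := PI_RGT_0).
  assert (D : is_RInt (fun t => minus (scal (INR n + 2) (sin t ^ S (S n))) (scal (INR n + 1) (sin t ^ n)))
    0 (PI / 2) 0).
  { replace 0 with (minus (- cos (PI / 2) * sin (PI / 2) ^ S n) (- cos 0 * sin 0 ^ S n)) at 2.
    2: { rewrite cos_PI2, sin_0; unfold minus, plus, opp; simpl; ring. }
    apply (is_RInt_derive (V := R_CompleteNormedModule) (fun t => - cos t * sin t ^ S n)).
    - intros t _; auto_derive; [auto |].
      unfold minus, plus, opp, scal; simpl; unfold mult; simpl.
      assert (E : cos t * cos t = 1 - sin t * sin t)
        by (assert (E := sin2_cos2 t); unfold Rsqr in E; lra).
      transitivity (sin t * (sin t * sin t ^ n) - (INR n + 1) * (cos t * cos t) * sin t ^ n);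
        [destruct n; simpl; ring | rewrite E; ring].
    - intros t _; apply (continuous_minus (fun t => scal (INR n + 2) (sin t ^ S (S n))));
        apply (continuous_scal_r (K := R_AbsRing) (V := R_NormedModule)), continuous_sin_pow. }
  assert (A : is_RInt (fun t => minus (scal (INR n + 2) (sin t ^ S (S n))) (scal (INR n + 1) (sin t ^ n)))
    0 (PI / 2) (minus (scal (INR n + 2) (Wallis (S (S n)))) (scal (INR n + 1) (Wallis n)))).
  { apply (is_RInt_minus (V := R_NormedModule) (fun t => scal (INR n + 2) (sin t ^ S (S n)))
      (fun t => scal (INR n + 1) (sin t ^ n)));
      [apply (is_RInt_scal (V := R_NormedModule) (fun t => sin t ^ S (S n)))
      |apply (is_RInt_scal (V := R_NormedModule) (fun t => sin t ^ n))];
      apply (RInt_correct (V := R_CompleteNormedModule)), ex_RInt_sin_pow. }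
  apply (is_RInt_unique (V := R_CompleteNormedModule)) in A, D.
  rewrite A in D; unfold minus, plus, opp, scal in D; simpl in D; unfold mult in D; simpl in D.
  lra.
Qed.

Lemma Wallis_0 : Wallis 0 = PI / 2.
Proof.
  unfold Wallis; simpl; rewrite RInt_const; unfold scal; simpl; unfold mult; simpl; ring.
Qed.

Lemma Wallis_1 : Wallis 1 = 1.
Proof.
  assert (D : is_RInt (fun t => sin t ^ 1) 0 (PI / 2) (minus (- cos (PI / 2)) (- cos 0))).
  { apply (is_RInt_derive (V := R_CompleteNormedModule) (fun t => - cos t)).
    - intros t _; auto_derive; [auto | simpl; ring].
    - intros t _; apply continuous_sin_pow. }
  apply (is_RInt_unique (V := R_CompleteNormedModule)) in D.
  unfold Wallis; rewrite D, cos_PI2, cos_0; unfold minus, plus, opp; simpl; ring.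
Qed.

Lemma Wallis_decr (n : nat) : Wallis (S n) <= Wallis n.
Proof.
  assert (P := PI_RGT_0).
  apply RInt_le; [lra | apply ex_RInt_sin_pow | apply ex_RInt_sin_pow |].
  intros t Ht; simpl; assert (0 <= sin t) by (apply sin_ge_0; lra).
  assert (B := SIN_bound t); assert (0 <= sin t ^ n) by (apply pow_le; assumption); nra.
Qed.

(** The ratio [(1/2, n) / n!], whose square is the coefficient [hc (1 / 2) n]. *)
Fixpoint wall (n : nat) : R :=
  match n with O => 1 | S m => wall m * ((1 / 2 + INR m) / INR (S m)) end.

Lemma wall_pos (n : nat) : 0 < wall n.
Proof.
  induction n as [| n IH]; cbn [wall]; [lra |].
  apply Rmult_lt_0_compat; [exact IH |]; apply Rdiv_lt_0_compat.
  - assert (H := pos_INR n); lra.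
  - apply lt_0_INR; lia.
Qed.

Lemma wall_sqr (n : nat) : wall n ^ 2 = hc (1 / 2) n.
Proof.
  induction n as [| n IH]; cbn [wall hc]; [ring |].
  rewrite Rpow_mult_distr, IH; reflexivity.
Qed.

Lemma Wallis_wall (n : nat) :
  Wallis (2 * n) = PI / 2 * wall n /\ Wallis (2 * n + 1) = / ((2 * INR n + 1) * wall n).
Proof.
  induction n as [| n [IH1 IH2]].
  - simpl Nat.mul; simpl Nat.add; rewrite Wallis_0, Wallis_1; simpl; split; field.
  - assert (P := pos_INR n); assert (Q := wall_pos n).
    replace (2 * S n)%nat with (S (S (2 * n))) by lia.
    replace (S (S (2 * n)) + 1)%nat with (S (S (2 * n + 1))) by lia.
    assert (R1 := Wallis_rec (2 * n)); assert (R2 := Wallis_rec (2 * n + 1)).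
    rewrite IH1 in R1; rewrite IH2 in R2.
    rewrite plus_INR, mult_INR in R2; rewrite mult_INR in R1; simpl (INR 2) in *; simpl (INR 1) in *.
    cbn [wall]; rewrite S_INR; split.
    + replace (Wallis (S (S (2 * n)))) with (((1 + 1) * INR n + 2) * Wallis (S (S (2 * n))) /
        ((1 + 1) * INR n + 2)) by (field; lra).
      rewrite R1; field; lra.
    + replace (Wallis (S (S (2 * n + 1)))) with (((1 + 1) * INR n + 1 + 2) * Wallis (S (S (2 * n + 1))) /
        ((1 + 1) * INR n + 1 + 2)) by (field; lra).
      rewrite R2; field; repeat split; lra.
Qed.

(** [Wallis (2n+1) <= Wallis (2n)] gives [wall n ^ 2 >= 2 / (PI (2 n + 1))], which is more than
    claimed. *)
Lemma hc_half_lower (n : nat) : / (PI * (INR n + 1)) <= hc (1 / 2) n.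
Proof.
  assert (P := PI_RGT_0); assert (Q := wall_pos n); assert (R := pos_INR n).
  destruct (Wallis_wall n) as [E1 E2].
  assert (D := Wallis_decr (2 * n)).
  replace (S (2 * n)) with (2 * n + 1)%nat in D by lia.
  rewrite E1, E2 in D; rewrite <- wall_sqr.
  assert (H : 0 < (2 * INR n + 1) * wall n) by (apply Rmult_lt_0_compat; lra).
  apply (Rmult_le_compat_r _ _ _ (Rlt_le _ _ H)) in D; rewrite Rinv_l in D by lra.
  assert (H2 : 0 < PI * (INR n + 1)) by (apply Rmult_lt_0_compat; lra).
  apply (Rmult_le_reg_r (PI * (INR n + 1))); [exact H2 |]; rewrite Rinv_l by lra.
  assert (0 < PI * wall n ^ 2) by (apply Rmult_lt_0_compat; [lra | apply pow_lt, Q]).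
  nra.
Qed.

(** [Wallis (2n+2) <= Wallis (2n+1)], combined with [(2 n + 1) wall n = 2 (n + 1) wall (n + 1)]. *)
Lemma hc_half_upper (n : nat) : hc (1 / 2) (S n) <= / (PI * (INR n + 1)).
Proof.
  assert (P := PI_RGT_0); assert (Q := wall_pos n); assert (R := pos_INR n).
  destruct (Wallis_wall n) as [_ E2]; destruct (Wallis_wall (S n)) as [E1 _].
  assert (D := Wallis_decr (2 * n + 1)).
  replace (S (2 * n + 1)) with (2 * S n)%nat in D by lia.
  rewrite E1, E2 in D; rewrite <- wall_sqr; cbn [wall] in *; rewrite S_INR in *.
  assert (H : 0 < (2 * INR n + 1) * wall n) by (apply Rmult_lt_0_compat; lra).
  apply (Rmult_le_compat_r _ _ _ (Rlt_le _ _ H)) in D; rewrite Rinv_l in D by lra.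
  assert (H2 : 0 < PI * (INR n + 1)) by (apply Rmult_lt_0_compat; lra).
  apply (Rmult_le_reg_r (PI * (INR n + 1))); [exact H2 |]; rewrite Rinv_l by lra.
  replace ((wall n * ((1 / 2 + INR n) / (INR n + 1))) ^ 2 * (PI * (INR n + 1))) with
    (PI / 2 * (wall n * ((1 / 2 + INR n) / (INR n + 1))) * ((2 * INR n + 1) * wall n))
    by (field; lra).
  exact D.
Qed.

Lemma is_series_geom_PI (x : R) : 0 <= x < 1 -> is_series (fun n => / PI * x ^ n) (/ PI * / (1 - x)).
Proof.
  intros Hx; apply (is_series_scal (K := R_AbsRing) (V := R_NormedModule) (/ PI) (fun n => x ^ n)).
  apply is_series_geom; rewrite Rabs_pos_eq; lra.
Qed.

Lemma increasing_from_0 (f df : R -> R) (x : R) : 0 <= x < 1 ->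
  (forall t, 0 <= t < 1 -> is_derive f t (df t)) -> (forall t, 0 <= t < 1 -> 0 <= df t) -> f 0 <= f x.
Proof.
  intros Hx Hf Hd; destruct (Req_dec x 0) as [-> | N]; [lra |].
  destruct (MVT_cor2 f df 0 x) as [t [E Ht]]; [lra | |].
  - intros t Ht; apply is_derive_Reals, Hf; lra.
  - assert (0 <= df t) by (apply Hd; lra); nra.
Qed.

(* Logarithmic singularity of F(1/2,1/2;1;x) at 1; the constant comes from Wallis' bounds. *)
Lemma Fr_half_log (x : R) : 0 <= x < 1 ->
  - ln (1 - x) <= PI * Fr (1 / 2) x <= PI - ln (1 - x).
Proof.
  intros Hx; assert (P := PI_RGT_0).
  assert (Hip : 0 < / PI) by (apply Rinv_0_lt_compat; lra).
  assert (HR : forall t, 0 <= t < 1 -> Rbar_lt (Rabs t) (CV_radius (hc (1 / 2))))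
    by (intros t Ht; apply hc_radius; [lra | rewrite Rabs_pos_eq; lra]).
  assert (E1 : forall t, 0 <= t < 1 -> ex_series (fun n => PS_derive (hc (1 / 2)) n * t ^ n)).
  { intros t Ht; apply ex_pseries_R, CV_radius_inside; rewrite CV_radius_derive; apply HR, Ht. }
  assert (E0 : forall t, 0 <= t < 1 -> ex_series (fun n => hc (1 / 2) n * t ^ n)).
  { intros t Ht; apply ex_pseries_R, CV_radius_inside, HR, Ht. }
  (* The coefficients [(n + 1) hc (n + 1)] of [F'] are at most [1 / PI]. *)
  assert (U : forall t, 0 <= t < 1 -> Fr1 (1 / 2) t <= / PI * / (1 - t)).
  { intros t Ht; rewrite <- (is_series_unique _ _ (is_series_geom_PI t Ht)).
    apply Series_le; [| eexists; apply is_series_geom_PI, Ht].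
    intros n; unfold PS_derive; assert (T : 0 <= t ^ n) by (apply pow_le; lra).
    assert (A := hc_half_upper n); assert (A' := hc_bounds (1 / 2) (S n) ltac:(lra)).
    assert (N := pos_INR n).
    assert (B : INR (S n) * hc (1 / 2) (S n) <= / PI).
    { rewrite S_INR; apply (Rmult_le_compat_l (INR n + 1)) in A; [| lra].
      replace ((INR n + 1) * / (PI * (INR n + 1))) with (/ PI) in A by (field; lra); exact A. }
    assert (B' : 0 <= INR (S n) * hc (1 / 2) (S n))
      by (apply Rmult_le_pos; [apply pos_INR | lra]).
    split; [apply Rmult_le_pos; assumption | apply Rmult_le_compat_r; assumption]. }
  (* The lower bound is taken for the derivative of [t F] instead, since its coefficients
     [(n + 1) hc n] are at least [1 / PI]. *)
  assert (L : forall t, 0 <= t < 1 -> / PI * / (1 - t) <= Fr (1 / 2) t + t * Fr1 (1 / 2) t).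
  { intros t Ht; rewrite <- (is_series_unique _ _ (is_series_geom_PI t Ht)).
    assert (I : ex_series (fun n => PS_incr_1 (PS_derive (hc (1 / 2))) n * t ^ n)).
    { apply ex_pseries_R, ex_pseries_incr_1, ex_pseries_R, E1, Ht. }
    unfold Fr1; rewrite <- PSeries_incr_1; unfold Fr, PSeries; rewrite <- Series_plus;
      [| apply E0, Ht | exact I].
    apply Series_le; [| apply (ex_series_plus (V := R_NormedModule)); [apply E0, Ht | exact I]].
    intros n; assert (T : 0 <= t ^ n) by (apply pow_le; lra).
    split; [apply Rmult_le_pos; lra |].
    rewrite <- Rmult_plus_distr_r; apply Rmult_le_compat_r; [exact T |].
    assert (A := hc_half_lower n).
    destruct n as [| n].
    - unfold PS_incr_1, zero; simpl in *.
      replace (PI * (0 + 1)) with PI in A by ring; lra.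
    - unfold PS_incr_1, PS_derive; assert (N := pos_INR (S n)).
      apply (Rmult_le_compat_l (INR (S n) + 1)) in A; [| lra].
      replace ((INR (S n) + 1) * / (PI * (INR (S n) + 1))) with (/ PI) in A by (field; lra).
      lra. }
  assert (Dln : forall t, 0 <= t < 1 -> is_derive (fun t => / PI * - ln (1 - t)) t (/ PI * / (1 - t))).
  { intros t Ht; auto_derive; [lra | field; lra]. }
  assert (F0 := Fr_0 (1 / 2)).
  assert (B1 := increasing_from_0 (fun t => / PI * - ln (1 - t) - Fr (1 / 2) t)
    (fun t => / PI * / (1 - t) - Fr1 (1 / 2) t) x Hx).
  assert (B2 := increasing_from_0 (fun t => t * Fr (1 / 2) t - / PI * - ln (1 - t))
    (fun t => (1 * Fr (1 / 2) t + t * Fr1 (1 / 2) t) - / PI * / (1 - t)) x Hx).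
  cbv beta in B1, B2; rewrite Rminus_0_r, ln_1, F0 in B1, B2.
  assert (C1 : / PI * - 0 - 1 <= / PI * - ln (1 - x) - Fr (1 / 2) x).
  { apply B1; intros t Ht; [| specialize (U t Ht); lra].
    apply (is_derive_minus (K := R_AbsRing) (V := R_NormedModule) (fun t => / PI * - ln (1 - t)));
      [apply Dln, Ht | apply is_derive_Fr; [lra | rewrite Rabs_pos_eq; lra]]. }
  assert (C2 : 0 * 1 - / PI * - 0 <= x * Fr (1 / 2) x - / PI * - ln (1 - x)).
  { apply B2; intros t Ht; [| specialize (L t Ht); lra].
    apply (is_derive_minus (K := R_AbsRing) (V := R_NormedModule) (fun t => t * Fr (1 / 2) t)).
    - apply (is_derive_prod (fun t => t) (Fr (1 / 2)));
        [apply (is_derive_id (K := R_AbsRing)) | apply is_derive_Fr; [lra | rewrite Rabs_pos_eq; lra]].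
    - apply Dln, Ht. }
  assert (G := Fr_ge1 (1 / 2) x ltac:(lra) Hx).
  assert (M : / PI * - ln (1 - x) <= Fr (1 / 2) x) by nra.
  assert (K : PI * (/ PI * - ln (1 - x)) = - ln (1 - x)) by (field; lra).
  split.
  - rewrite <- K; apply Rmult_le_compat_l; lra.
  - replace (PI - ln (1 - x)) with (PI * (1 + / PI * - ln (1 - x))) by (rewrite Rmult_plus_distr_l, K; ring).
    apply Rmult_le_compat_l; lra.
Qed.

(** * Lambda and theta00 on the imaginary axis *)

Definition rlam (x : R) : R := Re (lam (RtoC x)).

Lemma RtoC_lt1 (x : R) : 0 < x < 1 -> (Cmod (RtoC x) < 1)%R.
Proof. intros H; rewrite Cmod_R, Rabs_pos_eq; lra. Qed.

Lemma rA_neq0 (x : R) : -1 < x < 1 -> rA x <> 0.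
Proof.
  intros Hx E; apply (tA_neq0 (RtoC x)); [rewrite Cmod_R; apply Rabs_def1; lra |].
  rewrite tA_real, E; reflexivity.
Qed.

Lemma rpsi_neq0 (x : R) : -1 < x < 1 -> rpsi x <> 0.
Proof.
  intros Hx E; apply (tpsi_neq0 (RtoC x)); [rewrite Cmod_R; apply Rabs_def1; lra |].
  rewrite tpsi_real, E; reflexivity.
Qed.

Lemma lam_real (x : R) : 0 < x < 1 -> lam (RtoC x) = RtoC (rlam x).
Proof.
  intros Hx; unfold rlam, lam; rewrite tA_real, tpsi_real, <- !RtoC_pow, <- !RtoC_mult, <- RtoC_div;
    [reflexivity |].
  apply pow_nonzero, rA_neq0; lra.
Qed.

Lemma rlam_eq (x : R) : 0 < x < 1 -> rlam x = 16 * x * rpsi x ^ 4 / rA x ^ 4.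
Proof.
  intros Hx; apply RtoC_inj; rewrite <- lam_real by exact Hx; unfold lam.
  rewrite tA_real, tpsi_real, <- !RtoC_pow, <- !RtoC_mult, <- RtoC_div;
    [reflexivity | apply pow_nonzero, rA_neq0; lra].
Qed.

Lemma pow4_pos (x : R) : x <> 0 -> 0 < x ^ 4.
Proof. intros N; replace (x ^ 4) with ((x ^ 2) ^ 2) by ring; apply pow2_gt_0, pow_nonzero, N. Qed.

Lemma rlam_bounds (x : R) : 0 < x < 1 -> 0 < rlam x < 1.
Proof.
  intros Hx; split.
  - rewrite rlam_eq by exact Hx.
    assert (P1 := pow4_pos _ (rA_neq0 x ltac:(lra))); assert (P2 := pow4_pos _ (rpsi_neq0 x ltac:(lra))).
    apply Rdiv_lt_0_compat; [| exact P1]; apply Rmult_lt_0_compat; lra.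
  - assert (E : 1 - rlam x = rA (- x) ^ 4 / rA x ^ 4).
    { apply RtoC_inj; rewrite RtoC_minus, <- lam_real, one_minus_lam by (try apply RtoC_lt1; exact Hx).
      rewrite <- RtoC_opp, !tA_real, <- !RtoC_pow, <- RtoC_div; [reflexivity |].
      apply pow_nonzero, rA_neq0; lra. }
    assert (P1 := pow4_pos _ (rA_neq0 x ltac:(lra))); assert (P2 := pow4_pos _ (rA_neq0 (- x) ltac:(lra))).
    assert (0 < rA (- x) ^ 4 / rA x ^ 4) by (apply Rdiv_lt_0_compat; assumption).
    lra.
Qed.

(** The witness is [theta10^2 / theta00^2] at the squared nome; dividing the duplication formulas by
    [rA (x ^ 2) ^ 2] gives the three relations. *)
Lemma rlam_Landen (x : R) : 0 < x < 1 -> exists k, 0 < k < 1 /\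
  rlam (x ^ 2) = k ^ 2 /\ rlam x = 4 * k / (1 + k) ^ 2 /\ rA x ^ 2 = (1 + k) * rA (x ^ 2) ^ 2.
Proof.
  intros Hx; assert (Hx2 : 0 < x ^ 2 < 1) by nra.
  assert (N := rA_neq0 (x ^ 2) ltac:(lra)); assert (N' := rpsi_neq0 (x ^ 2) ltac:(lra)).
  assert (N0 := rA_neq0 x ltac:(lra)).
  set (k := 4 * x * rpsi (x ^ 2) ^ 2 / rA (x ^ 2) ^ 2).
  assert (Pa : 0 < rA (x ^ 2) ^ 2) by (apply pow2_gt_0, N).
  assert (Hk : 0 < k).
  { apply Rdiv_lt_0_compat; [| exact Pa].
    apply Rmult_lt_0_compat; [lra | apply pow2_gt_0, N']. }
  assert (E1 : rlam (x ^ 2) = k ^ 2).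
  { rewrite rlam_eq by exact Hx2; unfold k; field; exact N. }
  assert (E3 : rA x ^ 2 = (1 + k) * rA (x ^ 2) ^ 2).
  { rewrite rA_double by lra; unfold k; field; exact N. }
  assert (B := rlam_bounds _ Hx2).
  exists k; repeat split; try assumption; [nra |].
  rewrite rlam_eq by exact Hx.
  replace (rA x ^ 4) with ((rA x ^ 2) ^ 2) by ring; rewrite E3.
  replace (rpsi x ^ 4) with ((rpsi x ^ 2) ^ 2) by ring; rewrite rpsi_double by lra.
  unfold k at 2; field; repeat split; try assumption; lra.
Qed.

Fixpoint rsqrn (n : nat) (x : R) : R := match n with O => x | S m => rsqrn m x ^ 2 end.

Lemma rsqrn_bounds (n : nat) (x : R) : 0 < x < 1 -> 0 < rsqrn n x < 1.
Proof. intros H; induction n as [| n IH]; cbn [rsqrn]; [exact H | nra]. Qed.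

Lemma sqrn_rsqrn (n : nat) (x : R) : sqrn n (RtoC x) = RtoC (rsqrn n x).
Proof.
  induction n as [| n IH]; cbn [sqrn rsqrn]; [reflexivity |].
  rewrite IH, <- RtoC_mult; f_equal; ring.
Qed.

Lemma ln_rsqrn (n : nat) (x : R) : 0 < x < 1 -> ln (rsqrn n x) = 2 ^ n * ln x.
Proof.
  intros H; induction n as [| n IH]; cbn [rsqrn]; [simpl; ring |].
  assert (B := rsqrn_bounds n x H).
  replace (rsqrn n x ^ 2) with (rsqrn n x * rsqrn n x) by ring.
  rewrite ln_mult, IH by lra; simpl; ring.
Qed.

Lemma lim_rsqrn (f : C -> C) (x : R) (l : R) (g : R -> R) : 0 < x < 1 ->
  ccont f 0 -> f 0 = RtoC l -> (forall t, 0 < t < 1 -> f (RtoC t) = RtoC (g t)) ->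
  is_lim_seq (fun n => g (rsqrn n x)) l.
Proof.
  intros Hx Hf H0 Hg; apply is_lim_seq_spec; intros e.
  destruct (Hf e (cond_pos e)) as [d [Hd K]].
  destruct (sqrn_small (RtoC x) d (RtoC_lt1 x Hx) Hd) as [N HN].
  exists N; intros n Hn; specialize (HN n Hn); rewrite sqrn_rsqrn in HN.
  specialize (K (RtoC (rsqrn n x))).
  replace (RtoC (rsqrn n x) - 0)%C with (RtoC (rsqrn n x)) in K by ring.
  specialize (K HN); rewrite H0, Hg, <- RtoC_minus, Cmod_R in K by (apply rsqrn_bounds, Hx).
  exact K.
Qed.

Lemma zero_lt1 : (Cmod 0 < 1)%R.
Proof. rewrite Cmod_0; lra. Qed.

Lemma Fc_0 (a : R) : Fc a 0 = RtoC 1.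
Proof. rewrite Fc_real, Fr_0; reflexivity. Qed.

Lemma ccont_Fc_lam : ccont (fun q => Fc (1 / 2) (lam q)) 0.
Proof.
  apply (ccont_comp lam (Fc (1 / 2))); [apply holo_cont, holo_lam, zero_lt1 |].
  apply holo_cont, holo_Fc; [lra | rewrite lam_0; apply zero_lt1].
Qed.

Lemma lim_Fr_rlam (x : R) : 0 < x < 1 -> is_lim_seq (fun n => Fr (1 / 2) (rlam (rsqrn n x))) 1.
Proof.
  intros Hx; apply (lim_rsqrn (fun q => Fc (1 / 2) (lam q)) x 1 (fun t => Fr (1 / 2) (rlam t)) Hx).
  - apply ccont_Fc_lam.
  - rewrite lam_0; apply Fc_0.
  - intros t Ht; rewrite lam_real, Fc_real by exact Ht; reflexivity.
Qed.

Lemma lim_rA (x : R) : 0 < x < 1 -> is_lim_seq (fun n => rA (rsqrn n x)) 1.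
Proof.
  intros Hx; apply (lim_rsqrn tA x 1 rA Hx).
  - apply holo_cont, holo_tA, zero_lt1.
  - apply tA_0.
  - intros t _; apply tA_real.
Qed.

Lemma lim_rpsi (x : R) : 0 < x < 1 -> is_lim_seq (fun n => rpsi (rsqrn n x)) 1.
Proof.
  intros Hx; apply (lim_rsqrn tpsi x 1 rpsi Hx).
  - apply holo_cont, holo_tpsi, zero_lt1.
  - apply tpsi_0.
  - intros t _; apply tpsi_real.
Qed.

(** By Landen's transformation the quotient of the two sides is invariant under [x -> x ^ 2], and it
    tends to 1 along the iterates, which tend to 0. *)
Lemma Fr_rlam (x : R) : 0 < x < 1 -> Fr (1 / 2) (rlam x) = rA x ^ 2.
Proof.
  intros Hx.
  assert (I : forall n, Fr (1 / 2) (rlam x) * rA (rsqrn n x) ^ 2 =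
    rA x ^ 2 * Fr (1 / 2) (rlam (rsqrn n x))).
  { induction n as [| n IH]; [cbn [rsqrn]; ring |].
    assert (B := rsqrn_bounds n x Hx); cbn [rsqrn].
    destruct (rlam_Landen _ B) as [k [Hk [E1 [E2 E3]]]].
    rewrite E2, Fr_Landen, <- E1, E3 in IH by lra; nra. }
  assert (L1 : is_lim_seq (fun n => Fr (1 / 2) (rlam x) * (rA (rsqrn n x) * rA (rsqrn n x)))
    (Fr (1 / 2) (rlam x) * (1 * 1))).
  { apply is_lim_seq_mult'; [apply is_lim_seq_const |]; apply is_lim_seq_mult'; apply lim_rA, Hx. }
  assert (L2 : is_lim_seq (fun n => rA x ^ 2 * Fr (1 / 2) (rlam (rsqrn n x))) (rA x ^ 2 * 1)).
  { apply is_lim_seq_mult'; [apply is_lim_seq_const | apply lim_Fr_rlam, Hx]. }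
  assert (L3 : is_lim_seq (fun n => rA x ^ 2 * Fr (1 / 2) (rlam (rsqrn n x)))
    (Fr (1 / 2) (rlam x) * (1 * 1))).
  { revert L1; apply is_lim_seq_ext; intros n; rewrite <- I; ring. }
  apply is_lim_seq_unique in L2, L3; rewrite L2 in L3; injection L3; lra.
Qed.

(* The ratio K'/K is halved by [x -> x^2]; iterating, the logarithmic singularity yields
   [K'/K = - ln x / pi]. *)
Lemma Fr_ratio (x : R) : 0 < x < 1 ->
  PI * Fr (1 / 2) (1 - rlam x) = - ln x * Fr (1 / 2) (rlam x).
Proof.
  intros Hx; assert (P := PI_RGT_0).
  set (Ph := fun t => Fr (1 / 2) (1 - rlam t) / Fr (1 / 2) (rlam t)).
  assert (Fpos : forall t, 0 < t < 1 -> 1 <= Fr (1 / 2) (rlam t)).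
  { intros t Ht; assert (B := rlam_bounds t Ht); apply Fr_ge1; lra. }
  assert (I : forall n, Ph (rsqrn n x) = 2 ^ n * Ph x).
  { induction n as [| n IH]; [cbn [rsqrn]; simpl; ring |].
    assert (B := rsqrn_bounds n x Hx); cbn [rsqrn]; set (t := rsqrn n x) in *.
    assert (B2 : 0 < t ^ 2 < 1) by nra.
    destruct (rlam_Landen _ B) as [k [Hk [E1 [E2 _]]]].
    assert (Q := Fpos _ B2).
    assert (A1 : Fr (1 / 2) (rlam t) = (1 + k) * Fr (1 / 2) (rlam (t ^ 2)))
      by (rewrite E2, Fr_Landen, <- E1 by lra; reflexivity).
    (* At [(1 - k) / (1 + k)] Landen's transformation relates the complementary parameters
       [1 - rlam t] and [1 - k ^ 2], with factor [2 / (1 + k)]; hence [Ph (t ^ 2) = 2 * Ph t]. *)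
    assert (Hj : 0 <= (1 - k) / (1 + k) < 1).
    { split; [apply Rmult_le_pos; [lra | left; apply Rinv_0_lt_compat; lra] |].
      apply (Rmult_lt_reg_r (1 + k)); [lra |]; unfold Rdiv; rewrite Rmult_assoc, Rinv_l; lra. }
    assert (A2 := Fr_Landen _ Hj).
    replace (4 * ((1 - k) / (1 + k)) / (1 + (1 - k) / (1 + k)) ^ 2) with (1 - rlam (t ^ 2)) in A2
      by (rewrite E1; field; lra).
    replace (((1 - k) / (1 + k)) ^ 2) with (1 - rlam t) in A2 by (rewrite E2; field; lra).
    simpl (2 ^ S n); replace (2 * 2 ^ n * Ph x) with (2 * (2 ^ n * Ph x)) by ring.
    rewrite <- IH; unfold Ph; rewrite A1, A2; field; lra. }
  set (T := - ln x).
  (* [G t] is [rlam t / t] and tends to 16. The bounds 1 and 17 keep [ln (G t)] in a fixed interval,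
     so that it disappears after division by [2 ^ n]. *)
  set (G := fun t => 16 * rpsi t ^ 4 / rA t ^ 4).
  assert (LG : is_lim_seq (fun n => G (rsqrn n x)) 16).
  { replace 16 with (16 * (1 * 1 * (1 * 1)) / (1 * 1 * (1 * 1))) by field.
    apply (is_lim_seq_ext (fun n => 16 * (rpsi (rsqrn n x) * rpsi (rsqrn n x) *
      (rpsi (rsqrn n x) * rpsi (rsqrn n x))) / (rA (rsqrn n x) * rA (rsqrn n x) *
      (rA (rsqrn n x) * rA (rsqrn n x))))).
    - intros n; unfold G; f_equal; [ring | f_equal; ring].
    - assert (LA := lim_rA x Hx); assert (LP := lim_rpsi x Hx).
      apply is_lim_seq_div'; [| | lra];
        repeat first [exact LA | exact LP | apply is_lim_seq_mult' | apply is_lim_seq_const]. }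
  assert (S : forall n, 1 <= G (rsqrn n x) <= 17 ->
    T - / 2 ^ n * ln 17 <= PI * Ph x * Fr (1 / 2) (rlam (rsqrn n x)) <= T + / 2 ^ n * PI).
  { intros n HG; assert (B := rsqrn_bounds n x Hx); assert (Bl := rlam_bounds _ B).
    assert (P2 : 0 < 2 ^ n) by (apply pow_lt; lra).
    assert (P2' : 0 < / 2 ^ n) by (apply Rinv_0_lt_compat, P2).
    assert (D := Fr_half_log (1 - rlam (rsqrn n x)) ltac:(lra)).
    replace (1 - (1 - rlam (rsqrn n x))) with (rlam (rsqrn n x)) in D by ring.
    assert (EL : ln (rlam (rsqrn n x)) = ln (G (rsqrn n x)) + 2 ^ n * ln x).
    { rewrite <- ln_rsqrn, <- ln_mult by (try exact Hx; lra); f_equal.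
      rewrite rlam_eq by exact B; unfold G, Rdiv; ring. }
    assert (EP : PI * Ph x * Fr (1 / 2) (rlam (rsqrn n x)) =
      / 2 ^ n * (PI * Fr (1 / 2) (1 - rlam (rsqrn n x)))).
    { assert (Q := Fpos _ B).
      replace (Ph x) with (/ 2 ^ n * Ph (rsqrn n x)) by (rewrite I; field; lra).
      unfold Ph; field; lra. }
    rewrite EP; rewrite EL in D.
    assert (L1 : 0 <= ln (G (rsqrn n x))) by (rewrite <- ln_1; apply ln_le; lra).
    assert (L2 : ln (G (rsqrn n x)) <= ln 17) by (apply ln_le; lra).
    replace T with (/ 2 ^ n * - (2 ^ n * ln x)) by (unfold T; field; lra).
    rewrite <- Rmult_minus_distr_l, <- Rmult_plus_distr_l.
    split; apply Rmult_le_compat_l; lra. }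
  assert (LS : is_lim_seq (fun n => PI * Ph x * Fr (1 / 2) (rlam (rsqrn n x))) T).
  { assert (L2 : is_lim_seq (fun n => / 2 ^ n) 0).
    { apply (is_lim_seq_ext (fun n => (/ 2) ^ n)); [intros n; apply pow_inv |].
      apply is_lim_seq_geom; rewrite Rabs_pos_eq; lra. }
    apply (is_lim_seq_le_le_loc (fun n => T - / 2 ^ n * ln 17) _ (fun n => T + / 2 ^ n * PI)).
    - apply is_lim_seq_spec in LG; destruct (LG (mkposreal 1 Rlt_0_1)) as [N HN].
      exists N; intros n Hn; apply S; specialize (HN n Hn); simpl in HN; apply Rabs_def2 in HN; lra.
    - replace (Finite T) with (Finite (T - 0 * ln 17)%R) by (f_equal; ring).
      apply is_lim_seq_minus'; [apply is_lim_seq_const |].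
      apply is_lim_seq_mult'; [exact L2 | apply is_lim_seq_const].
    - replace (Finite T) with (Finite (T + 0 * PI)%R) by (f_equal; ring).
      apply is_lim_seq_plus'; [apply is_lim_seq_const |].
      apply is_lim_seq_mult'; [exact L2 | apply is_lim_seq_const]. }
  assert (LS' : is_lim_seq (fun n => PI * Ph x * Fr (1 / 2) (rlam (rsqrn n x))) (PI * Ph x * 1)).
  { apply is_lim_seq_mult'; [apply is_lim_seq_const | apply lim_Fr_rlam, Hx]. }
  apply is_lim_seq_unique in LS, LS'; rewrite LS in LS'; injection LS'; intros E.
  assert (Q := Fpos x Hx).
  replace (PI * Fr (1 / 2) (1 - rlam x)) with (PI * Ph x * 1 * Fr (1 / 2) (rlam x))
    by (unfold Ph; field; lra).
  rewrite <- E; reflexivity.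
Qed.

(** [Fr_ratio] at both nomes gives [F(1 - u) = y F(u)] and [F(v) = y F(1 - v)]. If [v < 1 - u], then
    [F(v) < F(1 - u)] says [F(1 - v) < F(u)], although [u < 1 - v]; the other inequality is excluded
    likewise. *)
Lemma S_transform_real (y : R) : 0 < y ->
  rlam (exp (- (PI / y))) = 1 - rlam (exp (- (PI * y))) /\
  rA (exp (- (PI / y))) ^ 2 = y * rA (exp (- (PI * y))) ^ 2.
Proof.
  intros Hy; assert (P := PI_RGT_0).
  assert (E01 : forall u, 0 < u -> 0 < exp (- u) < 1).
  { intros u Hu; split; [apply exp_pos |]; rewrite <- exp_0; apply exp_increasing; lra. }
  assert (Hx := E01 (PI * y) ltac:(apply Rmult_lt_0_compat; lra)).
  assert (Hx' := E01 (PI / y) ltac:(apply Rdiv_lt_0_compat; lra)).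
  set (x := exp (- (PI * y))) in *; set (x' := exp (- (PI / y))) in *.
  assert (R1 := Fr_ratio x Hx); assert (R2 := Fr_ratio x' Hx').
  unfold x at 2 in R1; unfold x' at 2 in R2; rewrite ln_exp in R1, R2.
  assert (B := rlam_bounds x Hx); assert (B' := rlam_bounds x' Hx').
  set (u := rlam x) in *; set (v := rlam x') in *.
  assert (Q1 : Fr (1 / 2) (1 - u) = y * Fr (1 / 2) u).
  { apply (Rmult_eq_reg_l PI); [rewrite R1; ring | lra]. }
  assert (Q2 : Fr (1 / 2) v = y * Fr (1 / 2) (1 - v)).
  { apply (Rmult_eq_reg_l (PI / y)); [| assert (0 < PI / y) by (apply Rdiv_lt_0_compat; lra); lra].
    replace (PI / y * (y * Fr (1 / 2) (1 - v))) with (PI * Fr (1 / 2) (1 - v)) by (field; lra).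
    rewrite R2; ring. }
  assert (E : v = 1 - u).
  { destruct (Rtotal_order v (1 - u)) as [L | [L | L]]; [exfalso | exact L | exfalso].
    - assert (A1 := Fr_increasing (1 / 2) v (1 - u) ltac:(lra) ltac:(lra) ltac:(lra)).
      assert (A2 := Fr_increasing (1 / 2) u (1 - v) ltac:(lra) ltac:(lra) ltac:(lra)).
      rewrite Q1, Q2 in A1; nra.
    - assert (A1 := Fr_increasing (1 / 2) (1 - u) v ltac:(lra) ltac:(lra) ltac:(lra)).
      assert (A2 := Fr_increasing (1 / 2) (1 - v) u ltac:(lra) ltac:(lra) ltac:(lra)).
      rewrite Q1, Q2 in A1; nra. }
  split; [exact E |].
  rewrite <- !Fr_rlam by assumption; fold u; fold v; rewrite E; exact Q1.
Qed.

Open Scope C_scope.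

(** * The fundamental domain *)

Lemma cnear_Im_pos (tau : C) : (0 < Im tau)%R -> cnear tau (fun w => (0 < Im w)%R).
Proof.
  intros H; exists (Im tau); split; [exact H |]; intros w Hw.
  assert (A := im_le_Cmod (w - tau)); change (Im (w - tau)) with (Im w + - Im tau)%R in A.
  destruct (Rlt_dec 0 (Im w)) as [L | L]; [exact L |].
  rewrite Rabs_left in A by lra; lra.
Qed.

Lemma Im_segment (p q : C) (t : R) : Im (p + RtoC t * (q - p)) = (Im p + t * (Im q - Im p))%R.
Proof. unfold Im; simpl; ring. Qed.

Lemma Re_segment (p q : C) (t : R) : Re (p + RtoC t * (q - p)) = (Re p + t * (Re q - Re p))%R.
Proof. unfold Re; simpl; ring. Qed.

(** * Extension of the inversion formula to the half-plane *)

Lemma zeros_cluster_imag (f : C -> C) (y0 : R) : 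
  (forall y, (y0 < y)%R -> f (RtoC y * Ci) = 0) -> zeros_cluster f (RtoC y0 * Ci).
Proof.
  intros H d Hd; exists (RtoC (y0 + d / 2) * Ci); split; [| apply H; lra].
  replace (RtoC (y0 + d / 2) * Ci - RtoC y0 * Ci) with (RtoC (d / 2) * Ci)
    by (rewrite RtoC_plus; ring).
  rewrite Cmod_mult, Cmod_Ci, Cmod_R, Rabs_pos_eq; lra.
Qed.

Lemma upper_identity (f : C -> C) :
  (forall tau, (0 < Im tau)%R -> holo f tau) ->
  forall p, (0 < Im p)%R -> zeros_cluster f p ->
  forall tau, (0 < Im tau)%R -> f tau = 0.
Proof.
  intros Hf p Hp Hz tau Ht.
  apply (cnear_self tau (fun w => f w = 0)), (identity_segment f p tau); [| exact Hz].
  intros t Ht'; apply (cnear_impl _ _ _ Hf), cnear_Im_pos; rewrite Im_segment.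
  destruct (Req_dec t 0) as [-> | N]; [lra | nra].
Qed.

Lemma Im_inv_opp (tau : C) : tau <> 0 -> Im (- / tau) = (Im tau / (Cmod tau ^ 2))%R.
Proof.
  intros N; rewrite Cmod2_alt; unfold Im, Re; simpl.
  assert (P := proj1 (Cmod_gt_0 _) N).
  assert (Q := Cmod2_alt tau); unfold Re, Im in Q; simpl in Q.
  field. assert (0 < Cmod tau * (Cmod tau * 1))%R by nra. lra.
Qed.

Lemma Im_pos_neq0 (tau : C) : (0 < Im tau)%R -> tau <> 0.
Proof. intros H E; rewrite E in H; unfold Im in H; simpl in H; lra. Qed.

Lemma Im_inv_opp_pos (tau : C) : (0 < Im tau)%R -> (0 < Im (- / tau))%R.
Proof.
  intros H; rewrite Im_inv_opp by (apply Im_pos_neq0, H).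
  apply Rdiv_lt_0_compat; [exact H |]; apply pow_lt, Cmod_gt_0, Im_pos_neq0, H.
Qed.

Lemma opp_inv_imag (y : R) : (0 < y)%R -> - / (RtoC y * Ci) = RtoC (/ y) * Ci.
Proof.
  intros Hy.
  assert (Ny : RtoC y <> 0) by (intros E; apply RtoC_inj in E; lra).
  assert (Ni : Ci <> 0) by (intros E; injection E; lra).
  replace (RtoC (/ y) * Ci) with (RtoC (/ y) * Ci * Ci * / Ci) by (field; exact Ni).
  rewrite RtoC_inv by lra.
  replace (/ RtoC y * Ci * Ci) with (- / RtoC y)
    by (apply injective_projections; simpl; ring).
  field; auto.
Qed.

Lemma exp_neg_PI_bounds (y : R) : (0 < y)%R -> (0 < exp (- (PI * y)) < 1)%R.
Proof.
  intros Hy; assert (P := PI_RGT_0); split; [apply exp_pos |].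
  rewrite <- exp_0; apply exp_increasing; nra.
Qed.

Lemma holo_lam_nome (tau : C) : (0 < Im tau)%R -> holo (fun t => lam (nome t)) tau.
Proof.
  intros H; apply (holo_comp nome lam); [apply holo_nome | apply holo_lam, nome_lt1, H].
Qed.

Lemma holo_tA_nome (tau : C) : (0 < Im tau)%R -> holo (fun t => tA (nome t)) tau.
Proof.
  intros H; apply (holo_comp nome tA); [apply holo_nome | apply holo_tA, nome_lt1, H].
Qed.

Lemma holo_opp_inv (tau : C) : (0 < Im tau)%R -> holo (fun t => - / t) tau.
Proof.
  intros H; apply holo_opp, (holo_inv (fun t => t)); [apply holo_id | apply Im_pos_neq0, H].
Qed.

Lemma S_transform_lam (tau : C) : (0 < Im tau)%R -> lam (nome (- / tau)) = 1 - lam (nome tau).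
Proof.
  intros H.
  assert (E : lam (nome (- / tau)) - (1 - lam (nome tau)) = 0).
  { apply (upper_identity (fun t => lam (nome (- / t)) - (1 - lam (nome t)))) with (p := RtoC 1 * Ci).
    - intros t Ht; apply holo_minus; [| apply holo_minus; [apply holo_const | apply holo_lam_nome, Ht]].
      apply (holo_comp (fun t => - / t) (fun t => lam (nome t)));
        [apply holo_opp_inv, Ht | apply holo_lam_nome, Im_inv_opp_pos, Ht].
    - unfold Im; simpl; lra.
    - apply zeros_cluster_imag; intros y Hy.
      destruct (S_transform_real y ltac:(lra)) as [E _].
      rewrite opp_inv_imag, !nome_imag by lra.
      replace (PI * / y)%R with (PI / y)%R by reflexivity.
      rewrite !lam_real, E, <- RtoC_minus, <- RtoC_minus; [f_equal; ring | |].
      + apply exp_neg_PI_bounds; lra.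
      + apply (exp_neg_PI_bounds (/ y)), Rinv_0_lt_compat; lra.
    - exact H. }
  rewrite <- (Cplus_0_l (1 - lam (nome tau))), <- E; ring.
Qed.

Lemma S_transform_tA (tau : C) : (0 < Im tau)%R ->
  tA (nome (- / tau)) * tA (nome (- / tau)) = - Ci * tau * (tA (nome tau) * tA (nome tau)).
Proof.
  intros H.
  set (f := fun t => tA (nome (- / t)) * tA (nome (- / t)) - - Ci * t * (tA (nome t) * tA (nome t))).
  assert (E : f tau = 0).
  { apply (upper_identity f) with (p := RtoC 1 * Ci).
    - intros t Ht; apply holo_minus.
      + assert (K : holo (fun t => tA (nome (- / t))) t).
        { apply (holo_comp (fun t => - / t) (fun t => tA (nome t)));
            [apply holo_opp_inv, Ht | apply holo_tA_nome, Im_inv_opp_pos, Ht]. }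
        apply holo_mult; exact K.
      + apply holo_mult; [apply holo_mult; [apply holo_const | apply holo_id] |].
        apply holo_mult; apply holo_tA_nome, Ht.
    - unfold Im; simpl; lra.
    - apply zeros_cluster_imag; intros y Hy; unfold f.
      destruct (S_transform_real y ltac:(lra)) as [_ E].
      rewrite opp_inv_imag, !nome_imag, !tA_real by lra.
      replace (PI * / y)%R with (PI / y)%R by reflexivity.
      rewrite <- !RtoC_mult.
      replace (rA (exp (- (PI / y))) * rA (exp (- (PI / y))))%R
        with (y * rA (exp (- (PI * y))) ^ 2)%R by (rewrite <- E; ring).
      apply injective_projections; simpl; ring.
    - exact H. }
  unfold f in E.
  rewrite <- (Cplus_0_l (- Ci * tau * (tA (nome tau) * tA (nome tau)))), <- E; ring.
Qed.

Lemma unit_opp_inv (tau : C) : Cmod tau = 1%R -> - / tau = - Cconj tau.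
Proof.
  intros H; f_equal.
  assert (N : tau <> 0) by (apply Cmod_gt_0; lra).
  assert (E := Cmod2_conj tau); rewrite H in E.
  replace (Cconj tau) with (tau * Cconj tau * / tau) by (field; exact N).
  rewrite <- E, pow1; field; exact N.
Qed.

(** On the unit circle [tau -> -1/tau] is the reflection in the imaginary axis, and this reflection
    conjugates the nome. *)
Lemma arc_lam_conj (tau : C) : (0 < Im tau)%R -> Cmod tau = 1%R ->
  Cconj (lam (nome tau)) = 1 - lam (nome tau).
Proof.
  intros H U; rewrite <- S_transform_lam, unit_opp_inv, nome_conj, lam_conj by
    (try assumption; apply nome_lt1, H); reflexivity.
Qed.

Lemma arc_lam_Re (tau : C) : (0 < Im tau)%R -> Cmod tau = 1%R -> Re (lam (nome tau)) = (1 / 2)%R.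
Proof.
  intros H U; assert (E := f_equal Re (arc_lam_conj tau H U)).
  change (Re (lam (nome tau)) = 1 + - Re (lam (nome tau)))%R in E; lra.
Qed.

Lemma arc_tA_conj (tau : C) : (0 < Im tau)%R -> Cmod tau = 1%R ->
  Cconj (tA (nome tau) * tA (nome tau)) = - Ci * tau * (tA (nome tau) * tA (nome tau)).
Proof.
  intros H U; rewrite <- S_transform_tA, unit_opp_inv, nome_conj, tA_conj, Cmult_conj by assumption.
  reflexivity.
Qed.

Lemma nome_minus1 (tau : C) : nome (tau - 1) = - nome tau.
Proof.
  assert (E := nome_plus1 (tau - 1)); replace (tau - 1 + 1) with tau in E by ring.
  rewrite E; ring.
Qed.

(** * The maximum principle on the fundamental domain *)

Definition inW (tau : C) : Prop := (-1 < Re tau < 1 /\ 1 < Cmod tau /\ 0 < Im tau)%R.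
Definition inWbar (tau : C) : Prop := (-1 <= Re tau <= 1 /\ 1 <= Cmod tau /\ 0 < Im tau)%R.

Lemma cnear_inW (tau : C) : inW tau -> cnear tau inW.
Proof.
  intros [H1 [H2 H3]].
  exists (Rmin (Rmin (1 - Re tau) (Re tau + 1)) (Rmin (Cmod tau - 1) (Im tau))); split.
  - repeat apply Rmin_pos; lra.
  - intros w Hw.
    assert (A := Rlt_le_trans _ _ _ Hw (Rmin_l _ _)); assert (B := Rlt_le_trans _ _ _ Hw (Rmin_r _ _)).
    assert (A1 := Rlt_le_trans _ _ _ A (Rmin_l _ _)); assert (A2 := Rlt_le_trans _ _ _ A (Rmin_r _ _)).
    assert (B1 := Rlt_le_trans _ _ _ B (Rmin_l _ _)); assert (B2 := Rlt_le_trans _ _ _ B (Rmin_r _ _)).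
    assert (R1 := re_le_Cmod (w - tau)); change (Re (w - tau)) with (Re w + - Re tau)%R in R1.
    assert (I1 := im_le_Cmod (w - tau)); change (Im (w - tau)) with (Im w + - Im tau)%R in I1.
    assert (M := Cmod_rev_triangle tau w); rewrite Cmod_minus_sym in M.
    assert (R2 := Rle_trans _ _ _ (Rle_abs _) R1); assert (I2 := Rle_trans _ _ _ (Rle_abs _) I1).
    assert (R3 := Rle_trans _ _ _ (Rle_abs _) (eq_ind_r (fun z => (z <= _)%R) R1 (Rabs_Ropp _))).
    assert (I3 := Rle_trans _ _ _ (Rle_abs _) (eq_ind_r (fun z => (z <= _)%R) I1 (Rabs_Ropp _))).
    unfold inW; lra.
Qed.

(* [lam (- nome tau) = - lam / (1 - lam)]. *)
Definition mu (tau : C) : C := lam (- nome tau).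

Lemma holo_mu (tau : C) : (0 < Im tau)%R -> holo mu tau.
Proof.
  intros H; apply (holo_comp (fun t => - nome t) lam);
    [apply holo_opp, holo_nome | apply holo_lam, Cmod_opp_lt1, nome_lt1, H].
Qed.

Lemma nome_small (d : R) : (0 < d)%R -> exists Y, (1 < Y)%R /\
  forall tau, (Y <= Im tau)%R -> (Cmod (nome tau) < d)%R.
Proof.
  intros Hd; assert (P := PI_RGT_0).
  exists (Rabs (ln d) / PI + 2)%R.
  assert (Q : (0 <= Rabs (ln d) / PI)%R)
    by (apply Rmult_le_pos; [apply Rabs_pos | left; apply Rinv_0_lt_compat; lra]).
  split; [lra |]; intros tau Ht; rewrite Cmod_nome.
  rewrite <- (exp_ln d Hd) at 1; apply exp_increasing.
  apply (Rmult_le_compat_l PI) in Ht; [| lra].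
  replace (PI * (Rabs (ln d) / PI + 2))%R with (Rabs (ln d) + 2 * PI)%R in Ht by (field; lra).
  assert (A := Rle_abs (- ln d)); rewrite Rabs_Ropp in A; lra.
Qed.

Lemma lam_nome_small (e : R) : (0 < e)%R -> exists Y, (1 < Y)%R /\
  forall tau, (Y <= Im tau)%R -> (Cmod (lam (nome tau)) < e)%R /\ (Cmod (mu tau) < e)%R.
Proof.
  intros He.
  destruct (holo_cont _ _ (holo_lam 0 zero_lt1) e He) as [d [Hd K]]; rewrite lam_0 in K.
  destruct (nome_small d Hd) as [Y [HY N]]; exists Y; split; [exact HY |]; intros tau Ht.
  specialize (N tau Ht); split.
  - specialize (K (nome tau)); replace (nome tau - 0) with (nome tau) in K by ring.
    replace (lam (nome tau) - 0) with (lam (nome tau)) in K by ring; auto.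
  - specialize (K (- nome tau)); replace (- nome tau - 0) with (- nome tau) in K by ring.
    rewrite Cmod_opp in K; unfold mu.
    replace (lam (- nome tau) - 0) with (lam (- nome tau)) in K by ring; auto.
Qed.

Lemma mu_eq (tau : C) : (0 < Im tau)%R ->
  Cmod (mu tau) = (Cmod (lam (nome tau)) / Cmod (1 - lam (nome tau)))%R.
Proof.
  intros H; unfold mu; rewrite lam_opp, Cmod_opp, Cmod_div by
    (try apply one_minus_lam_neq0; apply nome_lt1, H); reflexivity.
Qed.

(** [Cmod (mu tau) < 1] means that lambda is closer to 0 than to 1. *)
Lemma mu_lt1_Re (tau : C) : (0 < Im tau)%R -> (Cmod (mu tau) < 1)%R -> (Re (lam (nome tau)) < 1 / 2)%R.
Proof.
  intros H; rewrite mu_eq by exact H; set (l := lam (nome tau)); intros L.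
  assert (P := proj1 (Cmod_gt_0 _) (one_minus_lam_neq0 _ (nome_lt1 tau H))); fold l in P.
  apply (Rmult_lt_compat_r (Cmod (1 - l))) in L; [| exact P].
  unfold Rdiv in L; rewrite Rmult_assoc, Rinv_l, Rmult_1_r, Rmult_1_l in L by lra.
  assert (A := Cmod2_alt l); assert (B := Cmod2_alt (1 - l)); assert (Q := Cmod_ge_0 l).
  assert (S : (Cmod l ^ 2 < Cmod (1 - l) ^ 2)%R) by nra.
  rewrite A, B in S.
  change (Re (1 - l)) with (1 + - Re l)%R in S; change (Im (1 - l)) with (0 + - Im l)%R in S; nra.
Qed.

Lemma mu_arc (tau : C) : (0 < Im tau)%R -> Cmod tau = 1%R -> Cmod (mu tau) = 1%R.
Proof.
  intros H U; rewrite mu_eq, <- arc_lam_conj, Cmod_conj by assumption; field.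
  assert (P := proj1 (Cmod_gt_0 _) (one_minus_lam_neq0 _ (nome_lt1 tau H))).
  rewrite <- arc_lam_conj, Cmod_conj in P by assumption; lra.
Qed.

(** On the edges [- nome tau] is the nome of a point of the imaginary axis, where lambda takes
    values in (0, 1). *)
Lemma mu_edge (tau : C) : (0 < Im tau)%R -> (Re tau = 1 \/ Re tau = -1)%R -> (Cmod (mu tau) < 1)%R.
Proof.
  intros H E.
  assert (K : - nome tau = nome (RtoC (Im tau) * Ci)).
  { destruct E as [E | E].
    - rewrite <- nome_minus1; f_equal; apply injective_projections; simpl; unfold Re, Im in *; lra.
    - rewrite <- nome_plus1; f_equal; apply injective_projections; simpl; unfold Re, Im in *; lra. }
  unfold mu; rewrite K, nome_imag.
  assert (B := exp_neg_PI_bounds (Im tau) H); assert (B' := rlam_bounds _ B).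
  rewrite lam_real, Cmod_R, Rabs_pos_eq by (exact B || lra); lra.
Qed.

(** Outside the unit disc, low height forces closeness to a cusp: [x^2 + y^2 >= 1] implies
    [1 - x <= y^2]. Once the cusp is moved to 0, the inversion has imaginary part
    [y / ((1 - x)^2 + y^2) >= 1 / (2 y) >= Y]. *)
Lemma cusp_shift (tau sg : C) (x y Y : R) : (0 < y)%R -> (1 < Y)%R -> (y <= / (2 * Y))%R ->
  (0 <= x <= 1)%R -> (1 <= x ^ 2 + y ^ 2)%R ->
  (Re sg ^ 2 = (1 - x) ^ 2)%R -> Im sg = y -> (Y <= Im (- / sg))%R.
Proof.
  intros Hy HY Hs Hx Hxy HR HI.
  assert (Hy1 : (2 * Y * y <= 1)%R).
  { apply (Rmult_le_compat_l (2 * Y)) in Hs; [| lra]; rewrite Rinv_r in Hs by lra; exact Hs. }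
  assert (N : sg <> 0) by (apply Im_pos_neq0; lra).
  rewrite Im_inv_opp, Cmod2_alt, HR, HI by exact N.
  assert (A : (1 - x <= y ^ 2)%R) by nra.
  assert (y <= 1 / 2)%R by nra.
  assert (B : ((1 - x) ^ 2 <= y ^ 2)%R) by nra.
  assert (D : (0 < (1 - x) ^ 2 + y ^ 2)%R) by nra.
  apply (Rmult_le_reg_r ((1 - x) ^ 2 + y ^ 2)); [exact D |].
  unfold Rdiv; rewrite Rmult_assoc, Rinv_l, Rmult_1_r by lra. nra.
Qed.

(** Shifting the cusp to 0 by [sg = tau - 1] or [sg = tau + 1] turns [mu tau] into
    [lam (nome sg) = 1 - lam (nome (- / sg))], and the last term is small because [- / sg] is high
    up. *)
Lemma mu_cusp (N : R) : (1 < N)%R -> exists d, (0 < d)%R /\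
  forall tau, inWbar tau -> (Im tau <= d)%R -> (Cmod (mu tau) < N)%R.
Proof.
  intros HN; destruct (lam_nome_small (N - 1)%R ltac:(lra)) as [Y [HY K]].
  exists (/ (2 * Y))%R; split; [apply Rinv_0_lt_compat; lra |]; intros tau [H1 [H2 H3]] Hd.
  assert (Q : (1 <= Re tau ^ 2 + Im tau ^ 2)%R) by (rewrite <- Cmod2_alt; nra).
  assert (F : forall sg, (0 < Im sg)%R -> (Y <= Im (- / sg))%R -> - nome tau = nome sg ->
    (Cmod (mu tau) < N)%R).
  { intros sg Hs HYs E; unfold mu; rewrite E.
    assert (T := S_transform_lam sg Hs).
    replace (lam (nome sg)) with (1 + - lam (nome (- / sg))) by (rewrite T; ring).
    eapply Rle_lt_trans; [apply Cmod_triangle |].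
    rewrite Cmod_1, Cmod_opp; destruct (K (- / sg) HYs) as [K1 _]; lra. }
  destruct (Rle_dec 0 (Re tau)) as [P | P].
  - apply (F (tau - 1)); [unfold Im in *; simpl; lra | | symmetry; apply nome_minus1].
    apply (cusp_shift tau (tau - 1) (Re tau) (Im tau)); try lra; unfold Re, Im; simpl; ring.
  - apply (F (tau + 1)); [unfold Im in *; simpl; lra | | symmetry; apply nome_plus1].
    apply (cusp_shift tau (tau + 1) (- Re tau) (Im tau)); try lra; try (unfold Re, Im; simpl; ring).
Qed.

(** A local maximum would make [mu] constant on the half-plane, whereas its modulus is below 1 high
    up. *)
Lemma mu_no_local_max (p : C) : (0 < Im p)%R -> (1 <= Cmod (mu p))%R ->
  ~ cnear p (fun w => (Cmod (mu w) <= Cmod (mu p))%R).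
Proof.
  intros Hp H1 Hmax.
  assert (Hn : cnear p (holo mu)) by (apply (cnear_impl _ _ _ holo_mu), cnear_Im_pos, Hp).
  assert (E := maximum_modulus mu p Hn Hmax).
  destruct (lam_nome_small 1 ltac:(lra)) as [Y [HY K]].
  assert (I : (Y <= Im (RtoC Y * Ci))%R) by (unfold Im; simpl; lra).
  assert (Z : mu (RtoC Y * Ci) - mu p = 0).
  { apply (upper_identity (fun w => mu w - mu p)) with (p := p); [| exact Hp | | lra].
    - intros t Ht; apply holo_minus; [apply holo_mu, Ht | apply holo_const].
    - apply cnear_zeros_cluster; revert E; apply cnear_impl; intros w ->; ring. }
  destruct (K _ I) as [_ K2].
  replace (mu (RtoC Y * Ci)) with (mu p) in K2; [lra |].
  rewrite <- (Cplus_0_l (mu p)), <- Z; ring.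
Qed.

Lemma inW_inWbar (tau : C) : inW tau -> inWbar tau.
Proof. unfold inW, inWbar; lra. Qed.

(** Assuming [N = Cmod (mu p) > 1], the domain can be truncated at a low height [d] and a large
    height [Y] beyond which the modulus stays below [N]. On the compact remainder the maximum is at
    least [N > 1], so it is attained neither on the edges, nor on the arc, nor on the two cuts; it
    would be a local maximum. *)
Lemma mu_le1 (p : C) : inWbar p -> (Cmod (mu p) <= 1)%R.
Proof.
  intros Hp; apply Rnot_lt_le; intros HN; set (N := Cmod (mu p)) in *.
  destruct (mu_cusp N HN) as [d [Hd Kd]].
  destruct (lam_nome_small 1 ltac:(lra)) as [Y [HY KY]].
  set (D := fun w => (-1 <= Re w <= 1 /\ 1 <= Cmod w /\ d <= Im w <= Y)%R).
  assert (DW : forall w, D w -> inWbar w) by (intros w; unfold D, inWbar; lra).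
  assert (Dp : D p).
  { destruct Hp as [P1 [P2 P3]]; unfold D; repeat split; try lra; apply Rnot_lt_le; intros L.
    - assert (T := Kd p ltac:(unfold inWbar; lra) ltac:(lra)); fold N in T; lra.
    - destruct (KY p ltac:(lra)) as [_ T]; fold N in T; lra. }
  destruct (compact_max D (fun w => Cmod (mu w)) (-1) 1 d Y) as [m [Dm Hm]].
  - intros w; unfold D; lra.
  - exists p; exact Dp.
  - intros w Hw; unfold D; repeat split; apply Rnot_lt_le; intros L.
    + destruct (Hw (-1 - Re w)%R ltac:(lra)) as [q [Dq Hq]].
      assert (A := re_le_Cmod (q - w)); change (Re (q - w)) with (Re q + - Re w)%R in A.
      assert (B := Rle_abs (Re q + - Re w)%R); unfold D in Dq; lra.
    + destruct (Hw (Re w - 1)%R ltac:(lra)) as [q [Dq Hq]].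
      assert (A := re_le_Cmod (q - w)); change (Re (q - w)) with (Re q + - Re w)%R in A.
      assert (B := Rle_abs (- (Re q + - Re w))%R); rewrite Rabs_Ropp in B; unfold D in Dq; lra.
    + destruct (Hw (1 - Cmod w)%R ltac:(lra)) as [q [Dq Hq]].
      assert (A := Cmod_rev_triangle q w); unfold D in Dq; lra.
    + destruct (Hw (d - Im w)%R ltac:(lra)) as [q [Dq Hq]].
      assert (A := im_le_Cmod (q - w)); change (Im (q - w)) with (Im q + - Im w)%R in A.
      assert (B := Rle_abs (Im q + - Im w)%R); unfold D in Dq; lra.
    + destruct (Hw (Im w - Y)%R ltac:(lra)) as [q [Dq Hq]].
      assert (A := im_le_Cmod (q - w)); change (Im (q - w)) with (Im q + - Im w)%R in A.
      assert (B := Rle_abs (- (Im q + - Im w))%R); rewrite Rabs_Ropp in B; unfold D in Dq; lra.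
  - intros w Dw e He; destruct (DW w Dw) as [_ [_ W3]].
    destruct (holo_cont _ _ (holo_mu w W3) e He) as [r [Hr K]].
    exists r; split; [exact Hr |]; intros q Hq; specialize (K q Hq).
    eapply Rle_lt_trans; [| exact K]; apply Rabs_le; split.
    + assert (T := Cmod_rev_triangle (mu w) (mu q)); rewrite Cmod_minus_sym in T; lra.
    + apply Cmod_rev_triangle.
  - assert (Nm := Hm p Dp); fold N in Nm.
    assert (Wm := DW m Dm); destruct Dm as [M1 [M2 M3]].
    assert (M0 : (0 < Im m)%R) by lra.
    apply (mu_no_local_max m M0); [lra |].
    assert (S1 : Re m <> 1%R) by (intros E; assert (T := mu_edge m M0 (or_introl E)); lra).
    assert (S2 : Re m <> (-1)%R) by (intros E; assert (T := mu_edge m M0 (or_intror E)); lra).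
    assert (S3 : Cmod m <> 1%R) by (intros E; assert (T := mu_arc m M0 E); lra).
    assert (S4 : (d < Im m)%R).
    { apply Rnot_le_lt; intros L; assert (T := Kd m Wm L); lra. }
    assert (S5 : (Im m < Y)%R).
    { apply Rnot_le_lt; intros L; destruct (KY m L) as [_ T]; lra. }
    assert (V : inW m) by (unfold inW; lra).
    assert (Hs : cnear m (fun w => (Cmod (w - m) < Rmin (Im m - d) (Y - Im m))%R)).
    { apply cnear_ball; rewrite Cmod_self; apply Rmin_pos; lra. }
    generalize (cnear_and _ _ _ (cnear_inW m V) Hs); apply cnear_impl.
    intros w [[W1 [W2 W3]] Hw]; apply Hm; unfold D.
    assert (A1 := Rlt_le_trans _ _ _ Hw (Rmin_l _ _)); assert (A2 := Rlt_le_trans _ _ _ Hw (Rmin_r _ _)).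
    assert (A := im_le_Cmod (w - m)); change (Im (w - m)) with (Im w + - Im m)%R in A.
    assert (B := Rle_abs (Im w + - Im m)%R).
    assert (B' := Rle_abs (- (Im w + - Im m))%R); rewrite Rabs_Ropp in B'; lra.
Qed.

Lemma mu_lt1 (tau : C) : inW tau -> (Cmod (mu tau) < 1)%R.
Proof.
  intros H; destruct (mu_le1 tau (inW_inWbar _ H)) as [L | E]; [exact L |]; exfalso.
  apply (mu_no_local_max tau); [apply H | lra |].
  rewrite E; apply (cnear_impl _ inW); [intros w Hw; apply mu_le1, inW_inWbar, Hw | apply cnear_inW, H].
Qed.

(** * The identities on the fundamental domain *)

Definition defect (tau : C) : C := tA (nome tau) * tA (nome tau) - Fext (lam (nome tau)).

Lemma holo_defect (tau : C) : (0 < Im tau)%R -> slit (lam (nome tau)) -> holo defect tau.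
Proof.
  intros H S; apply holo_minus; [apply holo_mult; apply holo_tA_nome, H |].
  apply (holo_comp (fun t => lam (nome t)) Fext); [apply holo_lam_nome, H | apply holo_Fext, S].
Qed.

Lemma holo_defect_W (tau : C) : inW tau -> holo defect tau.
Proof.
  intros H; apply holo_defect; [apply H | apply slit_Re].
  assert (A := mu_lt1_Re tau (proj2 (proj2 H)) (mu_lt1 tau H)); lra.
Qed.

Lemma defect_imag (y : R) : (0 < y)%R -> defect (RtoC y * Ci) = 0.
Proof.
  intros Hy; unfold defect; rewrite nome_imag.
  assert (B := exp_neg_PI_bounds y Hy); assert (B' := rlam_bounds _ B).
  rewrite lam_real, tA_real, Fext_real, Fr_rlam, <- RtoC_mult by (exact B || lra).
  rewrite <- RtoC_minus; f_equal; ring.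
Qed.

Lemma Cmod_lt_of_sqr (a b : C) : (Re a ^ 2 + Im a ^ 2 < Re b ^ 2 + Im b ^ 2)%R -> (Cmod a < Cmod b)%R.
Proof.
  rewrite <- !Cmod2_alt; assert (P := Cmod_ge_0 a); assert (Q := Cmod_ge_0 b); nra.
Qed.

Lemma sqr_of_Cmod_gt1 (a : C) : (1 < Cmod a)%R -> (1 < Re a ^ 2 + Im a ^ 2)%R.
Proof. rewrite <- Cmod2_alt; nra. Qed.

Lemma inW_sqr (a : C) : (-1 < Re a < 1)%R -> (0 < Im a)%R -> (1 < Re a ^ 2 + Im a ^ 2)%R -> inW a.
Proof.
  intros H1 H2 H3; repeat split; try lra.
  rewrite <- Cmod_1; apply Cmod_lt_of_sqr; unfold Re at 1, Im at 1; simpl fst; simpl snd; lra.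
Qed.

(** The domain is not convex, so the identity theorem is applied twice: horizontally at height 2,
    above the unit disc, from the imaginary axis to the abscissa of [tau], then vertically to
    [tau]. *)
Lemma defect_W (tau : C) : inW tau -> defect tau = 0.
Proof.
  intros H; set (x := Re tau); set (y := Im tau).
  assert (Hx := H); destruct Hx as [H1 [H2 H3]]; fold x in H1; fold y in H3.
  apply sqr_of_Cmod_gt1 in H2; fold x in H2; fold y in H2.
  set (c := ((x, 2) : C)).
  assert (Wc : cnear c (fun w => defect w = 0)).
  { apply (identity_segment defect (RtoC 2 * Ci)).
    - intros t Ht; apply (cnear_impl _ _ _ holo_defect_W), cnear_inW, inW_sqr;
        rewrite ?Re_segment, ?Im_segment; unfold c, Re, Im; simpl; nra.
    - apply zeros_cluster_imag; intros y' Hy'; apply defect_imag; lra. }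
  apply (cnear_self tau (fun w => defect w = 0)), (identity_segment defect c tau);
    [| apply cnear_zeros_cluster, Wc].
  intros t Ht; apply (cnear_impl _ _ _ holo_defect_W), cnear_inW.
  assert (ER : Re (c + RtoC t * (tau - c)) = x).
  { rewrite Re_segment; unfold c; change (Re ((x, 2%R) : C)) with x; fold x; ring. }
  assert (EI : Im (c + RtoC t * (tau - c)) = (2 + t * (y - 2))%R).
  { rewrite Im_segment; unfold c; change (Im ((x, 2%R) : C)) with 2%R; fold y; reflexivity. }
  assert (Ypos : (0 < 2 + t * (y - 2))%R).
  { destruct (Req_dec t 1) as [-> | N]; [lra | nra]. }
  apply inW_sqr; rewrite ?ER, ?EI; [exact H1 | exact Ypos |].
  destruct (Rle_dec y 2) as [L | L].
  - assert (y <= 2 + t * (y - 2))%R by nra.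
    assert (y ^ 2 <= (2 + t * (y - 2)) ^ 2)%R by (apply pow_incr; lra). lra.
  - assert (2 <= 2 + t * (y - 2))%R by nra.
    assert (2 ^ 2 <= (2 + t * (y - 2)) ^ 2)%R by (apply pow_incr; lra).
    assert (0 <= x ^ 2)%R by apply pow2_ge_0. lra.
Qed.

Lemma defect_limit (tau : C) : (0 < Im tau)%R -> slit (lam (nome tau)) ->
  (forall d, (0 < d)%R -> exists w, (Cmod (w - tau) < d)%R /\ inW w) -> defect tau = 0.
Proof.
  intros H S A; apply ccont_zero; [apply holo_cont, holo_defect; assumption |].
  intros d Hd; destruct (A d Hd) as [w [Hw W]]; exists w; split; [exact Hw | apply defect_W, W].
Qed.

Lemma defect_edge (tau : C) : (0 < Im tau)%R -> Re tau = 1%R -> defect tau = 0.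
Proof.
  intros H E; apply defect_limit; [exact H | |].
  - apply slit_Re; assert (A := mu_lt1_Re tau H (mu_edge tau H (or_introl E))); lra.
  - intros d Hd.
    (* The last bound keeps the shifted point outside the unit disc:
       [(1 - e)^2 + (Im tau)^2 > 1]. *)
    set (e := Rmin (1 / 2) (Rmin (d / 2) (Im tau ^ 2 / 4))).
    assert (He : (0 < e)%R) by (repeat apply Rmin_pos; nra).
    assert (e <= 1 / 2)%R by apply Rmin_l.
    assert (L := Rmin_r (1 / 2) (Rmin (d / 2) (Im tau ^ 2 / 4))); fold e in L.
    assert (L1 := Rmin_l (d / 2) (Im tau ^ 2 / 4)); assert (L2 := Rmin_r (d / 2) (Im tau ^ 2 / 4)).
    exists (tau - RtoC e); split.
    + replace (tau - RtoC e - tau) with (- RtoC e) by ring.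
      rewrite Cmod_opp, Cmod_R, Rabs_pos_eq; lra.
    + assert (ER : Re (tau - RtoC e) = (1 - e)%R) by (rewrite <- E; reflexivity).
      assert (EI : Im (tau - RtoC e) = Im tau) by (unfold Im; simpl; ring).
      apply inW_sqr; rewrite ?ER, ?EI; nra.
Qed.

Lemma defect_arc (tau : C) : (0 < Im tau)%R -> Cmod tau = 1%R -> (-1 < Re tau < 1)%R -> defect tau = 0.
Proof.
  intros H U HR; apply defect_limit; [exact H | |].
  - apply slit_Re; rewrite arc_lam_Re by assumption; lra.
  - intros d Hd; exists (tau + RtoC (d / 2) * Ci); split.
    + replace (tau + RtoC (d / 2) * Ci - tau) with (RtoC (d / 2) * Ci) by ring.
      rewrite Cmod_mult, Cmod_Ci, Cmod_R, Rabs_pos_eq; lra.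
    + assert (Q := Cmod2_alt tau); rewrite U in Q.
      assert (ER : Re (tau + RtoC (d / 2) * Ci) = Re tau) by (unfold Re; simpl; ring).
      assert (EI : Im (tau + RtoC (d / 2) * Ci) = (Im tau + d / 2)%R) by (unfold Im; simpl; ring).
      apply inW_sqr; rewrite ?ER, ?EI; nra.
Qed.

Lemma defect_0 (tau : C) : defect tau = 0 ->
  Fext (lam (nome tau)) = tA (nome tau) * tA (nome tau).
Proof.
  intros E; unfold defect in E.
  replace (Fext (lam (nome tau))) with (tA (nome tau) * tA (nome tau) -
    (tA (nome tau) * tA (nome tau) - Fext (lam (nome tau)))) by ring.
  rewrite E; ring.
Qed.

(** * The sign of the imaginary part of lambda on the arc *)

Lemma lam_nome_Ci : lam (nome Ci) = RtoC (1 / 2).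
Proof.
  assert (H : (0 < Im Ci)%R) by (simpl; lra).
  assert (R1 := arc_lam_Re Ci H Cmod_Ci).
  assert (E := S_transform_lam Ci H).
  rewrite unit_opp_inv in E by apply Cmod_Ci.
  replace (- Cconj Ci) with Ci in E by (apply injective_projections; simpl; ring).
  apply (f_equal Im) in E.
  change (Im (lam (nome Ci)) = 0 + - Im (lam (nome Ci)))%R in E.
  apply injective_projections; [exact R1 |]; change (Im (lam (nome Ci)) = 0%R); lra.
Qed.

(** If lambda is 1/2, then theta00^2 is the positive real number F(1/2,1/2,1;1/2), and the inversion
    formula [arc_tA_conj] forces [- i tau = 1]. *)
Lemma arc_lam_half (tau : C) : (0 < Im tau)%R -> Cmod tau = 1%R -> (-1 < Re tau < 1)%R ->
  Im (lam (nome tau)) = 0%R -> tau = Ci.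
Proof.
  intros H U HR I.
  assert (E : lam (nome tau) = RtoC (1 / 2)).
  { apply injective_projections; [exact (arc_lam_Re tau H U) | exact I]. }
  assert (F := defect_0 tau (defect_arc tau H U HR)).
  rewrite E, Fext_real in F by lra.
  assert (S := arc_tA_conj tau H U); rewrite <- F in S.
  assert (G := Fr_ge1 (1 / 2) (1 / 2) ltac:(lra) ltac:(lra)).
  set (r := Fr (1 / 2) (1 / 2)) in *.
  assert (A := f_equal fst S); assert (B := f_equal snd S); simpl in A, B.
  apply injective_projections; simpl; nra.
Qed.

Lemma pos_persist (f : R -> R) (a b u v : R) :
  (forall t, (a <= t <= b)%R -> continuity_pt f t) -> (forall t, (a <= t <= b)%R -> f t <> 0%R) ->
  (a <= u <= b)%R -> (a <= v <= b)%R -> (0 < f u)%R -> (0 < f v)%R.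
Proof.
  intros Hc Hn Hu Hv P; apply Rnot_le_lt; intros L.
  assert (L' : (f v < 0)%R) by (assert (N := Hn v Hv); lra).
  destruct (Rtotal_order u v) as [O | [-> | O]]; [| lra |].
  - destruct (IVT_interv (fun t => - f t)%R u v) as [z [Hz Ez]]; try lra.
    + intros t Ht; apply continuity_pt_opp, Hc; lra.
    + apply (Hn z); lra.
  - destruct (IVT_interv f v u) as [z [Hz Ez]]; try lra.
    + intros t Ht; apply Hc; lra.
    + apply (Hn z); lra.
Qed.

Lemma continuity_Im_lam (g : R -> C) (t : R) : rcont g t -> (0 < Im (g t))%R ->
  continuity_pt (fun t => Im (lam (nome (g t)))) t.
Proof.
  intros Hg H; apply continuity_pt_filterlim.
  exact (proj2 (rcont_comp g (fun w => lam (nome w)) t Hg (holo_cont _ _ (holo_lam_nome _ H)))).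
Qed.

(** On this line [tau - 1] is the mirror image of [tau], so [mu tau] is the conjugate of [l]. For
    real nonzero [l] the relation [- l / (1 - l) = l] gives [l = 2], contrary to [mu_le1]; the bound
    on [y] places the point outside the unit disc. *)
Lemma half_line_lam (y : R) : (3 / 4 <= y ^ 2)%R -> (0 < y)%R ->
  Im (lam (nome ((1 / 2)%R, y))) <> 0%R.
Proof.
  intros Hy Hy0; set (tau := ((1 / 2)%R, y) : C); intros I.
  assert (H : (0 < Im tau)%R) by exact Hy0.
  assert (Wt : inWbar tau).
  { split; [unfold tau; simpl; lra | split; [| exact H]].
    apply Rnot_lt_le; intros L; assert (Q := Cmod2_alt tau); assert (P := Cmod_ge_0 tau).
    assert (T : (Re tau ^ 2 + Im tau ^ 2 >= 1)%R) by (unfold tau, Re, Im; simpl fst; simpl snd; nra).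
    nra. }
  assert (M := mu_le1 tau Wt).
  assert (E : mu tau = Cconj (lam (nome tau))).
  { unfold mu; rewrite <- lam_conj, <- nome_conj, <- nome_minus1 by (apply nome_lt1, H).
    f_equal; f_equal; apply injective_projections; simpl; field. }
  assert (D := one_minus_lam_neq0 _ (nome_lt1 tau H)).
  assert (Er : lam (nome tau) = RtoC (Re (lam (nome tau))))
    by (apply injective_projections; [reflexivity | exact I]).
  unfold mu in E; rewrite lam_opp in E by (apply nome_lt1, H).
  unfold mu in M; rewrite lam_opp, E, Cmod_conj in M by (apply nome_lt1, H).
  set (l := lam (nome tau)) in *; set (r := Re l) in *.
  assert (Nr : r <> 0%R).
  { intros Z; rewrite Z in Er; unfold l, lam in Er.
    assert (N := Cmult_neq_0 _ _ (Cmult_neq_0 _ _ (Cmult_neq_0 16 _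
      ltac:(intros K; apply RtoC_inj in K; lra) (nome_neq0 tau))
      (Cpow_nz _ 4 (tpsi_neq0 _ (nome_lt1 tau H)))) (Cinv_neq0 _ (Cpow_nz _ 4 (tA_neq0 _ (nome_lt1 tau H))))).
    exact (N Er). }
  assert (E2 : l * (2 - l) = 0).
  { assert (El : Cconj l = l) by (rewrite Er; apply injective_projections; simpl; ring).
    rewrite El in E.
    assert (F : - l = l * (1 - l)).
    { rewrite <- E at 2; field; exact D. }
    replace (l * (2 - l)) with (l * (1 - l) + l) by ring; rewrite <- F; ring. }
  rewrite Er, Cmod_R in M; rewrite Er, <- RtoC_minus, <- RtoC_mult in E2.
  apply RtoC_inj, Rmult_integral in E2; destruct E2 as [E2 | E2]; [contradiction |].
  rewrite Rabs_pos_eq in M by lra; lra.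
Qed.

(** The nome is a positive multiple of [i] on this line, and lambda is close to 16 times the nome
    high up. *)
Lemma half_line_lam_large : exists y, (1 < y)%R /\ (0 < Im (lam (nome ((1 / 2)%R, y))))%R.
Proof.
  set (g := fun q => tpsi q ^ 4 / tA q ^ 4).
  assert (G0 : g 0 = 1) by (unfold g; rewrite tA_0, tpsi_0; field).
  assert (Cg : ccont g 0).
  { apply holo_cont, holo_div; [apply holo_pow, holo_tpsi, zero_lt1
      | apply holo_pow, holo_tA, zero_lt1 | apply Cpow_nz, tA_neq0, zero_lt1]. }
  destruct (Cg 1%R ltac:(lra)) as [d [Hd K]]; rewrite G0 in K.
  destruct (nome_small d Hd) as [Y [HY N]].
  exists Y; split; [exact HY |].
  set (tau := ((1 / 2)%R, Y) : C); specialize (N tau ltac:(unfold tau; simpl; lra)).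
  specialize (K (nome tau)); replace (nome tau - 0) with (nome tau) in K by ring.
  specialize (K N).
  assert (R1 := Rle_lt_trans _ _ _ (re_le_Cmod _) K).
  change (Re (g (nome tau) - 1)) with (Re (g (nome tau)) + - (1))%R in R1.
  apply Rabs_def2 in R1.
  assert (En : nome tau = RtoC (exp (- (PI * Y))) * Ci).
  { unfold nome.
    replace (PI * Ci * tau) with ((- (PI * Y), PI / 2)%R : C)
      by (unfold tau; apply injective_projections; simpl; field).
    unfold Cexp; simpl; rewrite cos_PI2, sin_PI2; apply injective_projections; simpl; ring. }
  assert (El : lam (nome tau) = RtoC (16 * exp (- (PI * Y))) * (Ci * g (nome tau))).
  { transitivity (16 * nome tau * g (nome tau)); [unfold lam, g, Cdiv; ring |].
    rewrite En at 1; rewrite RtoC_mult; ring. }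
  rewrite El.
  replace (Im (RtoC (16 * exp (- (PI * Y))) * (Ci * g (nome tau))))
    with (16 * exp (- (PI * Y)) * Re (g (nome tau)))%R.
  - assert (P := exp_pos (- (PI * Y))); nra.
  - generalize (g (nome tau)); intros w; unfold Re, Im; simpl; ring.
Qed.

(** The sign is carried from high up on the line [Re = 1/2] down to its intersection with the arc at
    height [sqrt 3 / 2], and from there along the arc; lambda is not real on either path, by
    [half_line_lam] and [arc_lam_half]. *)
Lemma arc_lam_Im_pos (tau : C) : (0 < Im tau)%R -> Cmod tau = 1%R -> (0 < Re tau < 1)%R ->
  (0 < Im (lam (nome tau)))%R.
Proof.
  intros H U HR.
  set (y1 := (sqrt 3 / 2)%R).
  assert (S3 : (0 < sqrt 3)%R) by (apply sqrt_lt_R0; lra).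
  assert (S33 : (sqrt 3 * sqrt 3 = 3)%R) by (apply sqrt_sqrt; lra).
  assert (A1 : (0 < Im (lam (nome ((1 / 2)%R, y1))))%R).
  { destruct half_line_lam_large as [y2 [Hy2 P2]].
    assert (y1 <= 1)%R by (unfold y1; nra).
    apply (pos_persist (fun y => Im (lam (nome ((1 / 2)%R, y)))) y1 y2 y2 y1); try lra.
    - intros y Hy; apply (continuity_Im_lam (fun y => ((1 / 2)%R, y))).
      + split; [apply continuous_const | apply continuous_id].
      + simpl; unfold y1 in Hy; lra.
    - intros y Hy; apply half_line_lam; unfold y1 in Hy; nra. }
  set (b := Re tau).
  assert (Q := Cmod2_alt tau); rewrite U in Q; fold b in Q.
  assert (Hb : (0 < b < 1)%R) by exact HR.
  set (f := fun x => Im (lam (nome ((x, sqrt (1 - x * x))%R : C)))).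
  assert (Ef : Im (lam (nome tau)) = f b).
  { unfold f; f_equal; f_equal; f_equal; apply injective_projections; [reflexivity |]; simpl.
    change (snd tau) with (Im tau).
    replace (1 - b * b)%R with (Im tau * Im tau)%R by nra.
    rewrite sqrt_square; lra. }
  rewrite Ef.
  (* The interval between [b] and 1/2 stays inside (0, 1), away from the zero at 0 that corresponds
     to [Ci]. *)
  apply (pos_persist f (Rmin b (1 / 2)) (Rmax b (1 / 2)) (1 / 2)).
  - intros x Hx.
    assert (B : (0 < x < 1)%R).
    { split; [eapply Rlt_le_trans; [apply Rmin_pos | apply Hx]; lra
        | eapply Rle_lt_trans; [apply Hx | apply Rmax_lub_lt]; lra]. }
    assert (P : (0 < 1 - x * x)%R) by nra.
    apply (continuity_Im_lam (fun x => (x, sqrt (1 - x * x))%R)).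
    + split; [apply continuous_id |].
      apply (ex_derive_continuous (K := R_AbsRing) (V := R_NormedModule)); simpl; auto_derive; lra.
    + simpl; apply sqrt_lt_R0, P.
  - intros x Hx.
    assert (B : (0 < x < 1)%R).
    { split; [eapply Rlt_le_trans; [apply Rmin_pos | apply Hx]; lra
        | eapply Rle_lt_trans; [apply Hx | apply Rmax_lub_lt]; lra]. }
    assert (P : (0 < 1 - x * x)%R) by nra.
    assert (P' : (0 < sqrt (1 - x * x))%R) by (apply sqrt_lt_R0, P).
    assert (PP : (sqrt (1 - x * x) * sqrt (1 - x * x) = 1 - x * x)%R) by (apply sqrt_sqrt; lra).
    intros Z.
    assert (K : ((x, sqrt (1 - x * x))%R : C) = Ci).
    { apply arc_lam_half; [exact P' | | simpl; lra | exact Z].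
      unfold Cmod; simpl fst; simpl snd.
      replace (x ^ 2 + sqrt (1 - x * x) ^ 2)%R with 1%R by nra; apply sqrt_1. }
    injection K; intros; lra.
  - split; [apply Rmin_r | apply Rmax_r].
  - split; [apply Rmin_l | apply Rmax_l].
  - unfold f; replace (sqrt (1 - 1 / 2 * (1 / 2))) with y1; [exact A1 |].
    unfold y1; symmetry; rewrite <- (sqrt_square (sqrt 3 / 2)) by lra; f_equal; nra.
Qed.

(** * Boundary values of the continuations *)

Lemma Clim_within (dom : C -> Prop) (z l : C) (f : C -> C) :
  (forall d, (0 < d)%R -> exists w, (Cmod (w - z) < d)%R /\ dom w) ->
  (forall e, (0 < e)%R -> exists d, (0 < d)%R /\ forall w, (Cmod (w - z) < d)%R -> dom w ->
     (Cmod (f w - l) < e)%R) ->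
  Clim (within dom (locally (T := C_UniformSpace) z)) f = l.
Proof.
  intros Hd Hl.
  assert (PF : ProperFilter' (within dom (locally (T := C_UniformSpace) z))).
  { constructor.
    - intros P; destruct (proj1 (locally_cnear z _) P) as [d [Hd0 K]].
      destruct (Hd d Hd0) as [w [Hw D]]; exact (K w Hw D).
    - apply within_filter, locally_filter. }
  apply (iota_filterlim_locally (K := C_AbsRing) (V := C_CompleteNormedModule)).
  intros P HP; apply (proj1 (locally_cnear l P)) in HP; destruct HP as [e [He K]].
  destruct (Hl e He) as [d [Hd0 K']].
  apply (proj2 (locally_cnear z _)); exists d; split; [exact Hd0 |].
  intros w Hw D; apply K, K'; assumption.
Qed.

(** Both continuations depend on [w] through [Csqrt (1 - w)], so every limit in [hyperF] reduces to
    the limit [s0] of this root. *)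
Definition sqrt_limit (dom : C -> Prop) (z s0 : C) : Prop :=
  (forall d, (0 < d)%R -> exists w, (Cmod (w - z) < d)%R /\ dom w) /\
  (forall w, dom w -> slit w) /\
  (forall e, (0 < e)%R -> exists d, (0 < d)%R /\ forall w, (Cmod (w - z) < d)%R -> dom w ->
     (Cmod (Csqrt (1 - w) - s0) < e)%R).

Lemma Clim_sqrt (dom : C -> Prop) (z s0 : C) (f Phi : C -> C) :
  sqrt_limit dom z s0 -> ccont Phi s0 ->
  (forall w, slit w -> f w = Phi (Csqrt (1 - w))) ->
  Clim (within dom (locally (T := C_UniformSpace) z)) f = Phi s0.
Proof.
  intros [H1 [H2 H3]] HP Hf; apply Clim_within; [exact H1 |].
  intros e He; destruct (HP e He) as [d [Hd K]], (H3 d Hd) as [d' [Hd' K']].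
  exists d'; split; [exact Hd' |]; intros w Hw D; rewrite Hf by (apply H2, D).
  apply K, K'; assumption.
Qed.

Lemma sqrt_limit_1 : sqrt_limit (fun w => (Cmod w < 1)%R) (RtoC 1) 0.
Proof.
  split; [| split].
  - intros d Hd.
    assert (P : (0 < Rmin d 1)%R) by (apply Rmin_pos; lra).
    assert (A := Rmin_l d 1); assert (B := Rmin_r d 1).
    exists (RtoC (1 - Rmin d 1 / 2)); rewrite <- RtoC_minus, !Cmod_R; split.
    + rewrite Rabs_left; lra.
    + rewrite Rabs_pos_eq; lra.
  - apply disc_slit.
  - intros e He; exists (e * e)%R; split; [nra |]; intros w Hw D.
    assert (Q := Csqrt_Cmod (1 - w) (proj1 (slit_offneg w) (disc_slit w D))).
    rewrite Cmod_minus_sym in Hw.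
    replace (Csqrt (1 - w) - 0) with (Csqrt (1 - w)) by ring.
    assert (P := Cmod_ge_0 (Csqrt (1 - w))); nra.
Qed.

Lemma Csqrt_Im_neg (z : C) : (Im z < 0)%R -> (Im (Csqrt z) < 0)%R.
Proof.
  intros H.
  assert (O : offneg z) by (intros [_ K]; lra).
  destruct (Csqrt_spec z O) as [E P].
  assert (E2 : (2 * (Re (Csqrt z) * Im (Csqrt z)) = Im z)%R).
  { rewrite <- E at 3; unfold Re, Im; simpl; ring. }
  nra.
Qed.

(** For [Im w > 0] the principal root of [1 - w] lies in the lower half-plane, which selects [- v i]
    among the two roots of [- v^2] and keeps its distance to [v i] at least [v]. *)
Lemma sqrt_limit_cut (v : R) : (0 < v)%R ->
  sqrt_limit (fun w => (0 < Im w)%R) (RtoC (1 + v * v)) (- (RtoC v * Ci)).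
Proof.
  intros Hv; split; [| split].
  - intros d Hd; exists (RtoC (1 + v * v) + RtoC (d / 2) * Ci); split.
    + replace (RtoC (1 + v * v) + RtoC (d / 2) * Ci - RtoC (1 + v * v)) with (RtoC (d / 2) * Ci) by ring.
      rewrite Cmod_mult, Cmod_Ci, Cmod_R, Rabs_pos_eq; lra.
    + unfold Im; simpl; lra.
  - intros w Hw; apply slit_Im; lra.
  - intros e He; exists (e * v)%R; split; [nra |]; intros w Hw D.
    assert (S : slit w) by (apply slit_Im; lra).
    destruct (Csqrt_spec (1 - w) (proj1 (slit_offneg w) S)) as [E _].
    assert (N := Csqrt_Im_neg (1 - w) ltac:(change (Im (1 - w)) with (0 + - Im w)%R; lra)).
    set (s := Csqrt (1 - w)) in *.
    assert (F : Cmod (w - RtoC (1 + v * v)) = (Cmod (s - - (RtoC v * Ci)) * Cmod (s + - (RtoC v * Ci)))%R).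
    { rewrite <- Cmod_mult, Cmod_minus_sym; f_equal.
      replace ((s - - (RtoC v * Ci)) * (s + - (RtoC v * Ci))) with (s * s - RtoC v * RtoC v * (Ci * Ci)) by ring.
      rewrite E; apply injective_projections; simpl; ring. }
    assert (G : (v <= Cmod (s + - (RtoC v * Ci)))%R).
    { eapply Rle_trans; [| apply im_le_Cmod].
      replace (Im (s + - (RtoC v * Ci))) with (Im s - v)%R by (unfold Im; simpl; ring).
      rewrite Rabs_left by lra; lra. }
    rewrite F in Hw; assert (P := Cmod_ge_0 (s - - (RtoC v * Ci))).
    apply (Rmult_lt_reg_r v); [exact Hv |]; nra.
Qed.

(** * Evaluation at zeta *)

Lemma zeta_eq (tau : C) : (0 < Im tau)%R ->
  zeta tau = 4 * lam (nome tau) * (1 - lam (nome tau)).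
Proof.
  intros H; unfold zeta; rewrite theta00_eq, theta01_eq, theta10_pow4, one_minus_lam by
    (try exact H; apply nome_lt1, H).
  assert (N := tA_neq0 _ (nome_lt1 tau H)); unfold lam; field; exact N.
Qed.

Lemma one_minus_2lam (tau : C) : (0 < Im tau)%R ->
  1 - 2 * lam (nome tau) = (theta 0 1 tau ^ 4 - theta 1 0 tau ^ 4) / theta 0 0 tau ^ 4.
Proof.
  intros H; rewrite theta00_eq, theta01_eq, theta10_pow4 by exact H.
  assert (N := tA_neq0 _ (nome_lt1 tau H)); assert (J := Jacobi_quartic _ (nome_lt1 tau H)).
  replace (tA (- nome tau) ^ 4) with (tA (nome tau) ^ 4 - 16 * nome tau * tpsi (nome tau) ^ 4)
    by (rewrite J; ring).
  unfold lam; field; exact N.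
Qed.

Lemma theta_quotient (tau : C) : (0 < Im tau)%R -> 1 - 2 * lam (nome tau) <> 0 ->
  tA (nome tau) * tA (nome tau) / (1 - 2 * lam (nome tau)) =
  theta 0 0 tau ^ 6 / (theta 0 1 tau ^ 4 - theta 1 0 tau ^ 4).
Proof.
  intros H N; rewrite one_minus_2lam in * by exact H.
  assert (N0 := tA_neq0 _ (nome_lt1 tau H)); rewrite <- theta00_eq in * by exact H.
  field; split; [| exact N0].
  intros K; apply N; rewrite K; unfold Cdiv; ring.
Qed.

(** [G14] and [G34] as functions of the root [s = Csqrt (1 - z)]. In this variable they extend
    continuously to the line [Re s = 0] of boundary values, except [Phi34] at 0. *)
Definition Phi14 (s : C) : C := Fext ((1 - s) / 2).
Definition Phi34 (s : C) : C := Phi14 s / s.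

Lemma half_one_minus (l : C) : (1 - (1 - 2 * l)) / 2 = l.
Proof. field; apply C2_neq0. Qed.

Lemma ccont_Phi14 (l : C) : slit l -> ccont Phi14 (1 - 2 * l).
Proof.
  intros H; apply (ccont_comp (fun s => (1 - s) / 2) Fext).
  - apply ccont_mult; [apply ccont_minus; [apply ccont_const | apply ccont_id] | apply ccont_const].
  - rewrite half_one_minus; apply holo_cont, holo_Fext, H.
Qed.

Lemma hyperF_slit (a b c z : C) : slit z -> hyperF a b c z = hyper_continuation a b c z.
Proof.
  intros H; unfold hyperF; destruct (Ceq_dec z 1) as [-> | N].
  - exfalso; apply H; simpl; lra.
  - destruct (excluded_middle_informative (1 < Re z /\ Im z = 0)%R) as [K | K]; [| reflexivity].
    exfalso; apply H; lra.
Qed.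

Lemma hyperF_cut (a b c : C) (x : R) : (1 < x)%R ->
  hyperF a b c (RtoC x) = Clim (within (fun w : C => (0 < Im w)%R)
    (locally (T := C_UniformSpace) (RtoC x))) (hyper_continuation a b c).
Proof.
  intros H; unfold hyperF; destruct (Ceq_dec (RtoC x) 1) as [E | N].
  - apply RtoC_inj in E; lra.
  - destruct (excluded_middle_informative (1 < Re (RtoC x) /\ Im (RtoC x) = 0)%R) as [K | K];
      [reflexivity | exfalso; apply K; simpl; lra].
Qed.

Lemma hyperF_1 (a b c : C) :
  hyperF a b c 1 = Clim (within (fun w : C => (Cmod w < 1)%R)
    (locally (T := C_UniformSpace) (RtoC 1))) (hyper_continuation a b c).
Proof. unfold hyperF; destruct (Ceq_dec 1 1) as [_ | N]; [reflexivity | congruence]. Qed.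

Lemma Re_one_minus_twice (l : C) : Re (1 - 2 * l) = (1 - 2 * Re l)%R.
Proof. unfold Re; simpl; ring. Qed.

Lemma one_minus_twice (l : C) : Re l = (1 / 2)%R -> 1 - 2 * l = - (RtoC (2 * Im l) * Ci).
Proof. intros H; apply injective_projections; simpl; unfold Re, Im in *; lra. Qed.

Lemma four_times_product (l : C) : Re l = (1 / 2)%R ->
  4 * l * (1 - l) = RtoC (1 + 2 * Im l * (2 * Im l)).
Proof.
  destruct l as [a b]; simpl; intros ->; apply injective_projections; simpl; field.
Qed.

(** As [Re (1 - 2 * l) > 0], the map [lambda_of] sends [zeta tau] back to [l], where [Fext] is known
    from [defect]. *)
Lemma hyper_values_off_arc (tau : C) : (0 < Im tau)%R -> (Re (lam (nome tau)) < 1 / 2)%R ->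
  defect tau = 0 ->
  zeta tau <> 1 /\
  hyperF (1 / 4) (1 / 4) 1 (zeta tau) = theta 0 0 tau ^ 2 /\
  hyperF (3 / 4) (3 / 4) 1 (zeta tau) = theta 0 0 tau ^ 6 / (theta 0 1 tau ^ 4 - theta 1 0 tau ^ 4).
Proof.
  intros H L D; rewrite zeta_eq by exact H; set (l := lam (nome tau)) in *.
  assert (Hs : (0 < Re (1 - 2 * l))%R).
  { rewrite Re_one_minus_twice; lra. }
  assert (E : 1 - 4 * l * (1 - l) = (1 - 2 * l) * (1 - 2 * l)).
  { replace (RtoC 4) with (RtoC 2 * RtoC 2) by (rewrite <- RtoC_mult; f_equal; ring); ring. }
  assert (Es : Csqrt (1 - 4 * l * (1 - l)) = 1 - 2 * l) by (rewrite E; apply Csqrt_unique, Hs).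
  assert (S : slit (4 * l * (1 - l))).
  { apply slit_offneg; rewrite E; apply offneg_sqr, Hs. }
  split; [intros K; rewrite K in S; apply S; simpl; lra |].
  rewrite !hyperF_slit, hyper_14, hyper_34 by exact S.
  unfold G34, G14, lambda_of; rewrite Es, half_one_minus; unfold l; rewrite (defect_0 tau D).
  rewrite <- theta00_eq at 1 2 by exact H; split; [ring |].
  rewrite <- theta_quotient; [reflexivity | exact H | apply pos_Re_neq0, Hs].
Qed.

(** With [v = 2 Im l > 0], [1 - 2 * l] is precisely the boundary value [- v i] of [sqrt_limit_cut]
    at the point [1 + v^2] of the cut. *)
Lemma hyper_values_arc (tau : C) : (0 < Im tau)%R -> Cmod tau = 1%R -> (0 < Re tau < 1)%R ->
  zeta tau <> 1 /\
  hyperF (1 / 4) (1 / 4) 1 (zeta tau) = theta 0 0 tau ^ 2 /\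
  hyperF (3 / 4) (3 / 4) 1 (zeta tau) = theta 0 0 tau ^ 6 / (theta 0 1 tau ^ 4 - theta 1 0 tau ^ 4).
Proof.
  intros H U HR.
  assert (L := arc_lam_Re tau H U); assert (I := arc_lam_Im_pos tau H U HR).
  assert (D := defect_0 tau (defect_arc tau H U ltac:(lra))).
  rewrite zeta_eq by exact H; set (l := lam (nome tau)) in *.
  set (v := (2 * Im l)%R); assert (Hv : (0 < v)%R) by (unfold v; lra).
  assert (Es : 1 - 2 * l = - (RtoC v * Ci)).
  { apply one_minus_twice, L. }
  assert (Ez : 4 * l * (1 - l) = RtoC (1 + v * v)).
  { apply four_times_product, L. }
  assert (Sl : slit l) by (apply slit_Im; lra).
  assert (C14 : ccont Phi14 (- (RtoC v * Ci))) by (rewrite <- Es; apply ccont_Phi14, Sl).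
  assert (N : 1 - 2 * l <> 0).
  { rewrite Es; intros K; apply (f_equal snd) in K; simpl in K; lra. }
  assert (V14 : Phi14 (- (RtoC v * Ci)) = tA (nome tau) * tA (nome tau)).
  { rewrite <- Es; unfold Phi14; rewrite half_one_minus; exact D. }
  rewrite Ez; split; [intros K; apply RtoC_inj in K; nra |].
  rewrite !hyperF_cut by nra; split.
  - rewrite (Clim_sqrt _ _ _ _ Phi14 (sqrt_limit_cut v Hv) C14) by (intros w Hw; apply hyper_14, Hw).
    rewrite V14, theta00_eq by exact H; ring.
  - rewrite (Clim_sqrt _ _ _ _ Phi34 (sqrt_limit_cut v Hv)).
    + unfold Phi34; rewrite V14, <- Es; apply theta_quotient; assumption.
    + apply ccont_mult; [exact C14 |].
      apply (ccont_inv (fun s => s)); [apply ccont_id | rewrite <- Es; exact N].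
    + intros w Hw; apply hyper_34, Hw.
Qed.

(** Here [l = 1/2], so the root tends to [1 - 2 * l = 0], a point at which [Phi14] is still
    continuous. *)
Lemma hyper_value_Ci : zeta Ci = 1 /\ hyperF (1 / 4) (1 / 4) 1 (zeta Ci) = theta 0 0 Ci ^ 2.
Proof.
  assert (H : (0 < Im Ci)%R) by (simpl; lra).
  assert (D := defect_0 Ci (defect_arc Ci H Cmod_Ci ltac:(simpl; lra))).
  assert (E : zeta Ci = 1).
  { rewrite zeta_eq, lam_nome_Ci, <- RtoC_minus, <- !RtoC_mult by exact H; f_equal; field. }
  split; [exact E |]; rewrite E, hyperF_1.
  assert (Z : 1 - 2 * RtoC (1 / 2) = 0) by (rewrite <- RtoC_mult, <- RtoC_minus; f_equal; field).
  rewrite (Clim_sqrt _ _ _ _ Phi14 sqrt_limit_1).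
  - rewrite <- Z; unfold Phi14; rewrite half_one_minus, <- lam_nome_Ci, D, theta00_eq by exact H; ring.
  - rewrite <- Z; apply ccont_Phi14, slit_Re; simpl; lra.
  - intros w Hw; apply hyper_14, Hw.
Qed.

Theorem theorem4p5 :
  forall tau : C, D12 tau ->
    hyperF (1 / 4) (1 / 4) 1 (zeta tau) = theta 0 0 tau ^ 2 /\
    (zeta tau <> 1 ->
       hyperF (3 / 4) (3 / 4) 1 (zeta tau)
       = theta 0 0 tau ^ 6 / (theta 0 1 tau ^ 4 - theta 1 0 tau ^ 4)) /\
    (zeta tau = 1 <-> tau = Ci).
Proof.
  intros tau HD.
  assert (generic : tau <> Ci -> zeta tau <> 1 /\
    hyperF (1 / 4) (1 / 4) 1 (zeta tau) = theta 0 0 tau ^ 2 /\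
    hyperF (3 / 4) (3 / 4) 1 (zeta tau)
      = theta 0 0 tau ^ 6 / (theta 0 1 tau ^ 4 - theta 1 0 tau ^ 4)).
  { intros N; destruct HD as [[H [HR HM]] | [H [HM HR]]].
    - destruct (Rle_lt_or_eq_dec _ _ (proj2 HR)) as [L | E].
      + assert (W : inW tau) by (unfold inW; lra).
        apply hyper_values_off_arc; [exact H | apply mu_lt1_Re, mu_lt1, W; exact H | apply defect_W, W].
      + apply hyper_values_off_arc; [exact H | | apply defect_edge; assumption].
        apply mu_lt1_Re; [exact H | apply mu_edge; [exact H | left; exact E]].
    - assert (Q := Cmod2_alt tau); rewrite HM in Q.
      apply hyper_values_arc; [exact H | exact HM |]; split; [| nra].
      destruct (Rle_lt_or_eq_dec _ _ (proj1 HR)) as [L | E]; [exact L |]; exfalso; apply N.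
      apply injective_projections; [symmetry; exact E |].
      rewrite <- E in Q; change (Im tau = 1%R); nra. }
  destruct (Ceq_dec tau Ci) as [-> | N].
  - destruct hyper_value_Ci as [E V]; split; [exact V | split; [contradiction | tauto]].
  - destruct (generic N) as [Z [V1 V2]]; repeat split; auto; contradiction.
Qed.
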